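(* Let $\mathbf A\in\mathbb R^{I\times R}$, $\mathbf B\in\mathbb R^{J\times R}$, $\mathbf C\in\mathbb R^{K\times R}$, let $\mathcal T=[\mathbf A,\mathbf B,\mathbf C]_R\in\mathbb R^{I\times J\times K}$ and let $n:=R-k_{\mathbf C}+2$. Suppose that the matrix $\mathcal C_n(\mathbf A)\odot\mathcal C_n(\mathbf B)$ has full column rank. Then (i) $r_{\mathcal T}=R$ and the CPD of $\mathcal T$ is unique; (ii) the CPD of $\mathcal T$ can be found algebraically.
   Context: All matrices and tensors are real. For $\mathbf A=[\mathbf a_1\cdots\mathbf a_R]\in\mathbb R^{I\times R}$, $\mathbf B=[\mathbf b_1\cdots\mathbf b_R]\in\mathbb R^{J\times R}$, $\mathbf C=[\mathbf c_1\cdots\mathbf c_R]\in\mathbb R^{K\times R}$, $[\mathbf A,\mathbf B,\mathbf C]_R:=\sum_{r=1}^R\mathbf a_r\circ\mathbf b_r\circ\mathbf c_r$, where $(\mathbf a\circ\mathbf b\circ\mathbf c)_{ijk}=a_ib_jc_k$; for nonzero $\mathbf a,\mathbf b,\mathbf c$ this is a rank-1 tensor. The rank $r_{\mathcal T}$ of a tensor $\mathcal T$ is the minimal number of rank-1 tensors whose sum is $\mathcal T$; a decomposition of $\mathcal T$ into $r_{\mathcal T}$ rank-1 terms is a Canonical Polyadic Decomposition (CPD). The CPD is unique if it is unique up to permuting the rank-1 terms and rescaling the vectors inside a rank-1 term while keeping the term unchanged. $k_{\mathbf M}$ (the $k$-rank of a matrix $\mathbf M$) is the largest number such that every subset of $k_{\mathbf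 M}$ columns of $\mathbf M$ is linearly independent. For $k\le\min(p,q)$, the $k$-th compound matrix $\mathcal C_k(\mathbf M)$ of $\mathbf M\in\mathbb R^{p\times q}$ is the $\binom pk\times\binom qk$ matrix of all $k\times k$ minors of $\mathbf M$, with row and column index sets in lexicographic order; a hypothesis involving $\mathcal C_k(\mathbf M)$ presupposes that it is defined. $\odot$ is the Khatri-Rao (column-wise Kronecker) product: $\mathbf X\odot\mathbf Y=[\mathbf x_1\otimes\mathbf y_1\ \cdots\ \mathbf x_N\otimes\mathbf y_N]$. A matrix with $N$ columns has full column rank if its rank is $N$. ''The CPD can be found algebraically'' means: there is a procedure that is guaranteed to find the (exact) decomposition from $\mathcal T$ and relies only on standard linear algebra, namely basic operations on matrices (including solving linear systems and matrix factorizations), computing compound matrices, taking the orthogonal complement of a subspace, and computing generalized eigenvalue decompositions of matrix pencils; taking random (generic) linear combinations of slices is allowed. *)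

(* Defs.v *)
From mathcomp Require Import all_boot all_order all_fingroup all_algebra.
From mathcomp Require Import reals boolp mxtens.

Set Implicit Arguments.
Unset Strict Implicit.
Unset Printing Implicit Defensive.

Import Order.TTheory GRing.Theory Num.Theory.
Local Open Scope ring_scope.

Section Tensors.
Context {F : realType} {I J K : nat}.

Definition tensor := {ffun 'I_I * 'I_J * 'I_K -> F}.

Definition outer (a : 'cV[F]_I) (b : 'cV[F]_J) (c : 'cV[F]_K) : tensor :=
  [ffun x => a x.1.1 0 * b x.1.2 0 * c x.2 0].

Definition cpd_tensor R (A : 'M[F]_(I, R)) (B : 'M[F]_(J, R)) (C : 'M[F]_(K, R))
    : tensor :=
  \sum_r outer (col r A) (col r B) (col r C).

Definition rank1 (t : tensor) : Prop :=
  exists a b c, [/\ a != 0, b != 0, c != 0 & t = outer a b c].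

Definition sum_of_rank1 (T : tensor) (r : nat) : Prop :=
  exists t : 'I_r -> tensor, (forall i, rank1 (t i)) /\ T = \sum_i t i.

Lemma sum_of_rank1_ex (T : tensor) : exists r, `[< sum_of_rank1 T r >].
Proof.
pose S := [set x | T x != 0]; exists #|S|; apply/asboolP.
pose e (x : 'I_I * 'I_J * 'I_K) :=
  outer (T x *: delta_mx x.1.1 0) (delta_mx x.1.2 0) (delta_mx x.2 0).
have e_eq x y : e x y = T x *+ (x == y).
  rewrite !ffunE !mxE !eqxx !andbT; case: x y => [[i j] k] [[i' j'] k'] /=.
  rewrite !xpair_eqE (eq_sym i) (eq_sym j) (eq_sym k).
  by case: (i' == i); case: (j' == j); case: (k' == k);
    rewrite /= ?(mulr0, mul0r, mulr1).
have delta_neq0 m (i : 'I_m) : delta_mx i 0 != 0 :> 'cV[F]_m.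
  by apply/eqP => /matrixP/(_ i 0); rewrite !mxE !eqxx => /eqP; rewrite oner_eq0.
exists (fun i => e (enum_val i)); split => [i|].
  do 3!eexists; split; last by []; rewrite ?delta_neq0 //.
  by rewrite scaler_eq0 negb_or delta_neq0 andbT; have := enum_valP i; rewrite inE.
rewrite -(@big_enum_val _ _ _ _ (mem S) e); apply/ffunP => y; rewrite sum_ffunE.
under eq_bigr do rewrite e_eq.
have [yS|yS] := boolP (y \in S).
  rewrite (bigD1 y) //= eqxx big1 ?addr0 // => x /andP[_ /negPf-> //].
rewrite big1 => [|x xS]; first by apply/eqP; rewrite inE negbK in yS.
by case: eqP => // xy; rewrite -xy xS in yS.
Qed.

Definition tensor_rank (T : tensor) : nat := ex_minn (sum_of_rank1_ex T).

Definition is_cpd (T : tensor) (R : nat)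
    (A : 'M[F]_(I, R)) (B : 'M[F]_(J, R)) (C : 'M[F]_(K, R)) : Prop :=
  [/\ R = tensor_rank T,
      forall r, [/\ col r A != 0, col r B != 0 & col r C != 0] &
      T = cpd_tensor A B C].

Definition cpd_unique (T : tensor) : Prop :=
  forall (R : nat) (A A' : 'M[F]_(I, R)) (B B' : 'M[F]_(J, R)) (C C' : 'M[F]_(K, R)),
    is_cpd T A B C -> is_cpd T A' B' C' ->
    exists (s : 'S_R) (al be ga : 'I_R -> F), forall r,
      [/\ al r * be r * ga r = 1,
          col r A' = al r *: col (s r) A,
          col r B' = be r *: col (s r) B &
          col r C' = ga r *: col (s r) C].

End Tensors.

Arguments tensor : clear implicits.

Definition krank (F : fieldType) p q (M : 'M[F]_(p, q)) : nat :=
  \max_(k < q.+1 | [forall S : {set 'I_q},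
                     (#|S| == k) ==> free [seq col j M | j <- enum S]]) k.

(* A k-subset of 'I_p is represented by its increasing enumeration. *)
Definition lex_subsets p k : seq (k.-tuple 'I_p) :=
  sort (fun s t : k.-tuple 'I_p =>
          ((map val s : seqlexi nat) <= (map val t : seqlexi nat))%O)
       (enum [set s : k.-tuple 'I_p | sorted ltn (map val s)]).

Lemma size_lex_subsets p k : size (lex_subsets p k) = 'C(p, k).
Proof. by rewrite size_sort -cardE card_ltn_sorted_tuples. Qed.

Definition lex_subset p k (i : 'I_'C(p, k)) : k.-tuple 'I_p :=
  tnth (Tuple (introT eqP (size_lex_subsets p k))) i.

Definition compound (F : fieldType) k p q (M : 'M[F]_(p, q))
    : 'M[F]_('C(p, k), 'C(q, k)) :=
  \matrix_(i, j) \det (mxsub (tnth (lex_subset i)) (tnth (lex_subset j)) M).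

Definition khatri_rao (F : fieldType) p q N (X : 'M[F]_(p, N)) (Y : 'M[F]_(q, N))
    : 'M[F]_(p * q, N) :=
  \matrix_(i, r) tensmx (col r X) (col r Y) i ord0.

Definition full_column_rank (F : fieldType) p q (M : 'M[F]_(p, q)) : bool :=
  \rank M == q.

(* The first two conditions say that the compound matrices are defined; without
   them C_n(A) and C_n(B) could have no column at all. *)
Definition compound_condition (F : realType) (I J K R : nat)
    (A : 'M[F]_(I, R)) (B : 'M[F]_(J, R)) (C : 'M[F]_(K, R)) : Prop :=
  let n := (R - krank C + 2)%N in
  [/\ (n <= minn I R)%N, (n <= minn J R)%N &
      full_column_rank (khatri_rao (compound n A) (compound n B))].

(* Algebraic procedures are first-order finite programs acting on a list of
   matrices.  They carry no real constants and cannot inspect real numbers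
   otherwise than through the operations below. *)
Inductive mxop : Type :=
| OpConst m n of 'M[int]_(m, n)
| OpAdd
| OpMul
| OpTrace
| OpTranspose
| OpKronecker
| OpRowBlock
| OpReshape of nat & nat
| OpCompound of nat
| OpSolve
| OpRankFactor
| OpLUP
| OpQR
| OpSVD
| OpOrthCompl
| OpGEVD.

(* [Return a b c] returns the matrices number a, b, c of the list.
   [Apply o args p q] applies [o] to the matrices number [args]: if [o] can be
   performed, its results are appended to the list and [p] is run, otherwise
   [q] is run.  [Draw p] appends a random scalar. *)
Inductive procedure : Type :=
| Return of nat & nat & nat
| Fail
| Apply of mxop & seq nat & procedure & procedure
| Draw of procedure.

Section Semantics.
Context {F : realType}.

Record anymx := AnyMx { nrows : nat; ncols : nat; mxof : 'M[F]_(nrows, ncols) }.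

Local Notation mx := (@AnyMx _ _).

(* An operation may have several results (a particular solution of a linear
   system, a basis of a subspace, ...) or none (incompatible sizes, inconsistent
   system, pencil that cannot be diagonalized over F, ...). *)
Inductive computes : mxop -> seq anymx -> seq anymx -> Prop :=
| CConst m n (N : 'M[int]_(m, n)) :
    computes (OpConst N) [::] [:: mx (map_mx intr N)]
| CAdd m n (M N : 'M[F]_(m, n)) :
    computes OpAdd [:: mx M; mx N] [:: mx (M + N)]
| CMul m n p (M : 'M[F]_(m, n)) (N : 'M[F]_(n, p)) :
    computes OpMul [:: mx M; mx N] [:: mx (M *m N)]
| CTrace n (M : 'M[F]_n) :
    computes OpTrace [:: mx M] [:: mx ((\tr M)%:M : 'M[F]_1)]
| CTranspose m n (M : 'M[F]_(m, n)) :
    computes OpTranspose [:: mx M] [:: mx M^T]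
| CKronecker m n p q (M : 'M[F]_(m, n)) (N : 'M[F]_(p, q)) :
    computes OpKronecker [:: mx M; mx N] [:: mx (tensmx M N)]
| CRowBlock m n p (M : 'M[F]_(m, n)) (N : 'M[F]_(m, p)) :
    computes OpRowBlock [:: mx M; mx N] [:: mx (row_mx M N)]
| CReshape m n p q (M : 'M[F]_(m, n)) (X : 'M[F]_(p, q)) :
    (m * n = p * q)%N ->
    (forall (i : 'I_m) (j : 'I_n) (k : 'I_p) (l : 'I_q),
       (i * n + j = k * q + l)%N -> X k l = M i j) ->
    computes (OpReshape p q) [:: mx M] [:: mx X]
| CCompound k m n (M : 'M[F]_(m, n)) :
    (k <= minn m n)%N ->
    computes (OpCompound k) [:: mx M] [:: mx (compound k M)]
| CSolve m n p (M : 'M[F]_(m, n)) (N : 'M[F]_(m, p)) (X : 'M[F]_(n, p)) :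
    M *m X = N ->
    computes OpSolve [:: mx M; mx N] [:: mx X]
| CRankFactor m n (M : 'M[F]_(m, n)) (X : 'M[F]_(m, \rank M))
    (Y : 'M[F]_(\rank M, n)) :
    M = X *m Y ->
    computes OpRankFactor [:: mx M] [:: mx X; mx Y]
| CLUP m n (M U : 'M[F]_(m, n)) (P L : 'M[F]_m) :
    is_perm_mx P -> is_trig_mx L -> (forall i, L i i = 1) ->
    (forall (i : 'I_m) (j : 'I_n), (j < i)%N -> U i j = 0) ->
    P *m M = L *m U ->
    computes OpLUP [:: mx M] [:: mx L; mx U; mx P]
| CQR m n (M S : 'M[F]_(m, n)) (Q : 'M[F]_m) :
    Q^T *m Q = 1%:M ->
    (forall (i : 'I_m) (j : 'I_n), (j < i)%N -> S i j = 0) ->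
    M = Q *m S ->
    computes OpQR [:: mx M] [:: mx Q; mx S]
| CSVD m n (M S : 'M[F]_(m, n)) (U : 'M[F]_m) (V : 'M[F]_n) :
    U^T *m U = 1%:M -> V^T *m V = 1%:M ->
    (forall (i : 'I_m) (j : 'I_n), i != j :> nat -> S i j = 0) ->
    (forall (i : 'I_m) (j : 'I_n), 0 <= S i j) ->
    M = U *m S *m V^T ->
    computes OpSVD [:: mx M] [:: mx U; mx S; mx V]
  (* The columns of X form a basis of the orthogonal complement of the column
     space of M. *)
| COrthCompl m n d (M : 'M[F]_(m, n)) (X : 'M[F]_(m, d)) :
    M^T *m X = 0 -> \rank X = d -> (\rank M + d = m)%N ->
    computes OpOrthCompl [:: mx M] [:: mx X]
  (* The columns of V are generalized eigenvectors of the pencil (M, N), with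
     generalized eigenvalues (al : be) in the real projective line. *)
| CGEVD n (M N V : 'M[F]_n) (al be : 'rV[F]_n) :
    V \in unitmx -> (forall i, (al 0 i != 0) || (be 0 i != 0)) ->
    M *m V *m diag_mx be = N *m V *m diag_mx al ->
    computes OpGEVD [:: mx M; mx N] [:: mx V; mx al; mx be].

Definition get (env : seq anymx) (i : nat) : anymx :=
  nth (mx (0 : 'M[F]_0)) env i.

(* Whatever results the operations deliver, and for all but finitely many values
   of each random scalar (the exceptional values may depend on everything
   computed before the draw), the run ends by returning three matrices that
   satisfy [post]. *)
Fixpoint guarantees (p : procedure) (env : seq anymx)
    (post : anymx -> anymx -> anymx -> Prop) : Prop :=
  match p with
  | Return a b c => post (get env a) (get env b) (get env c)
  | Fail => False
  | Apply o args p1 p2 =>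
      let ins := [seq get env i | i <- args] in
      (forall outs, computes o ins outs -> guarantees p1 (env ++ outs) post) /\
      ((forall outs, ~ computes o ins outs) -> guarantees p2 env post)
  | Draw p1 =>
      exists bad : seq F, forall x : F, x \notin bad ->
        guarantees p1 (rcons env (mx (x%:M : 'M[F]_1))) post
  end.

Definition slices I J K (T : tensor F I J K) : seq anymx :=
  [seq mx (\matrix_(i < I, j < J) T (i, j, k)) | k <- enum 'I_K].

Definition finds_cpd (p : procedure) I J K (T : tensor F I J K) : Prop :=
  guarantees p (slices T) (fun a b c =>
    exists (R : nat) (A : 'M[F]_(I, R)) (B : 'M[F]_(J, R)) (C : 'M[F]_(K, R)),
      [/\ a = mx A, b = mx B, c = mx C & is_cpd T A B C]).

End Semantics.

(* Main.v *)
Require Import Defs.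
From mathcomp Require Import all_boot all_order all_fingroup all_algebra.
From mathcomp Require Import reals boolp mxtens.
From mathcomp Require Import zify ring lra.

(** Write [n := R - k + 1] with [k] the k-rank of [C], so that the hypothesis is about
minors of order [n + 1]. The slab of the tensor in direction [x], a combination of
its slices, is [A diag(y) B^T] with [y = C^T x]. By the Cauchy-Binet formula
([minor_diag_prod], [vecc_compound]) its [(n + 1)]-minors are combinations of the
[(n + 1)]-fold products of entries of [y], and full column rank of the Khatri-Rao
product of the compound matrices says that these products can be recovered from the
minors. Hence a slab of rank at most [n] has a [y] with at most [n] non-zero entries
([card_supp_lt]). Moreover any [n + 1] columns of [A], or of [B], are independent, so
the column space of a slab whose [y] has support [Q], with at most [n] elements, is
the span of the columns of [A] in [Q] ([diag_prod_span]).

Uniqueness. If [A', B', C'] is another decomposition with [R] terms, possibly with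
zero columns, then a vector [x] with at most [n] non-zero entries in [C'^T x] has no
more non-zero entries in [C^T x]. This is the hypothesis of Kruskal's permutation
lemma, which is proved by counting columns in subspaces ([count_inside],
[permutation_lemma]), and [C'] is [C] up to order and scaling. The spans of [n]
columns of [A] are then seen in both decompositions. Since the spans of the [n]-subsets
through [r] of an independent [(n + 1)]-set intersect in the line of column [r]
([span_inter]), the columns of [A'] are proportional to those of [A], and likewise for
[B] ([cpd_uniqueness]). Padding with zero columns shows that no shorter
decomposition exists ([condition_rank]).

Algorithm. A random linear map compresses the third mode to dimension [k] while
keeping any [k] columns of [C] independent ([compresses_cons]). The columns of [C] are
now [n + k - 1] linear forms in [k] variables, and for every [n]-set [Q] of them there
is one star point, up to scaling, where exactly the forms in [Q] do not vanish. The
slab at this point reveals the span of the columns of [A] in [Q], so it suffices to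
find the star points. They are the common zeros of the products of [n + 1] forms, and
the [(n + 1)]-minors of the slabs span these products as functions of [x]; similarly
for [n], because the rank hypothesis passes to minors of order [n]
([minors_indep_pred]). Polynomials are handled through their values on an integer
grid large enough to determine them ([vanish_grid]). Multiplication by a linear form
[l], from the span of the products of [n] forms to functions modulo products of
[n + 1] forms, is diagonal: the product over [Q] is multiplied by the value of [l] at
the star point of [Q] ([pencil_diag], [pencil_left_indep]). A pencil made of two random
forms therefore has the products of [n] forms as its generalized eigenvectors
([eigenvectors_of_diag]), and from an eigenvector the star point is read off by a rank
factorization ([wp_star]). Intersections of column spaces are computed with orthogonal
complements ([meet_spans]); they give [A] and [B] up to scaling, and then [C] solves a
linear system.

The order of the eigenvectors and the numbers [R] and [k] are unknown. They are
guessed exhaustively, by increasing [R]. A guess is accepted if the last linear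
system is solvable; its solution is then a decomposition with at most as many terms
as the rank, whence a CPD ([finish_safe], [is_cpd_of_size]), and the right guess is
accepted whatever the outcomes of the computation ([attempt_sure]).

Procedures are written as matrix expressions, compiled to runs with explicit indices
([compile]); the predicate transformer [wp] describes their possible values. *)


Set Implicit Arguments.
Unset Strict Implicit.
Unset Printing Implicit Defensive.

Import Order.TTheory GRing.Theory Num.Theory.
Local Open Scope ring_scope.

(** * Generic vectors *)

Section Generic.
Context {F : realType}.

Lemma roots_in_seq (p : {poly F}) :
  p != 0 -> exists bad : seq F, forall t, root p t -> t \in bad.
Proof.
elim: {p}(size p) {-2}p (leqnn (size p)) => [|m IH] p szp p0.
  by move: p0; rewrite -size_poly_eq0 -leqn0 szp.
have [[a ra]|nra] := pselect (exists a, root p a); last first.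
  by exists [::] => t rt; case: nra; exists t.
have [q pE] := factor_theorem p a ra; have q0 : q != 0.
  by apply: contraNneq p0 => q0; rewrite pE q0 mul0r.
have [|bad badP] := IH q _ q0.
  by move: szp; rewrite pE size_Mmonic ?monicXsubC // size_XsubC addn2.
exists (a :: bad) => t; rewrite pE rootM root_XsubC in_cons orbC.
by case/orP => [->//|/badP ->]; rewrite orbT.
Qed.

Lemma exists_notin (s : seq F) : exists t, t \notin s.
Proof.
exists (1 + \sum_(b <- s) `|b|); apply/negP => ts.
have : `|1 + \sum_(b <- s) `|b| | <= \sum_(b <- s) `|b|.
  by rewrite [leRHS](big_rem _ ts) /= lerDl sumr_ge0.
have s0 : 0 <= \sum_(b <- s) `|b| :> F by apply: sumr_ge0.
by rewrite ger0_norm; lra.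
Qed.

Definition moment m (t : F) : 'cV[F]_m := \col_j t ^+ j.

(** [v *m moment m t] is the value at [t] of the polynomial with coefficients [v]:
one random scalar is enough to draw a vector that avoids finitely many hyperplanes. *)
Lemma moment_generic m (vs : seq 'rV[F]_m) :
  (forall v, v \in vs -> v != 0) ->
  exists bad : seq F, forall t, t \notin bad ->
    forall v, v \in vs -> v *m moment m t != 0.
Proof.
elim: vs => [|v vs IH] vs0; first by exists [::].
have [|bad badP] := IH; first by move=> w wvs; rewrite vs0 // in_cons wvs orbT.
pose p := \poly_(j < m) (if insub j is Some i then v 0 i else 0).
have p_coef (i : 'I_m) : p`_i = v 0 i by rewrite coef_poly ltn_ord valK.
have [|bad' bad'P] := @roots_in_seq p.
  have : v != 0 by rewrite vs0 // mem_head.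
  apply: contraNneq => p0; apply/eqP/rowP => i.
  by rewrite -p_coef p0 coef0 mxE.
exists (bad' ++ bad) => t; rewrite mem_cat negb_or => /andP[t1 t2] w.
rewrite in_cons => /orP[/eqP->|]; last exact: badP.
apply: contra t1 => /eqP/rowP/(_ 0); rewrite !mxE => e; apply: bad'P.
rewrite /root horner_poly; apply/eqP; rewrite -[RHS]e; apply: eq_bigr => i _.
by rewrite valK !mxE.
Qed.

Lemma kernel_generic m K (W : 'M[F]_(m, K)) (vs : seq 'rV[F]_K) :
  (forall v, v \in vs -> ~~ (v <= W)%MS) ->
  exists x : 'cV[F]_K, W *m x = 0 /\ forall v, v \in vs -> v *m x != 0.
Proof.
move=> vsW.
have [|bad badP] := @moment_generic K [seq v *m cokermx W | v <- vs].
  by move=> _ /mapP[v vvs ->]; rewrite -submxE vsW.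
have [t tbad] := exists_notin bad.
exists (cokermx W *m moment K t); split.
  by rewrite mulmxA mulmx_coker mul0mx.
by move=> v vvs; rewrite mulmxA (badP t) //; apply: map_f.
Qed.

End Generic.

(** * Spans of sets of rows *)

Section Spans.
Context {F : realType} {R K : nat}.
Implicit Types (D : 'M[F]_(R, K)) (S : {set 'I_R}).

Definition rows_in S D : 'M[F]_(R, K) := \matrix_(r, j) (D r j *+ (r \in S)).

Lemma row_rows_in S D r : row r (rows_in S D) = row r D *+ (r \in S).
Proof. by apply/rowP => j; rewrite !mxE; case: (r \in S); rewrite ?mulr1n ?mulr0n !mxE. Qed.

Lemma rows_in_subP S D m (W : 'M[F]_(m, K)) :
  reflect (forall s, s \in S -> (row s D <= W)%MS) (rows_in S D <= W)%MS.
Proof.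
apply: (iffP row_subP) => [H s sS|H s].
  by have := H s; rewrite row_rows_in sS mulr1n.
by rewrite row_rows_in; case: (boolP (s \in S)) => sS; rewrite ?mulr1n ?mulr0n ?sub0mx ?H.
Qed.

Lemma row_sub_rows_in S D s : s \in S -> (row s D <= rows_in S D)%MS.
Proof. by move=> sS; apply: (rows_in_subP _ _ _ _). Qed.

Lemma rows_in_subset S S' D : S \subset S' -> (rows_in S D <= rows_in S' D)%MS.
Proof. by move=> /subsetP sS; apply/rows_in_subP => s /sS; apply: row_sub_rows_in. Qed.

Lemma sub_rows_inP S D (v : 'rV[F]_K) :
  (v <= rows_in S D)%MS ->
  exists u : 'rV[F]_R, v = \sum_(s in S) u 0 s *: row s D.
Proof.
case/submxP => u ->; exists u; rewrite mulmx_sum_row [RHS]big_mkcond /=.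
by apply: eq_bigr => s _; rewrite row_rows_in; case: (s \in S); rewrite ?mulr1n ?mulr0n ?scaler0.
Qed.

Lemma rank_rows_in_le S D : (\rank (rows_in S D) <= #|S|)%N.
Proof.
apply: leq_trans (rank_leq_row (rowsub (enum_val : 'I_#|S| -> 'I_R) D)).
apply/mxrankS/rows_in_subP => s sS.
have -> : row s D = row (enum_rank_in sS s) (rowsub (enum_val : 'I_#|S| -> 'I_R) D).
  by apply/rowP => j; rewrite !mxE enum_rankK_in.
exact: row_sub.
Qed.

(** The rows of [D] have k-rank at least [k] (all of them are independent if there are
fewer than [k]), in the form used below: a row is never in the span of fewer than [k]
others. *)
Definition kfree k D := forall S r,
  r \notin S -> (#|S| < k)%N -> ~~ (row r D <= rows_in S D)%MS.

Lemma kfreeW k k' D : (k' <= k)%N -> kfree k D -> kfree k' D.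
Proof. by move=> lk H S r rS Sk; apply: H => //; apply: leq_trans lk. Qed.


Lemma rank_rows_in k D S : kfree k D -> (#|S| <= k)%N -> \rank (rows_in S D) = #|S|.
Proof.
move=> kf; move eS: #|S| => m; elim: m S eS => [|m IH] S eS mk.
  by apply/eqP; rewrite -leqn0 -eS rank_rows_in_le.
have [r rS] : exists r, r \in S by apply/card_gt0P; rewrite eS.
have eS' : #|S :\ r| = m by have := cardsD1 r S; rewrite rS eS => -[].
apply/eqP; rewrite eqn_leq -{1}eS rank_rows_in_le /= -(IH _ eS' (ltnW mk)).
rewrite -[(_ < _)%N]/(_ < _)%N ltn_neqAle mxrankS ?rows_in_subset ?subD1set // andbT.
rewrite (mxrank_leqif_eq (rows_in_subset _ (subD1set S r))).2.
apply: contra (kf (S :\ r) r _ _) => [||]; rewrite ?setD11 ?eS' //.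
by case/andP => _; apply: submx_trans; rewrite row_sub_rows_in.
Qed.

Lemma superset_of_card (U : {set 'I_R}) k : (#|U| <= k <= R)%N ->
  exists2 T : {set 'I_R}, U \subset T & #|T| = k.
Proof.
case/andP=> Uk kR; elim: {k}(k - #|U|)%N {-2}k (erefl (k - #|U|)%N) kR Uk => [|m IH] k.
  by move=> e kR Uk; exists U => //; apply/eqP; rewrite eqn_leq Uk -subn_eq0 e.
case: k => // k e kR Uk; have {}Uk : (#|U| <= k)%N by lia.
have [|T UT cT] := IH k _ (ltnW kR) Uk; first by lia.
have [x xT] : exists x, x \notin T.
  have /card_gt0P[x] : (0 < #|~: T|)%N.
    by have := cardsC T; rewrite card_ord cT; lia.
  by rewrite inE; exists x.
exists (x |: T); first exact: subset_trans UT (subsetU1 _ _).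
by rewrite cardsU1 xT cT.
Qed.

(** A row in the span of fewer than [k] others would lower the rank of every
[k]-set containing all of them. *)
Lemma kfree_rank k D : (k <= R)%N ->
  (forall S, #|S| = k -> (k <= \rank (rows_in S D))%N) -> kfree k D.
Proof.
move=> kR H S r rS Sk; apply/negP => rW.
have [T [ST rT cT]] : exists T : {set 'I_R}, [/\ S \subset T, r \in T & #|T| = k].
  have [|T ST cT] := @superset_of_card (r |: S) k.
    by rewrite cardsU1 rS kR add1n Sk.
  exists T; split=> //; first exact: subset_trans (subsetU1 _ _) ST.
  by apply: (subsetP ST); rewrite setU11.
have := H T cT; rewrite leqNgt => /negP; apply.
apply: leq_ltn_trans (_ : #|T :\ r| < k)%N; last by rewrite -cT (cardsD1 r T) rT.
apply: leq_trans (rank_rows_in_le (T :\ r) D); apply/mxrankS/rows_in_subP => s sT.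
have [->|sr] := eqVneq s r; last by rewrite row_sub_rows_in // !inE sr.
apply: submx_trans rW _; apply: rows_in_subset; apply/subsetP => x xS.
rewrite !inE (subsetP ST) // andbT; by apply: contraNneq rS => <-.
Qed.

Lemma exists_dual k D (S : {set 'I_R}) r : kfree k D -> (#|S| <= k)%N -> r \in S ->
  exists z : 'cV[F]_K, row r D *m z = 1%:M /\
    forall s, s \in S -> s != r -> row s D *m z = 0.
Proof.
move=> kf Sk rS; have [|z [Wz vz]] := @kernel_generic F _ _ (rows_in (S :\ r) D) [:: row r D].
  move=> v; rewrite inE => /eqP->; apply: kf; rewrite ?setD11 //.
  by apply: leq_trans Sk; rewrite (cardsD1 r S) rS.
have := vz _ (mem_head _ _); set a := row r D *m z => a0.
have a00 : a 0 0 != 0 by apply: contraNneq a0 => e; rewrite [a]mx11_scalar e raddf0.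
exists ((a 0 0)^-1 *: z); split=> [|s sS sr]; rewrite -scalemxAr.
  by rewrite -/a [X in _ *: X]mx11_scalar scale_scalar_mx mulVf.
have : row s (rows_in (S :\ r) D) *m z = 0 by rewrite -row_mul Wz row0.
by rewrite row_rows_in !inE sr sS mulr1n => ->; rewrite scaler0.
Qed.

(** In the coordinates given by the independent rows in [M], lying in the span of
[M :\ s] means that coordinate [s] is zero; only coordinate [r] survives. *)
Lemma span_inter k D (M : {set 'I_R}) r (v : 'rV[F]_K) :
  kfree k D -> (#|M| <= k)%N -> r \in M -> (1 < #|M|)%N ->
  (forall s, s \in M -> s != r -> (v <= rows_in (M :\ s) D)%MS) ->
  exists a, v = a *: row r D.
Proof.
move=> kf Mk rM M1 vM.
have [s0 s0M s0r] : exists2 s, s \in M & s != r.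
  have /card_gt0P[s] : (0 < #|M :\ r|)%N by move: M1; rewrite (cardsD1 r M) rM.
  by rewrite !inE => /andP[sr sM]; exists s.
have [u vE] := sub_rows_inP (submx_trans (vM _ s0M s0r) (rows_in_subset _ (subD1set M s0))).
exists (u 0 r); rewrite vE (bigD1 r) //= big1 ?addr0 // => s /andP[sM sr].
have [z [z1 z0]] := exists_dual kf Mk sM.
have vz : v *m z = (u 0 s)%:M.
  rewrite vE mulmx_suml (bigD1 s) //= -scalemxAl z1 scale_scalar_mx mulr1.
  by rewrite big1 ?addr0 // => i /andP[iM is_]; rewrite -scalemxAl z0 ?scaler0.
have [w vE'] := sub_rows_inP (vM _ sM sr).
move: vz; rewrite vE' mulmx_suml big1 => [/matrixP/(_ 0 0)|i].
  by rewrite !mxE eqxx mulr1n => <-; rewrite scale0r.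
by rewrite !inE => /andP[is_ iM]; rewrite -scalemxAl z0 ?scaler0.
Qed.

End Spans.

(** * Minors and the Cauchy-Binet formula *)

Section LexSubsets.
Context {R n : nat}.

Lemma lex_subset_sorted (i : 'I_'C(R, n)) : sorted ltn (map val (lex_subset i)).
Proof.
have : lex_subset i \in lex_subsets R n.
  by rewrite /lex_subset; apply: (mem_tnth i (Tuple _)).
by rewrite mem_sort mem_enum inE.
Qed.

Lemma lex_subset_uniq (i : 'I_'C(R, n)) : uniq (lex_subset i).
Proof.
rewrite -(map_inj_uniq val_inj); apply: sorted_uniq (lex_subset_sorted i).
- exact: ltn_trans.
- exact: ltnn.
Qed.

Lemma lex_subset_inj (i : 'I_'C(R, n)) : injective (tnth (lex_subset i)).
Proof. by apply/tuple_uniqP/lex_subset_uniq. Qed.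

Definition subset_at (i : 'I_'C(R, n)) : {set 'I_R} := [set x in lex_subset i].

Lemma card_subset_at i : #|subset_at i| = n.
Proof. by rewrite cardsE (card_uniqP (lex_subset_uniq i)) size_tuple. Qed.

Lemma subset_at_inj : injective subset_at.
Proof.
move=> i j eij; have : lex_subset i = lex_subset j.
  apply/val_inj/(inj_map val_inj)/(irr_sorted_eq ltn_trans ltnn).
  - exact: lex_subset_sorted.
  - exact: lex_subset_sorted.
  have e : lex_subset i =i lex_subset j by move=> x; have /setP/(_ x) := eij; rewrite !inE.
  by move=> x; apply/mapP/mapP => -[y yi ->]; exists y; rewrite // ?e // -e.
have u : uniq (lex_subsets R n) by rewrite sort_uniq enum_uniq.
by move=> H; apply: (tuple_uniqP (Tuple (introT eqP (size_lex_subsets R n))) u).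
Qed.

Lemma subset_at_surj (S : {set 'I_R}) : #|S| = n -> exists i, subset_at i = S.
Proof.
move=> cS; have e : subset_at @: setT = [set T : {set 'I_R} | #|T| == n].
  apply/eqP; rewrite eqEcard; apply/andP; split.
    by apply/subsetP => _ /imsetP[i _ ->]; rewrite inE card_subset_at.
  rewrite card_imset; last exact: subset_at_inj.
  by rewrite cardsT !card_ord -[leqLHS]/(#|_|) card_draws card_ord.
have : S \in subset_at @: setT by rewrite e inE cS.
by case/imsetP => i _ ->; exists i.
Qed.

Lemma mem_subset_at i x : x \in subset_at i -> exists j, x = tnth (lex_subset i) j.
Proof. by rewrite inE => /tnthP[j ->]; exists j. Qed.

Lemma tnth_subset_at i j : tnth (lex_subset i) j \in subset_at i.
Proof. by rewrite inE mem_tnth. Qed.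

(** Groups the injective maps by their image, as needed for the Cauchy-Binet
formula. *)
Lemma inj_lex_perm (f : 'I_n -> 'I_R) : injective f ->
  exists i (s : 'S_n), f =1 (fun j => tnth (lex_subset i) (s j)).
Proof.
move=> fi; have [|i eS] := @subset_at_surj (f @: setT).
  by rewrite card_imset // cardsT card_ord.
have ex j : exists k, f j == tnth (lex_subset i) k.
  by have [|k ->] := @mem_subset_at i (f j); [rewrite eS imset_f | exists k].
pose g j := xchoose (ex j); have gP j : f j = tnth (lex_subset i) (g j) by apply/eqP/(xchooseP (ex j)).
have gi : injective g by move=> j k e; apply: fi; rewrite !gP e.
by exists i, (perm gi) => j; rewrite permE.
Qed.

End LexSubsets.

Section CauchyBinet.
Context {F : fieldType}.

Lemma det_mulmx_sum n R (X : 'M[F]_(n, R)) (Y : 'M[F]_(R, n)) :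
  \det (X *m Y) = \sum_(f : {ffun 'I_n -> 'I_R})
     (\prod_j X j (f j)) * \det (rowsub f Y).
Proof.
rewrite /determinant; under [RHS]eq_bigr do rewrite mulr_sumr.
rewrite exchange_big; apply: eq_bigr => s _ /=.
under [RHS]eq_bigr do rewrite mulrCA; rewrite -mulr_sumr; congr (_ * _).
under eq_bigr do rewrite mxE; rewrite bigA_distr_bigA /=.
by apply: eq_bigr => f _; rewrite -big_split /=; apply: eq_bigr => j _; rewrite mxE.
Qed.

Lemma det_rowsub_perm n R (Y : 'M[F]_(R, n)) (f : 'I_n -> 'I_R) (s : 'S_n) :
  \det (rowsub (fun j => f (s j)) Y) = (-1) ^+ s * \det (rowsub f Y).
Proof.
have -> : rowsub (fun j => f (s j)) Y = row_perm s (rowsub f Y).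
  by apply/matrixP => i j; rewrite !mxE.
by rewrite row_permE det_mulmx det_perm.
Qed.

Lemma det_rowsub_noninj n R (Y : 'M[F]_(R, n)) (f : 'I_n -> 'I_R) :
  ~ injective f -> \det (rowsub f Y) = 0.
Proof.
move=> /injectiveP/injectivePn[i [j ij e]].
by apply: (determinant_alternate ij) => k; rewrite !mxE e.
Qed.

Lemma cauchy_binet n R (X : 'M[F]_(n, R)) (Y : 'M[F]_(R, n)) :
  \det (X *m Y) = \sum_(i : 'I_'C(R, n))
     \det (colsub (tnth (lex_subset i)) X) * \det (rowsub (tnth (lex_subset i)) Y).
Proof.
pose h (p : 'I_'C(R, n) * 'S_n) : {ffun 'I_n -> 'I_R} := [ffun j => tnth (lex_subset p.1) (p.2 j)].
have h_inj : injective h.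
  move=> [i s] [j t] /ffunP e; have eij : i = j.
    apply/subset_at_inj/eqP; rewrite eqEcard !card_subset_at leqnn andbT.
    apply/subsetP => _ /mem_subset_at[k ->].
    have := e (s^-1 k)%g; rewrite !ffunE /= permKV => ->; exact: tnth_subset_at.
  rewrite eij in e *; congr (_, _); apply/permP => k; apply: (@lex_subset_inj _ _ j).
  by have := e k; rewrite !ffunE.
rewrite det_mulmx_sum (bigID (mem (h @: setT))) /= [X in _ + X]big1 ?addr0; last first.
  move=> f fn; rewrite det_rowsub_noninj ?mulr0 // => /inj_lex_perm[i [s fE]].
  by case/imsetP: fn; exists (i, s) => //; apply/ffunP => j; rewrite ffunE fE.
rewrite big_imset /=; last by move=> ? ? _ _; apply: h_inj.
rewrite (eq_bigl xpredT) => [|p]; last by rewrite inE.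
rewrite -(pair_bigA _ (fun i s => (\prod_j X j (h (i, s) j)) * \det (rowsub (h (i, s)) Y))).
apply: eq_bigr => i _ /=; rewrite {3}/determinant mulr_suml; apply: eq_bigr => s _.
have -> : \det (rowsub (h (i, s)) Y) = (-1) ^+ s * \det (rowsub (tnth (lex_subset i)) Y).
  by rewrite -det_rowsub_perm; congr (\det _); apply/matrixP => a b; rewrite !mxE ffunE.
rewrite mulrCA mulrA; congr (_ * _ * _).
by apply: eq_bigr => j _; rewrite ffunE mxE.
Qed.

(** Up to a factor that does not depend on the columns, an arbitrary selection of rows
gives one of the minors collected in a compound matrix. *)
Lemma det_mxsub_lex n p q (M : 'M[F]_(p, q)) (a : 'I_n -> 'I_p) :
  (forall c, \det (mxsub a c M) = 0) \/
  exists i e, forall c, \det (mxsub a c M) = e * \det (mxsub (tnth (lex_subset i)) c M).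
Proof.
have aE (b : 'I_n -> 'I_p) c : mxsub b c M = rowsub b (colsub c M).
  by apply/matrixP => i j; rewrite !mxE.
have [/inj_lex_perm[i [s as_]]|na] := pselect (injective a); last first.
  by left=> c; rewrite aE det_rowsub_noninj.
right; exists i, ((-1) ^+ s) => c; rewrite !aE -det_rowsub_perm; congr (\det _).
by apply/matrixP => j k; rewrite !mxE as_.
Qed.

End CauchyBinet.

(** * Matrices [A diag(y) B^T] and their minors *)

Section Minors.
Context {F : fieldType} {I J R : nat}.
Implicit Types (A : 'M[F]_(I, R)) (B : 'M[F]_(J, R)) (y : 'rV[F]_R).

Definition diag_prod A B y : 'M[F]_(I, J) := A *m diag_mx y *m B^T.

Definition subset_prods n y : 'cV[F]_'C(R, n) := \col_i \prod_(r in subset_at i) y 0 r.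

Lemma diag_prodE A B y i j : diag_prod A B y i j = \sum_r y 0 r * A i r * B j r.
Proof.
rewrite /diag_prod mul_mx_diag mxE; apply: eq_bigr => r _.
by rewrite !mxE [A i r * _]mulrC.
Qed.

Lemma minor_diag_prod n A B y (a : 'I_n -> 'I_I) (b : 'I_n -> 'I_J) :
  \det (mxsub a b (diag_prod A B y)) = \sum_(i : 'I_'C(R, n))
    \det (mxsub a (tnth (lex_subset i)) A) * \det (mxsub b (tnth (lex_subset i)) B)
    * \prod_(r in subset_at i) y 0 r.
Proof.
have -> : mxsub a b (diag_prod A B y) = rowsub a (A *m diag_mx y) *m (rowsub b B)^T.
  by apply/matrixP => i j; rewrite !mxE; apply: eq_bigr => k _; rewrite !mxE.
rewrite cauchy_binet; apply: eq_bigr => i _.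
have -> : rowsub (tnth (lex_subset i)) (rowsub b B)^T = (mxsub b (tnth (lex_subset i)) B)^T.
  by apply/matrixP => j k; rewrite !mxE.
rewrite det_tr mulrAC; congr (_ * _).
have -> : colsub (tnth (lex_subset i)) (rowsub a (A *m diag_mx y)) =
   mxsub a (tnth (lex_subset i)) A *m diag_mx (\row_j y 0 (tnth (lex_subset i) j)).
  by rewrite !mul_mx_diag; apply/matrixP => j k; rewrite !mxE.
rewrite det_mulmx det_diag; congr (_ * _).
under eq_bigr do rewrite mxE.
rewrite (eq_bigl (mem (lex_subset i))) => [|r]; last by rewrite inE.
by rewrite -big_uniq ?lex_subset_uniq // big_tuple.
Qed.

Definition vecc m p (M : 'M[F]_(m, p)) : 'cV[F]_(m * p) :=
  \col_k M (mxtens_unindex k).1 (mxtens_unindex k).2.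

Lemma khatri_raoE p q N (X : 'M[F]_(p, N)) (Y : 'M[F]_(q, N)) k r :
  khatri_rao X Y k r = X (mxtens_unindex k).1 r * Y (mxtens_unindex k).2 r.
Proof. by rewrite !mxE. Qed.

(** The key identity: the minors of [A diag(y) B^T] depend linearly on the [n]-fold
products of entries of [y], through the matrix whose column rank is assumed to be
full. *)
Lemma vecc_compound n A B y :
  vecc (compound n (diag_prod A B y)) =
  khatri_rao (compound n A) (compound n B) *m subset_prods n y.
Proof.
apply/colP => k; rewrite !mxE minor_diag_prod; apply: eq_bigr => i _.
by rewrite khatri_raoE !mxE.
Qed.

Definition indep_cols m p (M : 'M[F]_(m, p)) := forall w : 'cV_p, M *m w = 0 -> w = 0.

Lemma full_column_rankP m p (M : 'M[F]_(m, p)) : full_column_rank M <-> indep_cols M.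
Proof.
have -> : full_column_rank M = row_free M^T by rewrite /full_column_rank /row_free mxrank_tr.
split=> [fM w Mw|H].
  apply/trmx_inj; rewrite trmx0; apply: (row_free_inj fM).
  by rewrite mul0mx -trmx_mul Mw trmx0.
rewrite -kermx_eq0; apply/eqP/row_matrixP => i; apply/trmx_inj; rewrite row0 trmx0; apply: H.
by apply/trmx_inj; rewrite trmx_mul trmxK -row_mul mulmx_ker row0 trmx0.
Qed.

Lemma minor_rank n p q (M : 'M[F]_(p, q)) (a : 'I_n -> 'I_p) (b : 'I_n -> 'I_q) :
  (\rank M < n)%N -> \det (mxsub a b M) = 0.
Proof.
move=> rM; apply/eqP/negPn; rewrite -unitfE -unitmxE -row_full_unit /row_full.
rewrite neq_ltn; apply/orP; left; apply: leq_ltn_trans rM.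
have -> : mxsub a b M = (rowsub b (rowsub a M)^T)^T by apply/matrixP => i j; rewrite !mxE.
rewrite mxrank_tr; apply: leq_trans (mxrankS (rowsub_sub _ _)) _.
by rewrite mxrank_tr; exact: mxrankS (rowsub_sub _ _).
Qed.

(** Full column rank of the Khatri-Rao product of the compound matrices, with
arbitrary instead of increasing row selections, so that minors can be expanded
along a column without sorting indices. *)
Definition minors_indep n A B := forall la : 'I_'C(R, n) -> F,
  (forall (a : 'I_n -> 'I_I) (b : 'I_n -> 'I_J), \sum_i la i *
    (\det (mxsub a (tnth (lex_subset i)) A) * \det (mxsub b (tnth (lex_subset i)) B)) = 0) ->
  forall i, la i = 0.

Lemma full_rank_minors_indep n A B :
  full_column_rank (khatri_rao (compound n A) (compound n B)) <-> minors_indep n A B.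
Proof.
rewrite full_column_rankP; split=> [H la la0 i|H w w0].
  have /colP/(_ i) : (\col_i la i) = 0.
    apply: H; apply/colP => k; rewrite !mxE -[RHS](la0 (tnth (lex_subset (mxtens_unindex k).1)) (tnth (lex_subset (mxtens_unindex k).2))).
    by apply: eq_bigr => j _; rewrite khatri_raoE !mxE mulrC.
  by rewrite !mxE.
apply/colP => i; rewrite mxE; move: i; apply: (H (fun i => w i 0)) => a b.
have [a0|[ia [ea aE]]] := det_mxsub_lex A a.
  by apply: big1 => i _; rewrite a0 mul0r mulr0.
have [b0|[ib [eb bE]]] := det_mxsub_lex B b.
  by apply: big1 => i _; rewrite b0 !mulr0.
have /colP/(_ (mxtens_index (ia, ib))) := w0; rewrite mxE [RHS]mxE => e.
transitivity (ea * eb * \sum_j khatri_rao (compound n A) (compound n B) (mxtens_index (ia, ib)) j * w j 0).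
  rewrite mulr_sumr; apply: eq_bigr => i _.
  by rewrite khatri_raoE mxtens_indexK aE bE !mxE /=; ring.
by rewrite e mulr0.
Qed.

End Minors.

(** * Consequences of the independence of paired minors *)

Section MinorsIndep.
Context {F : realType} {R : nat}.

Definition supp (y : 'rV[F]_R) : {set 'I_R} := [set r | y 0 r != 0].

Lemma tr_diag_prod I J (A : 'M[F]_(I, R)) (B : 'M[F]_(J, R)) y :
  (diag_prod A B y)^T = diag_prod B A y.
Proof. by rewrite /diag_prod !trmx_mul trmxK tr_diag_mx mulmxA. Qed.

Lemma minors_indep_sym n I J (A : 'M[F]_(I, R)) (B : 'M[F]_(J, R)) :
  minors_indep n A B -> minors_indep n B A.
Proof.
move=> H la la0; apply: H => a b; rewrite -[RHS](la0 b a).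
by apply: eq_bigr => i _; congr (_ * _); rewrite mulrC.
Qed.

Lemma diag_prod_sub I J (A : 'M[F]_(I, R)) (B : 'M[F]_(J, R)) y (Q : {set 'I_R}) :
  supp y \subset Q -> ((diag_prod A B y)^T <= rows_in Q A^T)%MS.
Proof.
move=> /subsetP yQ; rewrite tr_diag_prod /diag_prod -mulmxA.
apply: submx_trans (submxMl _ _) _; apply/row_subP => r; rewrite row_mul row_diag_mx -scalemxAl -rowE.
have [rQ|rQ] := boolP (r \in Q); first by rewrite scalemx_sub // row_sub_rows_in.
suff -> : y 0 r = 0 by rewrite scale0r sub0mx.
by apply/eqP/(contraNT _ rQ) => yr; apply: yQ; rewrite inE.
Qed.

(** If the rank is below [n], all [n]-minors vanish, hence by independence all
[n]-fold products of entries of [y]. *)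
Lemma card_supp_lt n I J (A : 'M[F]_(I, R)) (B : 'M[F]_(J, R)) y :
  minors_indep n A B -> (\rank (diag_prod A B y) < n)%N -> (#|supp y| < n)%N.
Proof.
move=> H ry; rewrite ltnNge; apply/negP => ny.
have [S /subsetP Sy cS] : exists2 S : {set 'I_R}, S \subset supp y & #|S| = n.
  have [|S yS cS] := @superset_of_card _ (~: supp y) (R - n)%N.
    by have := cardsC (supp y); rewrite card_ord; lia.
  exists (~: S); first by rewrite -setCS setCK.
  have nR := leq_trans ny (max_card _); rewrite card_ord in nR.
  by have := cardsC S; rewrite card_ord cS; lia.
have [i iS] := subset_at_surj cS.
suff /(_ i)/eqP : forall i : 'I_'C(R, n), \prod_(r in subset_at i) y 0 r = 0.
  by rewrite iS; apply/negP/prodf_neq0 => r /Sy; rewrite inE.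
apply: H => a b; rewrite -[RHS](minor_rank a b ry) minor_diag_prod.
by apply: eq_bigr => j _; rewrite mulrC.
Qed.

(** For [y] the indicator of a dependent [n]-set of columns of [A], the rank of
[A diag(y) B^T] would be too small for the size of the support. *)
Lemma minors_indep_kfree n I J (A : 'M[F]_(I, R)) (B : 'M[F]_(J, R)) :
  (n <= R)%N -> minors_indep n A B -> kfree n A^T.
Proof.
move=> nR H; apply: kfree_rank => // S cS; rewrite leqNgt; apply/negP => rS.
pose y : 'rV[F]_R := \row_r (r \in S)%:R.
have yS : supp y = S by apply/setP => r; rewrite !inE mxE; case: (r \in S); rewrite ?oner_eq0 ?eqxx.
suff /(card_supp_lt H) : (\rank (diag_prod A B y) < n)%N by rewrite yS cS ltnn.
rewrite -mxrank_tr; apply: leq_ltn_trans rS; apply/mxrankS/diag_prod_sub.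
by rewrite yS.
Qed.

(** A vector dual to one of the independent columns of [B] in the support extracts the
corresponding column of [A]. *)
Lemma diag_prod_span n I J (A : 'M[F]_(I, R)) (B : 'M[F]_(J, R)) y :
  kfree n B^T -> (#|supp y| <= n)%N ->
  ((diag_prod A B y)^T :=: rows_in (supp y) A^T)%MS.
Proof.
move=> kB yn; apply/eqmxP; rewrite diag_prod_sub //=; apply/rows_in_subP => r ry.
have [z [z1 z0]] := exists_dual kB yn ry.
have -> : row r A^T = (y 0 r)^-1 *: (z^T *m (diag_prod A B y)^T).
  rewrite -trmx_mul /diag_prod -!mulmxA.
  have -> : diag_mx y *m (B^T *m z) = y 0 r *: delta_mx r 0 :> 'cV_R.
    apply/colP => s; rewrite mul_diag_mx mxE [RHS]mxE [X in _ = _ * X]mxE eqxx andbT.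
    have -> : (B^T *m z) s 0 = (row s B^T *m z) 0 0 by rewrite -row_mul [RHS]mxE.
    have [->|sr] := eqVneq s r; first by rewrite z1 mxE.
    have [sy|] := boolP (s \in supp y); first by rewrite z0 // !mxE !mulr0.
    by rewrite inE negbK => /eqP->; rewrite mul0r mulr0.
  rewrite -scalemxAr linearZ scalerA mulVf ?scale1r; last by move: ry; rewrite inE.
  by rewrite -colE; apply/rowP => j; rewrite !mxE.
by rewrite scalemx_sub // submxMl.
Qed.

(** Linear independence passes from [n + 1]-minors to [n]-minors: a relation
between [n]-minors, multiplied by column [r] of both matrices and expanded along
that column, is a relation between the [n + 1]-minors through column [r]. *)
Lemma minors_indep_pred n I J (A : 'M[F]_(I, R)) (B : 'M[F]_(J, R)) :
  (n < R)%N -> minors_indep n.+1 A B -> minors_indep n A B.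
Proof.
move=> nR H la la0 q0.
have [r rq0] : exists r, r \notin subset_at q0.
  have /card_gt0P[r] : (0 < #|~: subset_at q0|)%N.
    by have := cardsC (subset_at q0); rewrite card_ord card_subset_at; lia.
  by rewrite inE; exists r.
pose c q (j : 'I_n.+1) := oapp (tnth (lex_subset q)) r (unlift ord0 j).
pose D p (M : 'M[F]_(p, R)) (a : 'I_n.+1 -> 'I_p) i := \det (mxsub a (tnth (lex_subset i)) M).
have Dc q : r \notin subset_at q -> exists (i : 'I_'C(R, n.+1)) (e : F),
  [/\ e * e = 1, subset_at i = r |: subset_at q &
   forall p (M : 'M[F]_(p, R)) a, \det (mxsub a (c q) M) = e * D p M a i].
  move=> rq; have cinj : injective (c q).
    move=> j k; rewrite /c; case: unliftP => [j'|] ->; case: unliftP => [k'|] -> //=.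
    - by move/lex_subset_inj ->.
    - by move=> e; case/negP: rq; rewrite -e tnth_subset_at.
    - by move=> e; case/negP: rq; rewrite e tnth_subset_at.
  have [i [s cE]] := inj_lex_perm cinj; exists i, ((-1) ^+ s); split.
  - by rewrite -expr2 sqrr_sign.
  - apply/esym/eqP; rewrite eqEcard cardsU1 rq !card_subset_at add1n leqnn andbT.
    apply/subsetP => x /setU1P[->|/mem_subset_at[j ->]].
      have -> : r = c q ord0 by rewrite /c unlift_none.
      by rewrite cE tnth_subset_at.
    have -> : tnth (lex_subset q) j = c q (lift ord0 j) by rewrite /c liftK.
    by rewrite cE tnth_subset_at.
  move=> p M a; rewrite /D -det_tr -[in RHS]det_tr.
  have trE (f : 'I_n.+1 -> 'I_R) : (mxsub a f M)^T = rowsub f (rowsub a M)^T.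
    by apply/matrixP => ? ?; rewrite !mxE.
  rewrite !trE -det_rowsub_perm; congr (\det _).
  by apply/matrixP => j k; rewrite !mxE cE.
have [d dE] : exists d, d = fun p (M : 'M[F]_(p, R)) (a : 'I_n -> 'I_p) q =>
    \det (mxsub a (tnth (lex_subset q)) M) by eexists.
have minE p (M : 'M[F]_(p, R)) (a : 'I_n.+1 -> 'I_p) q : \det (mxsub a (c q) M) =
    \sum_j (M (a j) r * (-1) ^+ j) * d p M (fun k => a (lift j k)) q.
  rewrite dE (expand_det_col _ ord0); apply: eq_bigr => j _; rewrite /cofactor addn0 mulrA.
  have -> : mxsub a (c q) M j ord0 = M (a j) r by rewrite mxE /c unlift_none.
  congr (_ * _); congr (\det _).
  by apply/matrixP => k l; rewrite !mxE /c liftK.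
have rel (a : 'I_n.+1 -> 'I_I) (b : 'I_n.+1 -> 'I_J) :
    \sum_q la q * (\det (mxsub a (c q) A) * \det (mxsub b (c q) B)) = 0.
  under eq_bigr => q _ do rewrite !minE big_distrlr mulr_sumr.
  rewrite exchange_big big1 // => j _.
  under eq_bigr => q _ do rewrite mulr_sumr.
  rewrite exchange_big big1 // => k _ /=.
  transitivity (A (a j) r * (-1) ^+ j * (B (b k) r * (-1) ^+ k) * \sum_q la q *
     (d _ A (fun l => a (lift j l)) q * d _ B (fun l => b (lift k l)) q)).
    by rewrite mulr_sumr; apply: eq_bigr => q _; ring.
  by rewrite dE la0 mulr0.
pose mu (i : 'I_'C(R, n.+1)) := \sum_(q | (r \notin subset_at q) && (subset_at i == r |: subset_at q)) la q.
have mu0 : forall i, mu i = 0.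
  apply: H => a b; rewrite -[RHS](rel a b) [RHS](bigID (fun q => r \in subset_at q)) /=.
  rewrite [X in _ = X + _]big1 ?add0r => [|q rq]; last first.
    suff -> : \det (mxsub a (c q) A) = 0 by rewrite mul0r mulr0.
    have [j rj] := mem_subset_at rq.
    have trE : (mxsub a (c q) A)^T = rowsub (c q) (rowsub a A)^T.
      by apply/matrixP => ? ?; rewrite !mxE.
    rewrite -det_tr trE det_rowsub_noninj // => /(_ ord0 (lift ord0 j)).
    by rewrite /c unlift_none liftK /= -rj => /(_ erefl).
  under eq_bigr => i _ do rewrite mulr_suml.
  rewrite (exchange_big_dep (fun q => r \notin subset_at q)) /= => [|i q _ /andP[]//].
  apply: eq_bigr => q rq; have [i [e [ee iq cE]]] := Dc q rq.
  rewrite (big_pred1 i) => [|j /=]; last first.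
    by rewrite rq /= -iq; apply/eqP/eqP => [/subset_at_inj|->].
  rewrite !cE /D mulrACA ee; ring.
have [i0 [e [_ i0q _]]] := Dc q0 rq0.
rewrite -[RHS](mu0 i0) /mu (big_pred1 q0) // => q /=.
rewrite i0q; apply/andP/eqP => [[rq /eqP e0]|->]; last by rewrite rq0 eqxx.
apply: subset_at_inj; rewrite -(setU1K rq) -(setU1K rq0).
by rewrite e0.
Qed.

End MinorsIndep.

(** * The permutation lemma *)

Lemma krank_kfree (F : realType) p q (M : 'M[F]_(p, q)) : kfree (krank M) M^T /\ (krank M <= q)%N.
Proof.
pose P (k : 'I_q.+1) := [forall S : {set 'I_q},
  (#|S| == k) ==> free [seq col j M | j <- enum S]].
rewrite -[krank M]/(\max_(k | P k) k)%N.
have [|k0 Pk0 ->] := @eq_bigmax_cond _ P (@nat_of_ord q.+1).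
  apply/card_gt0P; exists ord0; apply/forallP => S; apply/implyP.
  by rewrite cards_eq0 => /eqP->; rewrite enum_set0; exact: nil_free.
split; last by rewrite -ltnS.
move=> S r rS Sk; apply/negP => rW.
have [|T ST cT] := @superset_of_card _ (r |: S) k0.
  by rewrite cardsU1 rS add1n Sk /= -ltnS.
have rT : r \in T by rewrite (subsetP ST) // setU11.
have /forallP/(_ T) := Pk0; rewrite cT eqxx /= => fT.
have pT : perm_eq (enum T) (r :: enum (T :\ r)).
  apply: uniq_perm; rewrite ?enum_uniq //= ?mem_enum ?setD11 ?enum_uniq // => x.
  by rewrite in_cons !mem_enum !inE; case: eqVneq => [->|].
move: fT; rewrite (perm_free (perm_map _ pT)) /= free_cons => /andP[/negP rN _]; apply: rN.
have [u uE] := sub_rows_inP rW.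
have -> : col r M = \sum_(s in S) u 0 s *: col s M.
  apply/colP => j; have /rowP/(_ j) := uE; rewrite !mxE !summxE => ->.
  by apply: eq_bigr => s _; rewrite !mxE.
apply: memv_suml => s sS; apply/memvZ/memv_span/map_f; rewrite mem_enum !inE.
rewrite (subsetP ST) ?inE ?sS ?orbT // andbT.
by apply: contraNneq rS => <-.
Qed.

Section Counting.
Context {F : realType} {R K : nat}.
Implicit Types (D : 'M[F]_(R, K)).

Definition inside D m (W : 'M[F]_(m, K)) := [set r | (row r D <= W)%MS].

Lemma rank_inside D S : (\rank (rows_in S D) <= #|inside D (rows_in S D)|)%N.
Proof.
apply: leq_trans (rank_rows_in_le _ D); apply/mxrankS/rows_in_subset.
by apply/subsetP => r rS; rewrite inE row_sub_rows_in.
Qed.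

Definition nz D (x : 'cV[F]_K) := [set r | row r D *m x != 0].

Lemma nz_supp D x : nz D x = supp (D *m x)^T.
Proof.
apply/setP => r; rewrite !inE -row_mul; congr (~~ _); apply/eqP/eqP => [/matrixP/(_ 0 0)|e].
  by rewrite !mxE.
by apply/matrixP => i j; rewrite !ord1 [RHS]mxE; move: e; rewrite !mxE.
Qed.

Lemma orth_generic D D' m (W : 'M[F]_(m, K)) :
  exists x : 'cV[F]_K, nz D x = ~: inside D W /\ nz D' x = ~: inside D' W.
Proof.
pose vs := [seq row r D | r <- enum (~: inside D W)] ++ [seq row r D' | r <- enum (~: inside D' W)].
have [|x [Wx vx]] := @kernel_generic F m K W vs.
  by move=> v; rewrite mem_cat => /orP[] /mapP[r]; rewrite mem_enum !inE => rW ->.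
have nzE E : {subset [seq row r E | r <- enum (~: inside E W)] <= vs} -> nz E x = ~: inside E W.
  move=> sub; apply/setP => r; rewrite !inE; apply/idP/idP => [|rW].
    by apply: contra => /submxP[u ->]; rewrite -mulmxA Wx mulmx0.
  by apply/vx/sub/map_f; rewrite mem_enum !inE.
by exists x; split; apply: nzE => v vE; rewrite mem_cat vE ?orbT.
Qed.

(** The counting core of the permutation lemma. For [W] of corank at most one in
the row space of [D'] the hypothesis applies to a generic vector orthogonal to
[W]. For smaller [W], the rows of [D'] outside [W] are partitioned by the
subspaces that they generate together with [W]; these subspaces meet pairwise in
[W], so adding up the inequalities known for them gives the one for [W]. *)
Lemma count_inside D D' :
  (forall x, (#|nz D' x| <= R - \rank D' + 1)%N -> (#|nz D x| <= #|nz D' x|)%N) ->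
  forall P : {set 'I_R}, (#|inside D' (rows_in P D')| <= #|inside D (rows_in P D')|)%N.
Proof.
move=> H; have cD E m (W : 'M[F]_(m, K)) : (#|inside E W| + #|~: inside E W| = R)%N.
  by rewrite cardsC card_ord.
have base P : (\rank D' <= (\rank (rows_in P D')).+1)%N ->
    (#|inside D' (rows_in P D')| <= #|inside D (rows_in P D')|)%N.
  move=> small; have [x [xD xD']] := orth_generic D D' (rows_in P D').
  have := H x; rewrite xD xD'; have := cD D _ (rows_in P D'); have := cD D' _ (rows_in P D').
  by have := rank_inside D' P; have := rank_leq_row D'; lia.
move=> P; have [n] := ubnP (\rank D' - \rank (rows_in P D')).
elim: n P => [//|m IH] P; set W := rows_in P D' => le_m.
have [|big] := leqP (\rank D') (\rank W).+1; first exact: base.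
rewrite leqNgt; apply/negP => lt_cnt.
(* [V r] is [W] enlarged by a row; rows outside [W] are grouped by the [V r] that
   contains them: [blk] for [D'], [cls] for [D] *)
pose V r := rows_in (r |: P) D'; pose Out E := ~: inside E W.
have WV r : (W <= V r)%MS by apply/rows_in_subset/subsetU1.
have rV r : (row r D' <= V r)%MS by apply: row_sub_rows_in; rewrite setU11.
have rkV r : (\rank (V r) <= (\rank W).+1)%N.
  apply: (@leq_trans (\rank (W + row r D')%MS)).
    apply/mxrankS/rows_in_subP => s /setU1P[->|sP]; first exact: addsmxSr.
    exact: submx_trans (row_sub_rows_in _ sP) (addsmxSl _ _).
  apply: leq_trans (mxrank_adds_leqif _ _).1 _.
  by have := rank_leq_row (row r D'); lia.
have gen r (v : 'rV[F]_K) : ~~ (v <= W)%MS -> (v <= V r)%MS -> (V r <= W + v)%MS.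
  move=> vW vV; have sub : (W + v <= V r)%MS by rewrite addsmx_sub WV.
  rewrite -(mxrank_leqif_sup sub); rewrite eqn_leq (mxrankS sub) /=.
  apply: leq_trans (rkV r) _; rewrite ltn_neqAle mxrankS ?addsmxSl // andbT.
  rewrite (mxrank_leqif_sup (addsmxSl W v)); apply: contra vW.
  by apply: submx_trans; apply: addsmxSr.
have eqV r s (v : 'rV[F]_K) : ~~ (v <= W)%MS -> (v <= V r)%MS -> (v <= V s)%MS -> (V r :=: V s)%MS.
  move=> vW vr vs; apply/eqmxP/andP; split.
    by apply: submx_trans (gen _ _ vW vr) _; rewrite addsmx_sub WV.
  by apply: submx_trans (gen _ _ vW vs) _; rewrite addsmx_sub WV.
have outE E r : (r \in Out E) = ~~ (row r E <= W)%MS by rewrite !inE.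
pose blk b := [set s in Out D' | (row s D' <= V b)%MS].
pose cls b := [set s in Out D | (row s D <= V b)%MS].
have blkE b s : b \in Out D' -> s \in Out D' -> (row s D' <= V b)%MS -> blk s = blk b.
  rewrite !outE => bO sO sb; have eqs := eqV _ _ _ sO (rV s) sb.
  by apply/setP => t; rewrite !inE eqs.
pose Bs := blk @: Out D'.
have partB : partition Bs (Out D').
  apply/and3P; split.
  - apply/eqP/setP => s; apply/bigcupP/idP => [[_ /imsetP[b _ ->]]|sO].
      by rewrite inE => /andP[].
    by exists (blk s); [apply: imset_f | rewrite inE sO rV].
  - apply/trivIsetP => _ _ /imsetP[b bO ->] /imsetP[c cO ->]; apply: contraR.
    case/pred0Pn => s /andP[]; rewrite !(inE, in_set) => /andP[sO sb] /andP[_ sc].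
    apply/eqP; rewrite -(blkE b s) // ?inE // -(blkE c s) // ?inE //.
  - apply/negP => /imsetP[b bO] /esym/setP/(_ b); rewrite !inE rV andbT.
    by move: bO; rewrite outE => ->.
pose cl (B : {set 'I_R}) := \bigcup_(b in B) cls b.
have clE b : b \in Out D' -> cl (blk b) = cls b.
  move=> bO; apply/setP => s; apply/bigcupP/idP => [[c]|sb].
    rewrite inE => /andP[cO cb]; rewrite !inE => /andP[-> sc] /=.
    by move: cO; rewrite outE => cO; rewrite -(eqV _ _ _ cO (rV c) cb).
  by exists b => //; rewrite inE bO rV.
have cls_ge b : b \in Out D' -> (#|blk b| + #|Out D| <= #|cls b| + #|Out D'|)%N.
  move=> bO; have rk : (\rank W < \rank (V b))%N.
    rewrite ltn_neqAle mxrankS // andbT (mxrank_leqif_sup (WV b)).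
    by move: (bO); rewrite outE; apply: contra => /(submx_trans (rV b)).
  have := IH (b |: P); rewrite -/(V b) => /(_ _); have -> : (\rank D' - \rank (V b) < m)%N by lia.
  have split_card E : #|inside E (V b)| = (#|inside E W| + #|[set s in Out E | (row s E <= V b)%MS]|)%N.
    rewrite -cardsUI [X in (_ + X)%N](_ : _ = 0%N) ?addn0; last first.
      apply/eqP; rewrite cards_eq0; apply/eqP/setP => s; rewrite !inE.
      by case: (row s E <= W)%MS.
    congr #|pred_of_set _|; apply/setP => s; rewrite !inE.
    have [sW|] := boolP (row s E <= W)%MS; last by [].
    by rewrite (submx_trans sW).
  rewrite !split_card -/(blk b) -/(cls b); have := cD D _ W; have := cD D' _ W; rewrite -!/(Out _).
  by move=> ? ? /(_ isT); lia.
have [b1 b1O] : exists b, b \in Out D'.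
  apply/set0Pn; apply: contraTneq big => O0; rewrite -leqNgt; apply: leqW; apply: mxrankS.
  by apply/row_subP => r; have := in_set0 r; rewrite -O0 outE => /negbFE.
have [b2 b2O b2n] : exists2 b, b \in Out D' & ~~ (row b D' <= V b1)%MS.
  have /row_subPn[b bn] : ~~ (D' <= V b1)%MS.
    apply: contraTN big => /mxrankS h; rewrite -leqNgt; exact: leq_trans h (rkV b1).
  by exists b => //; rewrite outE; apply: contra bn => /submx_trans; apply.
have Bs2 : (1 < #|Bs|)%N.
  rewrite (cardsD1 (blk b1)) imset_f // (cardsD1 (blk b2)) in_setD1 imset_f // andbT.
  suff -> : blk b2 != blk b1 by [].
  apply/eqP => e; have : b2 \in blk b2 by rewrite inE b2O rV.
  by rewrite e inE (negPf b2n) andbF.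
have sum_cl : (\sum_(B in Bs) #|cl B| <= #|Out D|)%N.
  under eq_bigr do rewrite -sum1_card big_mkcond /=.
  rewrite exchange_big /= -[leqRHS]sum1_card [leqRHS]big_mkcond /=; apply: leq_sum => s _.
  have [sO|sO] := ifPn.
    rewrite -big_mkcondr sum1_card; apply/card_le1_eqP => B B'.
    case/andP=> /imsetP[b bO ->]; rewrite clE // => sb.
    case/andP=> /imsetP[b' b'O ->]; rewrite clE // => sb'.
    move: sb sb'; rewrite !inE => /andP[sW sb] /andP[_ sb'].
    by have e := eqV _ _ _ sW sb sb'; apply/esym/blkE => //; rewrite -e.
  rewrite big1 // => B /imsetP[b bO ->]; rewrite clE // inE.
  by rewrite (negPf sO).
have : (\sum_(B in Bs) (#|B| + #|Out D|) <= \sum_(B in Bs) (#|cl B| + #|Out D'|))%N.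
  by apply: leq_sum => _ /imsetP[b bO ->]; rewrite clE // cls_ge.
rewrite !big_split /= -(card_partition partB) !sum_nat_const.
have := cD D _ W; have := cD D' _ W; rewrite -!/(Out _) => cD' cD_.
have : (#|Out D'| < #|Out D|)%N by lia.
move: sum_cl Bs2; move: (\sum_(B in Bs) #|cl B|)%N #|Bs| #|Out D| #|Out D'| => c N o o'.
by clear; case: N => // N; rewrite !mulSn; move: (leq_mul2l N o o'); nia.
Qed.

(** Kruskal's permutation lemma. The line through a row of [D'] contains, by the
counting inequality, at least as many rows of [D] as of [D']; as no two rows of [D]
are proportional, each line contains exactly one row of either matrix. *)
Lemma permutation_lemma D D' : kfree 2 D ->
  (forall x, (#|nz D' x| <= R - \rank D' + 1)%N -> (#|nz D x| <= #|nz D' x|)%N) ->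
  exists (s : 'S_R) (ga : 'I_R -> F), forall r, ga r != 0 /\ row r D' = ga r *: row (s r) D.
Proof.
move=> kD /count_inside cnt.
have D0 s : row s D != 0.
  have := kD set0 s; rewrite in_set0 cards0 => /(_ isT isT); apply: contraNneq => ->.
  exact: sub0mx.
have line r (v : 'rV[F]_K) : (v <= rows_in [set r] D')%MS -> exists c, v = c *: row r D'.
  by move=> /sub_rows_inP[u ->]; rewrite big_set1; exists (u 0 r).
have ex r : exists s, row s D \in [pred v | (v <= rows_in [set r] D')%MS].
  have : (0 < #|inside D (rows_in [set r] D')|)%N.
    apply: leq_trans (cnt _); apply/card_gt0P; exists r.
    by rewrite inE row_sub_rows_in // set11.
  by case/card_gt0P => s; rewrite inE; exists s.
pose s0 r := xchoose (ex r).
have s0P r : (row (s0 r) D <= rows_in [set r] D')%MS by have := xchooseP (ex r).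
have s0E r : exists g, g != 0 /\ row r D' = g *: row (s0 r) D.
  have [c e] := line _ _ (s0P r); have c0 : c != 0.
    by apply: contraNneq (D0 (s0 r)) => c0; rewrite e c0 scale0r.
  by exists c^-1; rewrite invr_eq0 c0 e scalerA mulVf ?scale1r.
have s0_inj : injective s0.
  move=> r r' e; apply/eqP; apply: contraT => rr'.
  have two : (1 < #|inside D (rows_in [set r] D')|)%N.
    apply: leq_trans (cnt _); rewrite (cardsD1 r) (cardsD1 r') !inE row_sub_rows_in ?set11 //.
    rewrite eq_sym rr' /=; suff -> : (row r' D' <= rows_in [set r] D')%MS by [].
    have [g [_ ->]] := s0E r'; by rewrite scalemx_sub // -e.
  have [t tI ts] : exists2 t, t \in inside D (rows_in [set r] D') & t != s0 r.
    have : (0 < #|inside D (rows_in [set r] D') :\ s0 r|)%N.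
      by move: two; rewrite (cardsD1 (s0 r)) inE s0P.
    by case/card_gt0P => t; rewrite !inE => /andP[ts tI]; exists t; rewrite ?inE.
  move: tI; rewrite inE => /line[c tE]; have [g [_ gE]] := s0E r.
  have := kD [set s0 r] t; rewrite inE ts cards1 => /(_ isT isT)/negP; case.
  by rewrite tE gE !scalemx_sub // row_sub_rows_in // set11.
have [ga gaP] := choice s0E.
by exists (perm s0_inj), ga => r; rewrite permE.
Qed.

End Counting.

(** * Uniqueness of the decomposition *)

Section Slabs.
Context {F : realType} {I J K : nat}.

(** Contraction of the third mode: a linear combination of the slices. *)
Definition slab (T : tensor F I J K) (x : 'cV[F]_K) : 'M[F]_(I, J) :=
  \matrix_(i, j) \sum_k T (i, j, k) * x k 0.

Lemma cpd_tensorE R (A : 'M[F]_(I, R)) (B : 'M[F]_(J, R)) (C : 'M[F]_(K, R)) i j k :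
  cpd_tensor A B C (i, j, k) = \sum_r A i r * B j r * C k r.
Proof. by rewrite sum_ffunE; apply: eq_bigr => r _; rewrite ffunE !mxE. Qed.

Lemma slab_cpd R (A : 'M[F]_(I, R)) (B : 'M[F]_(J, R)) (C : 'M[F]_(K, R)) x :
  slab (cpd_tensor A B C) x = diag_prod A B (C^T *m x)^T.
Proof.
apply/matrixP => i j; rewrite diag_prodE mxE.
under eq_bigr do rewrite cpd_tensorE mulr_suml.
rewrite exchange_big; apply: eq_bigr => r _ /=.
rewrite !mxE !mulr_suml; apply: eq_bigr => k _; rewrite !mxE; ring.
Qed.

End Slabs.

Section Supports.
Context {F : realType}.

(** Fewer than [k] rows remain outside [Q], so a generic vector orthogonal to these
is orthogonal to no row in [Q]. *)
Lemma exists_supp R K k (D : 'M[F]_(R, K)) (Q : {set 'I_R}) :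
  kfree k D -> (R < k + #|Q|)%N ->
  exists x : 'cV[F]_K, supp (D *m x)^T = Q.
Proof.
move=> kD kQ; have cQ := cardsC Q; rewrite card_ord in cQ.
have [|x [Wx vx]] := @kernel_generic F R K (rows_in (~: Q) D) [seq row r D | r <- enum Q].
  move=> v /mapP[r]; rewrite mem_enum => rQ ->; apply: kD; rewrite ?inE ?rQ //.
  by lia.
exists x; rewrite -nz_supp; apply/setP => r; rewrite inE; apply/idP/idP.
  apply: contraR => rQ; have : row r (rows_in (~: Q) D) *m x = 0 by rewrite -row_mul Wx row0.
  by rewrite row_rows_in inE rQ mulr1n => ->.
by move=> rQ; apply/vx/map_f; rewrite mem_enum.
Qed.

Lemma rank_diag_prod n I J R (A : 'M[F]_(I, R)) (B : 'M[F]_(J, R)) y :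
  kfree n A^T -> kfree n B^T -> (#|supp y| <= n)%N ->
  \rank (diag_prod A B y) = #|supp y|.
Proof.
move=> kA kB yn; rewrite -mxrank_tr (eqmxP (introT eqmxP (diag_prod_span A kB yn))).
exact: rank_rows_in kA yn.
Qed.

Lemma rank_diag_prod_le I J R (A : 'M[F]_(I, R)) (B : 'M[F]_(J, R)) y :
  (\rank (diag_prod A B y) <= #|supp y|)%N.
Proof.
rewrite -mxrank_tr; apply: leq_trans (rank_rows_in_le _ A^T).
exact/mxrankS/diag_prod_sub.
Qed.

(** The first factor of a decomposition is determined up to scaling by the
matrices [A diag(y) B^T] with [y] of support size [n]: their column spaces are
the spans of [n] columns, and these spans intersect in the lines spanned by single
columns. *)
Lemma factor_proportional n I J K R (A A2 : 'M[F]_(I, R)) (B B2 : 'M[F]_(J, R))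
    (D : 'M[F]_(R, K)) k :
  (0 < n < R)%N -> kfree n.+1 A^T -> kfree n.+1 B^T -> kfree k D -> (R < k + n)%N ->
  (forall x, diag_prod A B (D *m x)^T = diag_prod A2 B2 (D *m x)^T) ->
  forall r, exists a, col r A2 = a *: col r A.
Proof.
move=> /andP[n0 nR] kA kB kD Rkn e r.
have sub (Q : {set 'I_R}) s : #|Q| = n -> s \in Q -> (row s A2^T <= rows_in Q A^T)%MS.
  move=> cQ sQ; have [|x xQ] := @exists_supp _ _ _ D Q kD; first by rewrite cQ.
  have := diag_prod_span A (y := (D *m x)^T) kB; rewrite xQ cQ => /(_ (leqnSn n)) eqA.
  have sub1 : (rows_in Q A^T <= rows_in Q A2^T)%MS.
    by rewrite -eqA e diag_prod_sub ?xQ.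
  apply: submx_trans (row_sub_rows_in _ sQ) _.
  rewrite -(mxrank_leqif_sup sub1) eqn_leq (mxrankS sub1) /=.
  by rewrite (rank_rows_in kA) cQ // -cQ rank_rows_in_le.
have [|M rM cM] := @superset_of_card R [set r] n.+1; first by rewrite cards1.
rewrite sub1set in rM.
have [||||a aE] := @span_inter F R I n.+1 A^T M r (row r A2^T) kA; rewrite ?cM //.
  move=> s sM sr; apply: sub; rewrite ?inE 1?eq_sym ?sr //.
  by have := cardsD1 s M; rewrite sM cM => -[].
by exists a; apply/trmx_inj; rewrite tr_col aE [RHS]linearZ /= tr_col.
Qed.

End Supports.

Section Uniqueness.
Context {F : realType} {I J K R : nat}.

(** The form of the hypothesis used below. The number [n] is one less than the order
of the minors: the spans of [n] columns are what the tensor gives access to. *)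
Lemma condition_facts (A : 'M[F]_(I, R)) (B : 'M[F]_(J, R)) (C : 'M[F]_(K, R)) :
  compound_condition A B C ->
  exists n k, [/\ R.+1 = (n + k)%N, (k <= K)%N, (n < minn I J)%N /\ (0 < n < R)%N,
    minors_indep n.+1 A B & kfree k C^T].
Proof.
case=> nI nJ /full_rank_minors_indep H; have [kC kR] := krank_kfree C.
exists (R - krank C).+1, (krank C).
have e : (R - krank C + 2 = (R - krank C).+2)%N by rewrite addn2.
rewrite e in nI nJ H; split=> //; first lia; last by split; lia.
have [|S _ cS] := @superset_of_card R set0 (krank C); first by rewrite cards0.
by rewrite -cS -(rank_rows_in kC) ?cS // rank_leq_col.
Qed.

(** [C] and [C'] satisfy the hypothesis of the permutation lemma, because a vector [x]
with few non-zero entries in [C'^T x] gives a slab of small rank. With the third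
factors identified, the slabs determine the other two up to scaling. The second
decomposition may have zero columns; this is how the rank is bounded from below. *)
Lemma cpd_uniqueness (A A' : 'M[F]_(I, R)) (B B' : 'M[F]_(J, R)) (C C' : 'M[F]_(K, R)) :
  compound_condition A B C -> cpd_tensor A B C = cpd_tensor A' B' C' ->
  exists (s : 'S_R) (al be ga : 'I_R -> F), forall r,
      [/\ al r * be r * ga r = 1,
          col r A' = al r *: col (s r) A,
          col r B' = be r *: col (s r) B &
          col r C' = ga r *: col (s r) C].
Proof.
move=> /condition_facts[n [k [Rnk _ [_ /andP[n0 nR]] H kC]]] eT.
have kA := minors_indep_kfree nR H.
have kB := minors_indep_kfree nR (minors_indep_sym H).
have eS x : diag_prod A B (C^T *m x)^T = diag_prod A' B' (C'^T *m x)^T.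
  by rewrite -!slab_cpd eT.
have le_supp x : (#|nz C'^T x| <= n)%N -> (#|nz C^T x| <= #|nz C'^T x|)%N.
  rewrite !nz_supp => le_n; have rk := rank_diag_prod_le A' B' (C'^T *m x)^T.
  have lt_n : (#|supp (C^T *m x)^T| < n.+1)%N.
    by apply: (card_supp_lt H); rewrite eS ltnS (leq_trans rk).
  by rewrite -(rank_diag_prod kA kB) ?eS // ltnW.
have [s [ga gaP]] : exists (s : 'S_R) (ga : 'I_R -> F),
    forall r, ga r != 0 /\ row r C'^T = ga r *: row (s r) C^T.
  apply: permutation_lemma => [|x le_x]; first by apply: kfreeW kC; lia.
  apply: (le_supp); apply: leq_trans le_x _.
  have [|S _ cS] := @superset_of_card R set0 k; first by rewrite cards0; lia.
  have : (k <= \rank C^T)%N.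
    rewrite -cS -(rank_rows_in kC) ?cS //; apply/mxrankS/rows_in_subP => ? _.
    exact: row_sub.
  suff /mxrankS : (C^T <= C'^T)%MS by lia.
  rewrite submxE; apply/eqP/matrixP => r j; rewrite [RHS]mxE.
  have nz0 : nz C'^T (col j (cokermx C'^T)) = set0.
    apply/setP => t; rewrite !inE colE mulmxA -row_mul mulmx_coker row0 mul0mx.
    by rewrite eqxx.
  have := le_supp (col j (cokermx C'^T)); rewrite nz0 cards0 leqn0 cards_eq0.
  move=> /(_ isT)/eqP/setP/(_ r); rewrite !inE colE mulmxA -row_mul -colE.
  by move/negbFE/eqP/matrixP/(_ 0 0); rewrite [LHS]mxE [LHS]mxE [RHS]mxE.
(* the second decomposition, with its terms reordered and [C'] replaced by [C] *)
pose A2 : 'M_(I, R) := \matrix_(i, t) (ga (s^-1 t)%g * A' i (s^-1 t)%g).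
pose B2 : 'M_(J, R) := \matrix_(j, t) B' j (s^-1 t)%g.
have e2 x : diag_prod A B (C^T *m x)^T = diag_prod A2 B2 (C^T *m x)^T.
  rewrite eS; apply/matrixP => i j; rewrite !diag_prodE [RHS](reindex_inj (@perm_inj _ s)) /=.
  apply: eq_bigr => r _; rewrite [A2 _ _]mxE [B2 _ _]mxE permK.
  have -> : (C'^T *m x)^T 0 r = ga r * (C^T *m x)^T 0 (s r).
    transitivity ((row r C'^T *m x) 0 0); first by rewrite -row_mul !mxE.
    by rewrite (gaP r).2 -scalemxAl -row_mul !mxE.
  by ring.
have nR' : (0 < n < R)%N by rewrite n0.
have Rkn : (R < k + n)%N by lia.
have [al alP] := choice (factor_proportional nR' kA kB kC Rkn e2).
have e3 x : diag_prod B A (C^T *m x)^T = diag_prod B2 A2 (C^T *m x)^T.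
  by rewrite -tr_diag_prod e2 tr_diag_prod.
have [be beP] := choice (factor_proportional nR' kB kA kC Rkn e3).
have al_be r : al r * be r = 1.
  have [|Q rQ cQ] := @superset_of_card R [set r] n; first by rewrite cards1 n0 ltnW.
  rewrite sub1set in rQ; have [|x xQ] := @exists_supp _ _ _ _ _ Q kC; first by rewrite cQ.
  pose y : 'rV_R := \row_t ((C^T *m x)^T 0 t * (al t * be t - 1)).
  have yQ : (#|supp y| <= n.+1)%N.
    rewrite ltnW // ltnS -cQ -xQ; apply/subset_leq_card/subsetP => t.
    by rewrite !inE !mxE; apply: contraNneq => ->; rewrite mul0r.
  have y0 : diag_prod A B y = 0.
    have := e2 x; move/eqP; rewrite eq_sym -subr_eq0 => /eqP e0.
    rewrite -[RHS]e0; apply/matrixP => i j; rewrite [RHS]mxE [X in _ = _ + X]mxE !diag_prodE -sumrB.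
    apply: eq_bigr => t _; rewrite [y _ _]mxE.
    have -> : A2 i t = al t * A i t by have /colP/(_ i) := alP t; rewrite !mxE.
    have -> : B2 j t = be t * B j t by have /colP/(_ j) := beP t; rewrite !mxE.
    by ring.
  have := rank_diag_prod kA kB yQ; rewrite y0 mxrank0 => /esym/eqP.
  rewrite cards_eq0 => /eqP/setP/(_ r); rewrite !inE mxE => /negbFE.
  rewrite mulf_eq0 => /orP[xr|]; last by rewrite subr_eq0 => /eqP.
  by move: rQ; rewrite -xQ inE xr.
exists s, (fun r => (ga r)^-1 * al (s r)), (fun r => be (s r)), ga => r.
have [g0 gE] := gaP r; split.
- by rewrite -mulrA [_ * ga r]mulrC mulrA [X in X * _]mulrAC mulVf // mul1r al_be.
- apply/colP => i; have /colP/(_ i) := alP (s r); rewrite !mxE permK => e.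
  by rewrite -mulrA -e mulKf.
- by apply/colP => j; have /colP/(_ j) := beP (s r); rewrite !mxE permK.
- by apply/trmx_inj; rewrite tr_col gE linearZ /= tr_col.
Qed.

End Uniqueness.

Section Rank.
Context {F : realType} {I J K : nat}.

Lemma tensor_rankP (T : tensor F I J K) : sum_of_rank1 T (tensor_rank T).
Proof. by rewrite /tensor_rank; case: ex_minnP => m /asboolP. Qed.

Lemma tensor_rank_min (T : tensor F I J K) r : sum_of_rank1 T r -> (tensor_rank T <= r)%N.
Proof. by rewrite /tensor_rank; case: ex_minnP => m _ min /asboolP; apply: min. Qed.

Lemma outer0 (a : 'cV[F]_I) (b : 'cV[F]_J) (c : 'cV[F]_K) :
  (a == 0) || (b == 0) || (c == 0) -> outer a b c = 0.
Proof.
by move=> h; apply/ffunP => x; rewrite !ffunE; case/orP: h => [/orP[]|] /eqP->;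
  rewrite mxE ?(mul0r, mulr0).
Qed.

Definition proper_terms R (A : 'M[F]_(I, R)) (B : 'M[F]_(J, R)) (C : 'M[F]_(K, R)) :=
  [set r | [&& col r A != 0, col r B != 0 & col r C != 0]].

(** Terms with a zero factor can be discarded. *)
Lemma tensor_rank_le_proper R (A : 'M[F]_(I, R)) (B : 'M[F]_(J, R)) (C : 'M[F]_(K, R)) :
  (tensor_rank (cpd_tensor A B C) <= #|proper_terms A B C|)%N.
Proof.
set S := proper_terms A B C; apply: tensor_rank_min.
exists (fun i : 'I_#|S| => outer (col (enum_val i) A) (col (enum_val i) B) (col (enum_val i) C)); split.
  move=> i; exists (col (enum_val i) A), (col (enum_val i) B), (col (enum_val i) C).
  by have := enum_valP i; rewrite inE => /and3P[].
rewrite /cpd_tensor (bigID (mem S)) /= [X in _ + X]big1 ?addr0 => [|r].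
  by rewrite (big_enum_val (fun r => outer (col r A) (col r B) (col r C))).
by rewrite inE => h; apply: outer0; move: h; rewrite !negb_and !negbK orbA.
Qed.

Lemma is_cpd_of_size R (A : 'M[F]_(I, R)) (B : 'M[F]_(J, R)) (C : 'M[F]_(K, R)) T :
  T = cpd_tensor A B C -> (R <= tensor_rank T)%N -> is_cpd T A B C.
Proof.
move=> TE le_R; have := tensor_rank_le_proper A B C; rewrite -TE => le_rk.
have le_S : (#|proper_terms A B C| <= R)%N by rewrite -[leqRHS]card_ord max_card.
split=> //; first by apply/eqP; rewrite eqn_leq le_R (leq_trans le_rk).
move=> r; have : proper_terms A B C = setT.
  by apply/eqP; rewrite eqEcard subsetT cardsT card_ord (leq_trans le_R).
by move/setP/(_ r); rewrite !inE => /and3P[].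
Qed.

Lemma condition_rank R (A : 'M[F]_(I, R)) (B : 'M[F]_(J, R)) (C : 'M[F]_(K, R)) :
  compound_condition A B C -> tensor_rank (cpd_tensor A B C) = R.
Proof.
move=> cond; set T := cpd_tensor A B C.
have le_rk : (tensor_rank T <= R)%N.
  apply: leq_trans (tensor_rank_le_proper _ _ _) _.
  by rewrite -[leqRHS]card_ord max_card.
apply/eqP; rewrite eqn_leq le_rk leqNgt; apply/negP => lt_rk.
have [t [t1 tE]] := tensor_rankP T.
have [a /choice[b /choice[c abc]]] := choice t1.
(* a shorter decomposition, padded with zero columns, would contradict uniqueness *)
pose pad p (v : 'I_(tensor_rank T) -> 'cV[F]_p) : 'M[F]_(p, R) :=
  \matrix_(i, r) oapp (fun r' => v r' i 0) 0 (insub (nat_of_ord r)).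
have TE : T = cpd_tensor (pad _ a) (pad _ b) (pad _ c).
  apply/ffunP => -[[i j] k]; rewrite [RHS]cpd_tensorE {1}tE sum_ffunE.
  pose G (m : nat) := oapp (fun r' => t r' (i, j, k)) 0 (insub m).
  transitivity (\sum_(r < tensor_rank T) G r).
    by apply: eq_bigr => r _; rewrite /G valK.
  rewrite (big_ord_widen _ G le_rk) big_mkcond; apply: eq_bigr => r _ /=.
  rewrite !mxE /G; case: insubP => [r' rr' _|/negbTE->] /=; last by rewrite !mul0r.
  by rewrite rr'; have [_ _ _ ->] := abc r'; rewrite ffunE.
have [s [al [be [ga /(_ (Ordinal lt_rk))[abg aE _ _]]]]] := cpd_uniqueness cond TE.
set r0 := Ordinal lt_rk in abg aE.
have col0 : col (s r0) A == 0.
  have : al r0 *: col (s r0) A == 0.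
    rewrite -aE; apply/eqP/colP => i; rewrite !mxE insubF //=; exact: ltnn.
  rewrite scaler_eq0 => /orP[/eqP al0|//].
  by move/eqP: abg; rewrite al0 !mul0r eq_sym oner_eq0.
have [n [k [_ _ [_ /andP[_ nR]] H _]]] := condition_facts cond.
have := minors_indep_kfree nR H; move/(_ set0 (s r0)); rewrite in_set0 cards0 => /(_ isT isT).
by rewrite -tr_col (eqP col0) trmx0 sub0mx.
Qed.

Lemma condition_unique R (A : 'M[F]_(I, R)) (B : 'M[F]_(J, R)) (C : 'M[F]_(K, R)) :
  compound_condition A B C -> cpd_unique (cpd_tensor A B C).
Proof.
move=> cond R0 A1 A2 B1 B2 C1 C2 [R0E _ T1] [_ _ T2].
rewrite (condition_rank cond) in R0E; subst R0.
have [s1 [al1 [be1 [ga1 H1]]]] := cpd_uniqueness cond T1.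
have [s2 [al2 [be2 [ga2 H2]]]] := cpd_uniqueness cond T2.
pose t r := (s1^-1)%g (s2 r).
exists (s2 * s1^-1)%g, (fun r => al2 r / al1 (t r)), (fun r => be2 r / be1 (t r)),
  (fun r => ga2 r / ga1 (t r)) => r.
have [e2 a2 b2 c2] := H2 r; have [e1 a1 b1 c1] := H1 (t r).
have /and3P[al0 be0 ga0] : [&& al1 (t r) != 0, be1 (t r) != 0 & ga1 (t r) != 0].
  by have := oner_neq0 F; rewrite -e1 !mulf_eq0 !negb_or -andbA.
rewrite permM -/(t r); rewrite permKV in a1 b1 c1.
split; first by rewrite mulf_div mulf_div e1 e2 divr1.
- by rewrite a1 scalerA divfK.
- by rewrite b1 scalerA divfK.
- by rewrite c1 scalerA divfK.
Qed.

End Rank.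

(** * Interpolation on an integer grid *)

Definition grid_size k m := #|{: {ffun 'I_k -> 'I_m.+1}}|.
Definition grid_int k m (l : 'I_(grid_size k m)) : 'cV[int]_k := \col_j Posz (enum_val l j).

Section Interpolation.
Context {F : realType} {k : nat}.
Implicit Types (g h : 'cV[F]_k -> F).

(** [g] is a polynomial of degree at most [m] in each coordinate. *)
Definition coord_poly m g := forall x j, exists2 p : {poly F}, (size p <= m.+1)%N &
  forall t, g (x + t *: delta_mx j 0) = p.[t].

Lemma coord_polyW m m' g : (m <= m')%N -> coord_poly m g -> coord_poly m' g.
Proof. by move=> mm' gp x j; have [p sp pE] := gp x j; exists p => //; apply: leq_trans sp _. Qed.

Lemma coord_poly_sum (T : finType) m (a : T -> F) (gs : T -> 'cV[F]_k -> F) :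
  (forall i, coord_poly m (gs i)) -> coord_poly m (fun x => \sum_i a i * gs i x).
Proof.
move=> gp x j; have /choice[p pP] : forall i, exists p : {poly F}, (size p <= m.+1)%N /\
    forall t, gs i (x + t *: delta_mx j 0) = p.[t].
  by move=> i; have [p] := gp i x j; exists p.
exists (\sum_i a i *: p i).
  apply: (big_ind (fun q : {poly F} => size q <= m.+1)%N) => [|q r sq sr|i _].
  - by rewrite size_poly0.
  - by rewrite (leq_trans (size_polyD _ _)) // geq_max sq sr.
  - by rewrite (leq_trans (size_scale_leq _ _)) // (pP i).1.
move=> t; rewrite horner_sum; apply: eq_bigr => i _.
by rewrite hornerZ (pP i).2.
Qed.

Lemma coord_poly_mul m m' g h : coord_poly m g -> coord_poly m' h ->
  coord_poly (m + m') (fun x => g x * h x).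
Proof.
move=> gp hp x j; have [p sp pE] := gp x j; have [q sq qE] := hp x j.
exists (p * q); first by have := size_polyMleq p q; lia.
by move=> t; rewrite hornerM pE qE.
Qed.

Lemma coord_poly_linear (v : 'rV[F]_k) : coord_poly 1 (fun x => (v *m x) 0 0).
Proof.
move=> x j; exists (((v *m x) 0 0)%:P + (v 0 j)%:P * 'X).
  apply: leq_trans (size_polyD _ _) _; rewrite geq_max (leq_trans (size_polyC_leq1 _)) //.
  by apply: leq_trans (size_polyMleq _ _) _; rewrite size_polyX; have := size_polyC_leq1 (v 0 j); lia.
move=> t; rewrite !hornerE mulmxDr -scalemxAr -colE mxE; congr (_ + _).
by rewrite !mxE mulrC.
Qed.

Lemma coord_poly_prods R (D : 'M[F]_(R, k)) n (i : 'I_'C(R, n)) :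
  coord_poly n (fun x => subset_prods n (D *m x)^T i 0).
Proof.
have gp (s : seq 'I_R) : coord_poly (size s) (fun x => \prod_(r <- s) (row r D *m x) 0 0).
  elim: s => [|r s IH] /=.
    by move=> x j; exists 1%:P; [rewrite size_polyC oner_eq0 | move=> t; rewrite big_nil hornerC].
  have := coord_poly_mul (coord_poly_linear (row r D)) IH.
  by move=> H x j; have [p sp pE] := H x j; exists p => // t; rewrite big_cons pE.
have := gp (enum (subset_at i)); rewrite -cardE card_subset_at => H x j.
have [p sp pE] := H x j; exists p => // t; rewrite -pE mxE big_enum /=.
by apply: eq_bigr => r _; rewrite -row_mul !mxE.
Qed.

(** The coordinates are freed one after the other: along each of them, a polynomial
of degree at most [m] with [m + 1] roots is zero. *)
Lemma vanish_on_grid m g : coord_poly m g ->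
  (forall x : 'cV_k, (forall j, exists2 a, (a <= m)%N & x j 0 = a%:R) -> g x = 0) ->
  forall x, g x = 0.
Proof.
move=> gp g0 x; suff H c : (c <= k)%N -> forall x : 'cV_k,
    (forall j : 'I_k, (c <= j)%N -> exists2 a, (a <= m)%N & x j 0 = a%:R) -> g x = 0.
  by apply: (H k (leqnn k)) => j; rewrite leqNgt ltn_ord.
elim: c => [|c IH] ck {}x xP; first by apply: g0 => j; apply: xP.
pose j := Ordinal ck; pose x0 := x - x j 0 *: delta_mx j 0.
have [p sp pE] := gp x0 j.
have xE t i : (x0 + t *: delta_mx j 0) i 0 = if i == j then t else x i 0.
  rewrite !mxE eqxx andbT; case: eqVneq => [->|_] /=.
    by rewrite !mulr1 subrr add0r.
  by rewrite !mulr0 subr0 addr0.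
suff p0 : p = 0 by rewrite -(subrK (x j 0 *: delta_mx j 0) x) pE p0 horner0.
apply: (@roots_geq_poly_eq0 _ p [seq a%:R | a <- iota 0 m.+1]).
- apply/allP => _ /mapP[a am ->]; rewrite mem_iota add0n ltnS /= in am.
  rewrite /root -pE; apply/eqP; apply: (IH (ltnW ck)) => i ci.
  rewrite xE; case: eqVneq => [_|ij]; first by exists a.
  by apply: xP; rewrite ltn_neqAle ci andbT eq_sym; apply: contra ij => /eqP e; apply/eqP/val_inj.
- rewrite map_inj_uniq ?iota_uniq // => a b /eqP.
  by rewrite eqr_nat => /eqP.
- by rewrite size_map size_iota.
Qed.

Definition grid m (l : 'I_(grid_size k m)) : 'cV[F]_k := map_mx intr (grid_int l).

Lemma vanish_grid m g : coord_poly m g -> (forall l, g (@grid m l) = 0) -> forall x, g x = 0.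
Proof.
move=> gp g0; apply: vanish_on_grid gp _ => x xP.
have /choice[a aP] : forall j, exists a : 'I_m.+1, x j 0 = a%:R.
  by move=> j; have [a am ->] := xP j; exists (Ordinal (am : a < m.+1)%N).
have -> : x = @grid m (enum_rank [ffun j => a j]).
  by apply/colP => j; rewrite !mxE enum_rankK ffunE aP.
exact: g0.
Qed.

End Interpolation.

(** * The pencil of a star configuration *)

(** The rows [c_r] of [D] are linear forms in [k] variables, any [k] of them being
independent, and there are [n + k - 1] of them. For each set [Q] of [n] of them there
is, up to scaling, one star point at which exactly the forms in [Q] do not vanish. The
product of [n] distinct forms is then non-zero at exactly one star point, and the
product of [n + 1] distinct forms vanishes at all of them. *)

Section Pencil.
Context {F : realType} {R k n : nat} (D : 'M[F]_(R, k)).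
Hypotheses (kD : kfree k D) (Rnk : R.+1 = (n + k)%N) (n0 : (0 < n)%N).

Notation pt := (@grid F k n.+1).

(** Products of forms are represented by their values on the grid. *)
Definition form_values m : 'M[F]_(grid_size k n.+1, 'C(R, m)) :=
  \matrix_(l, i) subset_prods m (D *m pt l)^T i 0.

Definition mul_form (l : 'cV[F]_k) : 'M[F]_(grid_size k n.+1) :=
  diag_mx (\row_i (l^T *m pt i) 0 0).

Context (xs : 'I_'C(R, n) -> 'cV[F]_k).
Hypothesis xsP : forall q, supp (D *m xs q)^T = subset_at q.

Lemma prods_at_xs m (i : 'I_'C(R, m)) q :
  (subset_prods m (D *m xs q)^T i 0 != 0) = (subset_at i \subset subset_at q).
Proof.
rewrite mxE -(xsP q); apply/prodf_neq0/subsetP => h r /h; by rewrite inE.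
Qed.

Lemma prods_at_xs_neq (i q : 'I_'C(R, n)) : i != q -> subset_prods n (D *m xs q)^T i 0 = 0.
Proof.
move=> iq; apply/eqP; rewrite -[_ == _]negbK prods_at_xs; apply: contra iq => sub.
by apply/eqP/subset_at_inj/eqP; rewrite eqEcard sub !card_subset_at leqnn.
Qed.

Lemma prods_at_xs_eq (q : 'I_'C(R, n)) : subset_prods n (D *m xs q)^T q 0 != 0.
Proof. by rewrite prods_at_xs. Qed.

Lemma prods_at_xs_succ (i : 'I_'C(R, n.+1)) q : subset_prods n.+1 (D *m xs q)^T i 0 = 0.
Proof.
apply/eqP; rewrite -[_ == _]negbK prods_at_xs; apply/negP => /subset_leq_card.
by rewrite !card_subset_at ltnn.
Qed.

Lemma form_values_indep : indep_cols (form_values n).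
Proof.
move=> w w0; apply/colP => q; rewrite [RHS]mxE.
have g0 : forall x, \sum_i w i 0 * subset_prods n (D *m x)^T i 0 = 0.
  apply: (@vanish_grid F k n.+1) => [|l].
    by apply: coord_poly_sum => i; apply: coord_polyW (coord_poly_prods D i).
  have /colP/(_ l) := w0; rewrite [RHS]mxE mxE => e; rewrite -[RHS]e.
  by apply: eq_bigr => i _; rewrite [form_values _ _ _]mxE mulrC.
have /eqP := g0 (xs q); rewrite (bigD1 q) //= big1 ?addr0 => [|i iq].
  by rewrite mulf_eq0 (negPf (prods_at_xs_eq q)) orbF => /eqP.
by rewrite prods_at_xs_neq ?mulr0.
Qed.

Lemma pick_in (q : 'I_'C(R, n)) : exists r, r \in subset_at q.
Proof. by apply/card_gt0P; rewrite card_subset_at. Qed.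

(** Some form that does not vanish at the star point [xs q]. *)
Definition form_in q : 'cV[F]_k := (row (xchoose (pick_in q)) D)^T.

Lemma form_in_neq0 q : (form_in q)^T *m xs q != 0.
Proof.
rewrite /form_in trmxK; move: (xchoose _) (xchooseP (pick_in q)) => r.
rewrite -(xsP q) inE -row_mul; apply: contra => /eqP/matrixP/(_ 0 0).
by rewrite !mxE => ->.
Qed.

Lemma form_in_neq00 q : ((form_in q)^T *m xs q) 0 0 != 0.
Proof. by apply: contra (form_in_neq0 q) => /eqP e; rewrite [_ *m _]mx11_scalar e raddf0. Qed.

(** The [k - 1] rows outside [subset_at q] vanish at [xs q] and are independent, so
they generate all linear forms that do. *)
Lemma annihilator_span q (v : 'rV[F]_k) :
  v *m xs q = 0 -> (v <= rows_in (~: subset_at q) D)%MS.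
Proof.
move=> v0; have sub : (rows_in (~: subset_at q) D <= kermx (xs q))%MS.
  apply/rows_in_subP => r; rewrite inE => rq; apply/sub_kermxP.
  rewrite -row_mul; apply/matrixP => a b; rewrite !ord1 [RHS]mxE.
  by move: rq; rewrite -(xsP q) inE negbK => /eqP <-; rewrite !mxE.
have x0 : xs q != 0.
  by apply: contraTneq (form_in_neq0 q) => ->; rewrite mulmx0 eqxx.
have cQ : #|~: subset_at q| = k.-1.
  by have := cardsC (subset_at q); rewrite card_ord card_subset_at; lia.
have : (kermx (xs q) <= rows_in (~: subset_at q) D)%MS.
  rewrite -(mxrank_leqif_sup sub) mxrank_ker (rank_rows_in kD) ?cQ ?leq_pred //.
  suff -> : \rank (xs q) = 1%N by rewrite subn1.
  by apply/eqP; rewrite eqn_leq rank_leq_col lt0n mxrank_eq0.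
by apply: submx_trans; apply/sub_kermxP.
Qed.

(** [Y^T] is a projection of functions on the grid modulo the products of [n + 1]
forms. *)
Context {d : nat} (Y : 'M[F]_(grid_size k n.+1, d)).
Hypothesis Y_orth : forall v : 'cV[F]_(grid_size k n.+1),
  Y^T *m v = 0 <-> exists w, v = form_values n.+1 *m w.

Lemma mul_form_outside q r : r \notin subset_at q ->
  Y^T *m (mul_form (row r D)^T *m col q (form_values n)) = 0.
Proof.
move=> rq; have [|i iE] := @subset_at_surj R n.+1 (r |: subset_at q).
  by rewrite cardsU1 rq card_subset_at.
apply/Y_orth; exists (delta_mx i 0); rewrite -colE; apply/colP => l.
rewrite mul_diag_mx mxE [RHS]mxE [form_values _ _ _]mxE [RHS]mxE iE big_setU1 //=.
by congr (_ * _); [rewrite mxE trmxK -row_mul !mxE | do 3!rewrite [LHS]mxE].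
Qed.

Lemma mul_form_lin (l : 'cV[F]_k) (T : finType) (P : pred T) (u : T -> F) (ls : T -> 'cV[F]_k) :
  l = \sum_(t | P t) u t *: ls t -> mul_form l = \sum_(t | P t) u t *: mul_form (ls t).
Proof.
move=> ->; apply/matrixP => i j; rewrite summxE !mxE.
under [RHS]eq_bigr do rewrite !mxE.
have [->|ij] := eqVneq i j; last by rewrite mulr0n big1 // => t _; rewrite mulr0n mulr0.
rewrite mulr1n; under [RHS]eq_bigr do rewrite mulr1n mulr_sumr.
rewrite exchange_big; apply: eq_bigr => a _ /=.
rewrite !mxE summxE mulr_suml; apply: eq_bigr => t _.
by rewrite !mxE mulrA.
Qed.

Lemma mul_form_kill q (l : 'cV[F]_k) : l^T *m xs q = 0 ->
  Y^T *m (mul_form l *m col q (form_values n)) = 0.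
Proof.
move=> /annihilator_span/sub_rows_inP[u lE].
rewrite (@mul_form_lin l _ (mem (~: subset_at q)) (fun s => u 0 s) (fun s => (row s D)^T)).
  rewrite mulmx_suml mulmx_sumr big1 // => s; rewrite /= inE => sq.
  by rewrite -scalemxAl -scalemxAr mul_form_outside // scaler0.
by apply/trmx_inj; rewrite lE linear_sum; apply: eq_bigr => s _; rewrite linearZ /= trmxK.
Qed.

Definition pencil_left : 'M[F]_(d, 'C(R, n)) :=
  \matrix_(i, q) ((((form_in q)^T *m xs q) 0 0)^-1 *: (Y^T *m (mul_form (form_in q) *m col q (form_values n)))) i 0.

Lemma col_pencil_left q : col q pencil_left =
  (((form_in q)^T *m xs q) 0 0)^-1 *: (Y^T *m (mul_form (form_in q) *m col q (form_values n))).
Proof. by apply/colP => i; rewrite mxE [LHS]mxE. Qed.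

(** Modulo the products of [n + 1] forms, multiplication by [l] acts on the product
of the [n] forms in [subset_at q] as the scalar [l (xs q)]. *)
Lemma pencil_diag (l : 'cV[F]_k) :
  Y^T *m mul_form l *m form_values n =
  pencil_left *m diag_mx (\row_q (l^T *m xs q) 0 0).
Proof.
apply/matrixP => i q; rewrite mul_mx_diag.
suff /colP/(_ i) : col q (Y^T *m mul_form l *m form_values n) =
    (l^T *m xs q) 0 0 *: col q pencil_left.
  rewrite [col q (_ *m _) _ _]mxE [fun_of_matrix (_ *: _) _ _]mxE [col q _ _ _]mxE => ->.
  by rewrite [RHS]mxE [X in _ = _ * X]mxE mulrC.
rewrite col_pencil_left colE -mulmxA -colE -mulmxA.
set a := (l^T *m xs q) 0 0; set b := ((form_in q)^T *m xs q) 0 0; have b0 : b != 0 := form_in_neq00 q.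
have lE : l = (l - (a / b) *: form_in q) + (a / b) *: form_in q by rewrite subrK.
have -> : mul_form l = mul_form (l - (a / b) *: form_in q) + (a / b) *: mul_form (form_in q).
  rewrite {1}lE (@mul_form_lin _ bool xpredT (fun t => if t then 1 else a / b)
    (fun t => if t then l - (a / b) *: form_in q else form_in q)) ?big_bool /= ?scale1r //.
rewrite mulmxDl mulmxDr (@mul_form_kill q (l - (a / b) *: form_in q)) ?add0r.
  by rewrite -scalemxAl -scalemxAr scalerA.
rewrite linearB linearZ /= mulmxBl -scalemxAl.
by rewrite [l^T *m _]mx11_scalar [(form_in q)^T *m _]mx11_scalar -/a -/b scale_scalar_mx divfK ?subrr.
Qed.

(** A relation modulo the products of [n + 1] forms holds on the grid, hence
everywhere; evaluated at the star points, it is trivial. *)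
Lemma pencil_left_indep : indep_cols pencil_left.
Proof.
move=> w w0; pose ga q := (((form_in q)^T *m xs q) 0 0)^-1 * w q 0.
have : Y^T *m (\sum_q ga q *: (mul_form (form_in q) *m col q (form_values n))) = 0.
  rewrite -[RHS]w0 mulmx_sumr.
  apply/colP => i; rewrite summxE [RHS]mxE; apply: eq_bigr => q _.
  by rewrite -scalemxAr /ga [pencil_left _ _]mxE mxE [in RHS]mxE; ring.
case/Y_orth => w' wE.
pose g x := \sum_(t : 'I_'C(R, n) + 'I_'C(R, n.+1)) (match t with inl q => ga q | inr i => - w' i 0 end) *
  (match t with inl q => ((form_in q)^T *m x) 0 0 * subset_prods n (D *m x)^T q 0
   | inr i => subset_prods n.+1 (D *m x)^T i 0 end).
have g0 x : g x = 0.
  apply: (@vanish_grid F k n.+1 g) => [|l].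
    apply: coord_poly_sum => -[q|i]; last exact: coord_poly_prods.
    exact: (coord_poly_mul (coord_poly_linear (form_in q)^T) (coord_poly_prods D q)).
  rewrite /g big_sumType /=; under [X in _ + X]eq_bigr do rewrite mulNr.
  rewrite sumrN; apply/eqP; rewrite subr_eq0; apply/eqP.
  have /colP/(_ l) := wE; rewrite summxE [RHS]mxE => e.
  transitivity (\sum_q (ga q *: (mul_form (form_in q) *m col q (form_values n))) l 0).
    apply: eq_bigr => q _; rewrite [RHS]mxE mul_diag_mx [X in _ = _ * X]mxE.
    by congr (_ * (_ * _)); [rewrite [RHS]mxE | rewrite [RHS]mxE [RHS]mxE].
  by rewrite e; apply: eq_bigr => i _; rewrite [form_values _ _ _]mxE mulrC.
apply/colP => q; rewrite [RHS]mxE; have /eqP := g0 (xs q).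
rewrite /g big_sumType /= [X in _ + X]big1 ?addr0 => [|i _]; last by rewrite prods_at_xs_succ mulr0.
rewrite (bigD1 q) //= big1 ?addr0 => [|i iq]; last by rewrite prods_at_xs_neq ?mulr0.
rewrite !mulf_eq0 (negPf (form_in_neq00 q)) (negPf (prods_at_xs_eq q)) !orbF invr_eq0 (negPf (form_in_neq00 q)).
by move/eqP.
Qed.

End Pencil.

Arguments mul_form {F k} n l.
Arguments form_values {F R k} n D m.

Section Eigen.
Context {F : fieldType}.

Lemma indep_cols_inj m N p (U : 'M[F]_(m, N)) (X1 X2 : 'M[F]_(N, p)) :
  indep_cols U -> U *m X1 = U *m X2 -> X1 = X2.
Proof.
move=> Ui /eqP; rewrite -subr_eq0 -mulmxBr => /eqP e; apply/eqP; rewrite -subr_eq0.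
apply/eqP/matrixP => i j; have /Ui/colP/(_ i) : U *m col j (X1 - X2) = 0.
  by rewrite colE mulmxA e mul0mx.
by rewrite !mxE.
Qed.

(** Solving for [W] turns the rectangular pencil into the square matrix with
eigenvectors the columns of [P]. *)
Lemma pencil_solve d N (M1 M2 U : 'M[F]_(d, N)) (P : 'M[F]_N) (d1 d2 : 'rV[F]_N) :
  P \in unitmx -> indep_cols U -> (forall i, d1 0 i != 0) ->
  M1 *m P = U *m diag_mx d1 -> M2 *m P = U *m diag_mx d2 ->
  forall W, M1 *m W = M2 <-> W *m P = P *m diag_mx (\row_i (d2 0 i / d1 0 i)).
Proof.
move=> uP Ui d10 e1 e2 W.
have dd : diag_mx d1 *m diag_mx (\row_i (d2 0 i / d1 0 i)) = diag_mx d2.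
  rewrite mulmx_diag; congr diag_mx; apply/rowP => i; rewrite !mxE.
  by rewrite mulrC divfK.
have key : M1 *m (P *m diag_mx (\row_i (d2 0 i / d1 0 i))) = M2 *m P.
  by rewrite mulmxA e1 -mulmxA dd e2.
split=> [e|e]; last first.
  by rewrite -[W](mulmxK uP) e mulmxA key mulmxK.
have : M1 *m (W *m P) = M1 *m (P *m diag_mx (\row_i (d2 0 i / d1 0 i))).
  by rewrite key mulmxA e.
have M1i : indep_cols M1.
  move=> w M1w; rewrite -[w](mulKVmx uP); suff -> : invmx P *m w = 0 by rewrite mulmx0.
  have /Ui dw : U *m (diag_mx d1 *m (invmx P *m w)) = 0.
    by rewrite mulmxA -e1 -mulmxA mulKVmx.
  apply/colP => i; have /colP/(_ i) := dw; rewrite mul_diag_mx mxE [RHS]mxE => /eqP.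
  by rewrite mulf_eq0 (negPf (d10 i)) /= [RHS]mxE => /eqP.
exact: indep_cols_inj.
Qed.

(** The eigenvalues being distinct, each column of any [V] is an eigenvector of [W]
proportional to a column of [P], and no column of [P] is missed. *)
Lemma eigenvectors_of_diag N (W P V : 'M[F]_N) (e al be : 'rV[F]_N) :
  P \in unitmx -> W *m P = P *m diag_mx e -> injective (fun i => e 0 i) ->
  V \in unitmx -> (forall i, (al 0 i != 0) || (be 0 i != 0)) ->
  W *m V *m diag_mx be = 1%:M *m V *m diag_mx al ->
  exists (ka : 'S_N) (z : 'I_N -> F), forall i, z i != 0 /\ col i V = z i *: col (ka i) P.
Proof.
move=> uP WP ei uV ab; rewrite mul1mx => eV.
have [y VE] : exists y, V = P *m y by exists (invmx P *m V); rewrite mulKVmx.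
have uy : y \in unitmx by move: uV; rewrite VE unitmx_mul => /andP[].
have ey q i : e 0 q * y q i * be 0 i = y q i * al 0 i.
  have : P *m (diag_mx e *m y *m diag_mx be) = P *m (y *m diag_mx al).
    by rewrite !mulmxA -WP -(mulmxA W) -VE eV.
  move/(can_inj (mulKmx uP))/matrixP/(_ q i).
  by rewrite !mul_mx_diag mul_diag_mx ![in LHS]mxE [RHS]mxE.
have y0 i : exists q, y q i != 0.
  apply/existsP; apply: contraT => /existsPn h.
  have : col i y = 0 by apply/colP => q; have := h q; rewrite negbK !mxE => /eqP.
  rewrite colE => /(congr1 (mulmx (invmx y))); rewrite mulmx0 mulKmx //.
  by move/colP/(_ i); rewrite !mxE !eqxx => /eqP; rewrite oner_eq0.
have be0 i : be 0 i != 0.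
  have := ab i; case: (be 0 i =P 0) => [b0|//]; rewrite orbF.
  have [q yq] := y0 i; have /eqP := ey q i; rewrite b0 mulr0 eq_sym mulf_eq0 (negPf yq) /=.
  by move/eqP->; rewrite eqxx.
pose ka i := xchoose (y0 i); have kaP i : y (ka i) i != 0 := xchooseP (y0 i).
have yE i q : q != ka i -> y q i = 0.
  apply: contraNeq => yq; apply/eqP/ei.
  have val p : y p i != 0 -> e 0 p = al 0 i / be 0 i.
    by move=> yp; apply: (mulIf (be0 i)); apply: (mulfI yp); rewrite divfK // -ey; ring.
  by rewrite !val.
have cE i : col i V = y (ka i) i *: col (ka i) P.
  apply/colP => a; rewrite VE !mxE (bigD1 (ka i)) //= big1 ?addr0 => [|q qi]; first by rewrite mulrC.
  by rewrite yE ?mulr0.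
have ka_inj : injective ka.
  move=> i j kij; apply/eqP; apply: contraT => ij.
  have : V *m ((y (ka i) i)^-1 *: delta_mx i 0 - (y (ka j) j)^-1 *: delta_mx j 0) = 0 :> 'cV_N.
    rewrite mulmxBr -!scalemxAr -!colE !cE !scalerA !mulVf // !scale1r kij.
    exact: subrr.
  move/(congr1 (mulmx (invmx V))); rewrite mulmx0 mulKmx // => /colP/(_ i).
  rewrite !mxE !eqxx (negPf ij) mulr0 subr0 mulr1 => /eqP.
  by rewrite invr_eq0 (negPf (kaP i)).
exists (perm ka_inj), (fun i => y (ka i) i) => i; rewrite permE; split=> //.
Qed.

Lemma rank_outer d k (u : 'cV[F]_d) (x : 'cV[F]_k) : u != 0 -> x != 0 -> \rank (u *m x^T) = 1%N.
Proof.
move=> u0 x0; apply/eqP; rewrite eqn_leq (leq_trans (mxrankM_maxl _ _)) ?rank_leq_col //=.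
rewrite lt0n mxrank_eq0; apply: contraNneq u0 => /matrixP e.
have [j xj] : exists j, x j 0 != 0.
  apply/existsP; apply: contraNT x0 => /existsPn h; apply/eqP/colP => j.
  by rewrite mxE; apply/eqP; have := h j; rewrite negbK.
apply/eqP/colP => i; have /eqP := e i j; rewrite !mxE big_ord1 !mxE mulf_eq0 (negPf xj) orbF.
by move/eqP.
Qed.

Lemma rank1_factor d k (u X : 'cV[F]_d) (x : 'cV[F]_k) (Y : 'rV[F]_k) : u != 0 ->
  x != 0 -> u *m x^T = X *m Y -> exists2 a, a != 0 & Y = a *: x^T.
Proof.
move=> u0 x0 e.
have [i ui] : exists i, u i 0 != 0.
  apply/existsP; apply: contraNT u0 => /existsPn h; apply/eqP/colP => j.
  by rewrite mxE; apply/eqP; have := h j; rewrite negbK.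
have eY : u i 0 *: x^T = X i 0 *: Y.
  by apply/rowP => j; have /matrixP/(_ i j) := e; rewrite !mxE !big_ord1 !mxE.
have X0 : X i 0 != 0.
  apply: contraNneq x0 => X0; move/eqP: (eY); rewrite X0 scale0r scaler_eq0 (negPf ui) /=.
  by rewrite trmx_eq0.
exists ((X i 0)^-1 * u i 0); first by rewrite mulf_neq0 ?invr_eq0.
by rewrite -scalerA eY scalerA mulVf ?scale1r.
Qed.

End Eigen.

Section Blocks.
Context {F : Type} {m s : nat} (c : 'M[F]_(m, 1)) (M : 'M[F]_(m, s)).

Lemma row_mx_lift i j : (row_mx c M : 'M_(m, s.+1)) i (lift ord0 j) = M i j.
Proof. by rewrite -(row_mxEr c M i j); congr (fun_of_matrix _ _ _); apply: val_inj. Qed.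

Lemma row_mx_ord0 i : (row_mx c M : 'M_(m, s.+1)) i ord0 = c i ord0.
Proof. by rewrite -(row_mxEl c M i ord0); congr (fun_of_matrix _ _ _); apply: val_inj. Qed.

End Blocks.

(** * Random compression and random linear forms *)

Section RandomChoices.
Context {F : realType}.

Definition moments K k (xs : seq F) : 'M[F]_(K, k) := \matrix_(a, j) xs`_j ^+ a.

(** The invariant of the random compression of [K] columns to [k]: on every [k]-set of
rows of [D], the compressed columns drawn so far are independent. *)
Definition compresses R K (D : 'M[F]_(R, K)) k xs := forall S : {set 'I_R}, #|S| = k ->
  indep_cols (rows_in S D *m moments K (size xs) xs).

Lemma compresses_nil R K (D : 'M[F]_(R, K)) k : compresses D k [::].
Proof. by move=> S _ w _; apply/colP => -[]. Qed.

(** The left kernel of the columns drawn so far strictly contains that of the [k] rows: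
some combination [u] of the rows is killed by these columns without being zero, and a
generic moment vector is not killed by it. *)
Lemma compresses_cons R K (D : 'M[F]_(R, K)) k xs : kfree k D -> (size xs < k)%N ->
  compresses D k xs -> exists bad : seq F, forall x, x \notin bad -> compresses D k (x :: xs).
Proof.
move=> kD sxs Dxs.
have ex (S : {set 'I_R}) : exists u : 'rV[F]_R, #|S| = k ->
    u *m (rows_in S D *m moments K (size xs) xs) = 0 /\ u *m rows_in S D != 0.
  have [cS|nS] := eqVneq #|S| k; last by exists 0 => /eqP; rewrite (negPf nS).
  have /row_subPn[i iP] : ~~ (kermx (rows_in S D *m moments K (size xs) xs) <= kermx (rows_in S D))%MS.
    apply/negP => /mxrankS; rewrite !mxrank_ker (rank_rows_in kD) ?cS //.
    have := rank_leq_col (rows_in S D *m moments K (size xs) xs).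
    have := rank_rows_in_le S D; have := rank_leq_row (rows_in S D).
    by rewrite (rank_rows_in kD) ?cS //; lia.
  exists (row i (kermx (rows_in S D *m moments K (size xs) xs))) => _.
  split; first by rewrite -row_mul mulmx_ker row0.
  by apply: contra iP => /eqP e; apply/sub_kermxP.
have [u uP] := choice ex.
have [|bad badP] := @moment_generic F K [seq u Q *m rows_in Q D | Q <- enum [set S : {set 'I_R} | #|S| == k]].
  by move=> _ /mapP[S + ->]; rewrite mem_enum inE => /eqP/uP[].
exists bad => x /badP xP S cS w.
have [u0 u1] := uP S cS.
have -> : moments K (size (x :: xs)) (x :: xs) = row_mx (moment K x) (moments K (size xs) xs).
  apply/matrixP => a j; rewrite [LHS]mxE.
  case: (unliftP ord0 j) => [j'|] ->.
    by rewrite row_mx_lift mxE.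
  by rewrite row_mx_ord0 mxE.
pose w1 : 'cV_1 := usubmx (w : 'cV_(1 + size xs)); pose w2 : 'cV_(size xs) := dsubmx (w : 'cV_(1 + size xs)).
have wE : w = col_mx w1 w2 by rewrite [RHS]vsubmxK.
have key : rows_in S D *m row_mx (moment K x) (moments K (size xs) xs) *m col_mx w1 w2 =
    rows_in S D *m moment K x *m w1 + rows_in S D *m moments K (size xs) xs *m w2.
  by rewrite mul_mx_row mul_row_col.
rewrite wE => /(etrans (esym key)) e.
have w10 : w1 = 0.
  have /eqP : (u S *m rows_in S D *m moment K x) *m w1 = 0.
    by have := congr1 (mulmx (u S)) e; rewrite mulmxDr mulmx0 [X in _ + X]mulmxA u0 mul0mx addr0 !mulmxA => ->.
  have h : u S *m rows_in S D *m moment K x != 0.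
    by apply: xP; apply: map_f; rewrite mem_enum inE cS.
  rewrite [X in X *m _]mx11_scalar mul_scalar_mx scaler_eq0 => /orP[/eqP h0|/eqP//].
  by case/eqP: h; rewrite [LHS]mx11_scalar h0 raddf0.
have w20 : w2 = 0 by apply: (Dxs S cS); rewrite -[RHS]e w10 mulmx0 add0r.
by rewrite w10 w20 col_mx0.
Qed.

Lemma compresses_kfree R K (D : 'M[F]_(R, K)) k xs : (k <= R)%N -> size xs = k ->
  compresses D k xs -> kfree k (D *m moments K k xs).
Proof.
move=> kR sxs Dxs; apply: kfree_rank => // S cS; have := Dxs S cS; rewrite sxs.
have -> : rows_in S D *m moments K k xs = rows_in S (D *m moments K k xs).
  apply/row_matrixP => r; rewrite row_mul !row_rows_in row_mul.
  by case: (r \in S); rewrite ?mul0mx.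
by move/full_column_rankP/eqP ->.
Qed.

Lemma generic_form k N (xs : 'I_N -> 'cV[F]_k) : (forall q, xs q != 0) ->
  exists bad : seq F, forall t, t \notin bad -> forall q, ((moment k t)^T *m xs q) 0 0 != 0.
Proof.
move=> x0; have [|bad badP] := @moment_generic F k [seq (xs q)^T | q <- enum 'I_N].
  by move=> _ /mapP[q _ ->]; rewrite trmx_eq0.
exists bad => t /badP tP q; have := tP (xs q)^T (map_f _ (mem_enum _ q)).
apply: contra => /eqP e; rewrite -[X in X == _]trmxK trmx_mul trmxK.
by rewrite [_ *m _]mx11_scalar e raddf0 trmx0.
Qed.

(** The two forms of the pencil: with [l] fixed, equal quotients at [q] and [q'] mean
that the new form vanishes at a vector depending on [q] and [q'] only. *)
Lemma generic_ratio k N (xs : 'I_N -> 'cV[F]_k) (l : 'cV[F]_k) :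
  (forall q q', q != q' -> (l^T *m xs q') 0 0 *: xs q - (l^T *m xs q) 0 0 *: xs q' != 0) ->
  (forall q, (l^T *m xs q) 0 0 != 0) ->
  exists bad : seq F, forall t, t \notin bad ->
    injective (fun q => ((moment k t)^T *m xs q) 0 0 / (l^T *m xs q) 0 0).
Proof.
move=> dx l0; pose v (p : 'I_N * 'I_N) := ((l^T *m xs p.2) 0 0 *: xs p.1 - (l^T *m xs p.1) 0 0 *: xs p.2)^T.
have [|bad badP] := @moment_generic F k [seq v p | p <- enum [pred p : 'I_N * 'I_N | p.1 != p.2]].
  by move=> _ /mapP[[q q'] + ->]; rewrite mem_enum inE /v trmx_eq0 /= => /dx.
exists bad => t /badP tP q q' e; apply/eqP; apply: contraT => qq'.
have := tP (v (q, q')); rewrite map_f ?mem_enum ?inE //= => /(_ isT)/eqP; case.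
apply/trmx_inj; rewrite trmx_mul trmx0 /v trmxK mulmxBr -!scalemxAr.
rewrite [(moment k t)^T *m xs q]mx11_scalar [(moment k t)^T *m xs q']mx11_scalar !scale_scalar_mx.
rewrite -raddfB /= [X in X%:M](_ : _ = 0) ?raddf0 //.
apply/eqP; rewrite subr_eq0; apply/eqP; move: e.
set a := fun_of_matrix _ _ _; set b := (l^T *m xs q) 0 0; set a' := fun_of_matrix _ _ _; set b' := (l^T *m xs q') 0 0.
have b0 : b != 0 := l0 q; have b0' : b' != 0 := l0 q'.
by move/eqP; rewrite eqr_div // => /eqP e; rewrite mulrC e mulrC.
Qed.

End RandomChoices.

(** * A language of matrix expressions *)

(** A procedure as a function of the length of the environment in which it is run,
which is the index of the next result. *)
Definition builder := nat -> procedure.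

(** The last [nat] of an operation node selects one of its results. *)
Inductive expr :=
| Var of nat
| E0 of mxop & nat
| E1 of mxop & nat & expr
| E2 of mxop & nat & expr & expr.

Definition arity (o : mxop) := match o with
  | OpRankFactor | OpQR => 2
  | OpLUP | OpSVD | OpGEVD => 3
  | _ => 1
  end%N.

(** Evaluates [e], goes on with [k] on the index of the value, and falls back on [q]
as soon as an operation cannot be performed. *)
Fixpoint compile (e : expr) (k : nat -> builder) (q : builder) : builder :=
  match e with
  | Var i => k i
  | E0 o f => fun sz => Apply o [::] (k (sz + f)%N (sz + arity o)%N) (q sz)
  | E1 o f e1 => compile e1 (fun i sz =>
      Apply o [:: i] (k (sz + f)%N (sz + arity o)%N) (q sz)) q
  | E2 o f e1 e2 => compile e1 (fun i => compile e2 (fun j sz =>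
      Apply o [:: i; j] (k (sz + f)%N (sz + arity o)%N) (q sz)) q) q
  end.

Local Notation mx := (@AnyMx _ _ _).

Section Computes.
Context {F : realType}.
Notation anymx := (@anymx F).
Implicit Types (a : anymx) (outs : seq anymx).

Lemma mx_inj m n (M N : 'M[F]_(m, n)) : mx M = mx N -> M = N.
Proof.
move/(congr1 (fun a => conform_mx M (mxof a))) => /=.
by rewrite !conform_mx_id.
Qed.

Lemma seq1_inj a a' : [:: a] = [:: a'] -> a = a'. Proof. by case. Qed.

Lemma seq2_inj a a' b b' : [:: a; b] = [:: a'; b'] -> a = a' /\ b = b'.
Proof. by move=> e; split; [have := congr1 (head a) e | have := congr1 (last a) e]. Qed.

Lemma computes_size o ins outs : computes o ins outs -> size outs = arity o.
Proof. by case. Qed.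

Lemma computes_const m n (N : 'M[int]_(m, n)) outs :
  computes (OpConst N) [::] outs -> outs = [:: mx (map_mx intr N : 'M[F]_(m, n))].
Proof.
move Eo: (OpConst N) => o; move Ei: [::] => ins H; case: H Eo Ei => // m' n' N' e _.
by move: e => /(congr1 (fun o => if o is OpConst m n N then mx (map_mx intr N : 'M[F]_(m, n)) else mx (0 : 'M[F]_0))) <-.
Qed.

Ltac same_dims e := 
  let e1 := fresh in let e2 := fresh in
  have e1 := congr1 (@nrows F) e; have e2 := congr1 (@ncols F) e; simpl in e1, e2; subst;
  move/mx_inj: e => e.

Lemma computes_mul m n p (M : 'M[F]_(m, n)) (N : 'M[F]_(n, p)) outs :
  computes OpMul [:: mx M; mx N] outs -> outs = [:: mx (M *m N)].
Proof.
move Eo: OpMul => o; move Ei: [:: _; _] => ins H; case: H Eo Ei => // m' n' p' M' N' _.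
by case/seq2_inj => e e'; same_dims e; same_dims e'; subst.
Qed.

Lemma computes_tr m n (M : 'M[F]_(m, n)) outs :
  computes OpTranspose [:: mx M] outs -> outs = [:: mx M^T].
Proof.
move Eo: OpTranspose => o; move Ei: [:: _] => ins H; case: H Eo Ei => // m' n' M' _.
by move/seq1_inj => e; same_dims e; subst.
Qed.

Lemma computes_kron m n p q (M : 'M[F]_(m, n)) (N : 'M[F]_(p, q)) outs :
  computes OpKronecker [:: mx M; mx N] outs -> outs = [:: mx (tensmx M N)].
Proof.
move Eo: OpKronecker => o; move Ei: [:: _; _] => ins H; case: H Eo Ei => // m' n' p' q' M' N' _.
by case/seq2_inj => e e'; same_dims e; same_dims e'; subst.
Qed.

Lemma computes_row m n p (M : 'M[F]_(m, n)) (N : 'M[F]_(m, p)) outs :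
  computes OpRowBlock [:: mx M; mx N] outs -> outs = [:: mx (row_mx M N)].
Proof.
move Eo: OpRowBlock => o; move Ei: [:: _; _] => ins H; case: H Eo Ei => // m' n' p' M' N' _.
by case/seq2_inj => e e'; same_dims e; same_dims e'; subst.
Qed.

Lemma computes_reshape m n p q (M : 'M[F]_(m, n)) outs :
  computes (OpReshape p q) [:: mx M] outs -> (m * n = p * q)%N /\
  exists2 X : 'M_(p, q), outs = [:: mx X] &
    forall (i : 'I_m) (j : 'I_n) (k : 'I_p) (l : 'I_q), (i * n + j = k * q + l)%N -> X k l = M i j.
Proof.
move Eo: (OpReshape p q) => o; move Ei: [:: _] => ins H.
case: H Eo Ei => // m' n' p' q' M' X mn XP [ep eq_] /seq1_inj e; subst.
by same_dims e; subst; split=> //; exists X.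
Qed.

Lemma computes_compound k m n (M : 'M[F]_(m, n)) outs :
  computes (OpCompound k) [:: mx M] outs -> outs = [:: mx (compound k M)].
Proof.
move Eo: (OpCompound k) => o; move Ei: [:: _] => ins H; case: H Eo Ei => // k' m' n' M' _ [ek].
by move/seq1_inj => e; same_dims e; subst.
Qed.

Lemma computes_solve m n p (M : 'M[F]_(m, n)) (N : 'M[F]_(m, p)) outs :
  computes OpSolve [:: mx M; mx N] outs -> exists2 X : 'M_(n, p), outs = [:: mx X] & M *m X = N.
Proof.
move Eo: OpSolve => o; move Ei: [:: _; _] => ins H; case: H Eo Ei => // m' n' p' M' N' X MX _.
by case/seq2_inj => e e'; same_dims e; same_dims e'; subst; exists X.
Qed.

Lemma computes_rank_factor m n (M : 'M[F]_(m, n)) r outs : \rank M = r ->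
  computes OpRankFactor [:: mx M] outs ->
  exists (X : 'M_(m, r)) (Y : 'M_(r, n)), outs = [:: mx X; mx Y] /\ M = X *m Y.
Proof.
move=> rM; move Eo: OpRankFactor => o; move Ei: [:: _] => ins H; case: H Eo Ei => // m' n' M' X Y MXY _.
by move/seq1_inj => e; same_dims e; subst; exists X, Y.
Qed.

Lemma computes_orth m n (M : 'M[F]_(m, n)) outs :
  computes OpOrthCompl [:: mx M] outs -> exists d (X : 'M_(m, d)),
    [/\ outs = [:: mx X], M^T *m X = 0, \rank X = d & (\rank M + d = m)%N].
Proof.
move Eo: OpOrthCompl => o; move Ei: [:: _] => ins H; case: H Eo Ei => // m' n' d M' X h1 h2 h3 _.
by move/seq1_inj => e; same_dims e; subst; exists d, X.
Qed.

Lemma computes_gevd n (M N : 'M[F]_n) outs :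
  computes OpGEVD [:: mx M; mx N] outs -> exists (V : 'M_n) (al be : 'rV_n),
    [/\ outs = [:: mx V; mx al; mx be], V \in unitmx,
        forall i, (al 0 i != 0) || (be 0 i != 0) &
        M *m V *m diag_mx be = N *m V *m diag_mx al].
Proof.
move Eo: OpGEVD => o; move Ei: [:: _; _] => ins H; case: H Eo Ei => // n' M' N' V al be uV ab h _.
by case/seq2_inj => e e'; same_dims e; same_dims e'; subst; exists V, al, be.
Qed.

End Computes.

Section Logic.
Context {F : realType}.
Notation anymx := (@anymx F).
Variable post : anymx -> anymx -> anymx -> Prop.
Implicit Types (env : seq anymx) (P Q : anymx -> Prop) (b : bool).

Definition ext env env' := exists s, env' = env ++ s.

Lemma ext_refl env : ext env env. Proof. by exists [::]; rewrite cats0. Qed.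

Lemma ext_trans env2 env1 env3 : ext env1 env2 -> ext env2 env3 -> ext env1 env3.
Proof. by case=> s -> [t ->]; exists (s ++ t); rewrite catA. Qed.

Lemma ext_cat env s : ext env (env ++ s). Proof. by exists s. Qed.

Lemma ext_size env env' : ext env env' -> (size env <= size env')%N.
Proof. by case=> s ->; rewrite size_cat leq_addr. Qed.

Lemma get_ext env env' i : ext env env' -> (i < size env)%N -> get env' i = get env i.
Proof. by case=> s -> lt_i; rewrite /get nth_cat lt_i. Qed.

(** With [b = true] the operation has to be performable, with [b = false] it may
fail. *)
Definition step b o f (ins : seq anymx) P :=
  [/\ (f < arity o)%N, b -> exists outs, computes o ins outs &
    forall outs, computes o ins outs -> P (nth (mx (0 : 'M[F]_0)) outs f)].

(** Every possible value of [e] satisfies [P]; operations may have several results, so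
that an expression denotes a set of values rather than one. *)
Fixpoint wp b env e P : Prop :=
  match e with
  | Var i => (i < size env)%N /\ P (get env i)
  | E0 o f => step b o f [::] P
  | E1 o f e1 => wp b env e1 (fun x => step b o f [:: x] P)
  | E2 o f e1 e2 => wp b env e1 (fun x => wp b env e2 (fun y => step b o f [:: x; y] P))
  end.

Lemma step_mono b b' o f ins P Q : (b' -> b) -> (forall a, P a -> Q a) ->
  step b o f ins P -> step b' o f ins Q.
Proof. by move=> bb PQ [h1 h2 h3]; split=> // [/bb|outs /h3/PQ]. Qed.

Lemma wp_mono' b b' env e P Q : (b' -> b) -> (forall a, P a -> Q a) ->
  wp b env e P -> wp b' env e Q.
Proof.
move=> bb; elim: e P Q => [i|o f|o f e1 IH|o f e1 IH1 e2 IH2] P Q PQ /=.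
- by case=> h /PQ.
- exact: step_mono.
- by apply: IH => a; apply: step_mono.
- by apply: IH1 => a; apply: IH2 => a'; apply: step_mono.
Qed.

Lemma wp_mono b env e P Q : (forall a, P a -> Q a) -> wp b env e P -> wp b env e Q.
Proof. exact: wp_mono'. Qed.

Lemma wp_any b env e P : wp true env e P -> wp b env e P.
Proof. exact: wp_mono'. Qed.

Lemma wp_ext b env env' e P : ext env env' -> wp b env e P -> wp b env' e P.
Proof.
move=> ex; elim: e P => [i|o f|o f e1 IH|o f e1 IH1 e2 IH2] P //=.
- by case=> h Pi; rewrite (get_ext ex h) (leq_trans h (ext_size ex)).
- exact: IH.
- by move=> H; apply: IH1; apply: wp_mono H => a; apply: IH2.
Qed.

Lemma apply_ok b o f args k q env P :
  step b o f [seq get env i | i <- args] P ->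
  (forall i env', ext env env' -> (i < size env')%N -> P (get env' i) ->
     guarantees (k i (size env')) env' post) ->
  (~~ b -> guarantees (q (size env)) env post) ->
  guarantees (Apply o args (k (size env + f)%N (size env + arity o)%N) (q (size env))) env post.
Proof.
move=> [fa ex all] kP qP; split=> [outs c|nc]; last first.
  by case: b ex qP {all} => [/(_ isT)[outs /nc]|_ ]//; apply.
have so := computes_size c; rewrite -so -size_cat; apply: kP; first exact: ext_cat.
  by rewrite size_cat ltn_add2l so.
by rewrite /get nth_cat ltnNge leq_addr /= addKn; apply: all.
Qed.

Lemma compile_ok b e k q env P : wp b env e P ->
  (forall i env', ext env env' -> (i < size env')%N -> P (get env' i) ->
     guarantees (k i (size env')) env' post) ->
  (~~ b -> forall env', ext env env' -> guarantees (q (size env')) env' post) ->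
  guarantees (compile e k q (size env)) env post.
Proof.
elim: e env k P => [i|o f|o f e1 IH|o f e1 IH1 e2 IH2] env k P /= wpe kP qP.
- by case: wpe => h Pi; apply: kP => //; apply: ext_refl.
- by apply: (apply_ok (args := [::]) wpe) => // nb; apply: qP => //; apply: ext_refl.
- apply: (IH env _ _ wpe) => // i env' ex hi st.
  apply: (apply_ok (args := [:: i]) st) => [j env'' ex'|nb]; last exact: qP.
  by apply: kP; apply: ext_trans ex ex'.
- apply: (IH1 env _ _ wpe) => // i env' ex hi wp2.
  apply: (IH2 env' _ _ (wp_ext ex wp2)) => [j env'' ex' hj st|nb env'' ex']; last first.
    by apply: qP => //; apply: ext_trans ex ex'.
  have ex2 := ext_trans ex ex'.
  apply: (apply_ok (args := [:: i; j]) (b := b) (P := P)) => [|l env3 ex3|nb].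
  + by rewrite /= (get_ext ex' hi).
  + by apply: kP; apply: ext_trans ex2 ex3.
  + exact: qP.
Qed.

(** Nothing needs to be known about [e] if the run can be completed from any value and
after a failure: this deals with the attempts based on a wrong guess. *)
Lemma compile_total e k q env :
  (forall i env', ext env env' -> guarantees (k i (size env')) env' post) ->
  (forall env', ext env env' -> guarantees (q (size env')) env' post) ->
  guarantees (compile e k q (size env)) env post.
Proof.
have ap o f args k' env' : (forall i env'', ext env' env'' -> guarantees (k' i (size env'')) env'' post) ->
    guarantees (q (size env')) env' post ->
    guarantees (Apply o args (k' (size env' + f)%N (size env' + arity o)%N) (q (size env'))) env' post.
  move=> kP qP; split=> [outs c|//].
  by rewrite -(computes_size c) -size_cat; apply: kP; apply: ext_cat.
elim: e env k => [i|o f|o f e1 IH|o f e1 IH1 e2 IH2] env k /= kP qP.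
- by apply: kP; apply: ext_refl.
- by apply: (ap _ _ [::]) => //; apply: qP; apply: ext_refl.
- apply: IH => // i env' ex; apply: ap; last exact: qP.
  by move=> j env'' ex'; apply: kP; apply: ext_trans ex ex'.
- apply: IH1 => // i env' ex; apply: IH2 => [j env'' ex'|env'' ex']; last first.
    by apply: qP; apply: ext_trans ex ex'.
  have ex2 := ext_trans ex ex'; apply: ap; last exact: qP.
  by move=> l env3 ex3; apply: kP; apply: ext_trans ex2 ex3.
Qed.

Definition draw (k : nat -> builder) : builder := fun sz => Draw (k sz sz.+1).

Lemma draw_ok k env :
  (exists bad : seq F, forall x, x \notin bad -> forall i env', ext env env' ->
     (i < size env')%N -> get env' i = mx (x%:M : 'M[F]_1) ->
     guarantees (k i (size env')) env' post) ->
  guarantees (draw k (size env)) env post.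
Proof.
case=> bad H; exists bad => x /H {}H; rewrite -[(size env).+1](size_rcons env (mx (x%:M : 'M[F]_1))).
apply: H; first by rewrite -cats1; apply: ext_cat.
  by rewrite size_rcons.
by rewrite /get nth_rcons ltnn eqxx.
Qed.

(** * Evaluation rules *)

Definition den env e m n (M : 'M[F]_(m, n)) := wp true env e (fun a => a = mx M).

Lemma den_ext env env' e m n (M : 'M[F]_(m, n)) : ext env env' -> den env e M -> den env' e M.
Proof. exact: wp_ext. Qed.

Lemma den_var env i m n (M : 'M[F]_(m, n)) : (i < size env)%N -> get env i = mx M -> den env (Var i) M.
Proof. by []. Qed.

Lemma den_eq env e m n (M N : 'M[F]_(m, n)) : den env e M -> M = N -> den env e N.
Proof. by move=> + <-. Qed.

Definition EConst m n (N : 'M[int]_(m, n)) := E0 (OpConst N) 0.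
Definition EMul := E2 OpMul 0.
Definition ETr := E1 OpTranspose 0.
Definition EKron := E2 OpKronecker 0.
Definition ERow := E2 OpRowBlock 0.
Definition EReshape p q := E1 (OpReshape p q) 0.
Definition ECompound k := E1 (OpCompound k) 0.
Definition ESolve := E2 OpSolve 0.
Definition EFactorL := E1 OpRankFactor 0.
Definition EFactorR := E1 OpRankFactor 1.
Definition EOrth := E1 OpOrthCompl 0.
Definition EEigen := E2 OpGEVD 0.

Lemma den_const env m n (N : 'M[int]_(m, n)) : den env (EConst N) (map_mx intr N).
Proof. by split=> // [_|outs /computes_const->//]; eexists; constructor. Qed.

Lemma wp_tr b env e m n (P : 'M[F]_(m, n) -> Prop) :
  wp b env e (fun a => exists2 M : 'M[F]_(m, n), a = mx M & P M) ->
  wp b env (ETr e) (fun a => exists2 M : 'M[F]_(n, m), a = mx M & P M^T).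
Proof.
apply: wp_mono => a [M -> PM]; split=> // [_|outs /computes_tr->]; first by eexists; constructor.
by exists M^T; rewrite ?trmxK.
Qed.

Lemma den_tr env e m n (M : 'M[F]_(m, n)) : den env e M -> den env (ETr e) M^T.
Proof.
move=> H; apply: wp_mono (wp_tr (P := fun N => N = M) _) => [a [N -> <-]|].
  by rewrite trmxK.
by apply: wp_mono H => a ->; exists M.
Qed.

Lemma wp2 b b' env e1 e2 o f m n p q (M : 'M[F]_(m, n)) (N : 'M[F]_(p, q)) P :
  (b' -> b) -> den env e1 M -> den env e2 N -> step b o f [:: mx M; mx N] P -> wp b' env (E2 o f e1 e2) P.
Proof.
move=> bb d1 d2 st; apply: (wp_mono' (b := true) _ _ d1) => // a ->.
by apply: (wp_mono' (b := true) _ _ d2) => // a' ->; apply: step_mono st.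
Qed.

Lemma den_mul env e1 e2 m n p (M : 'M[F]_(m, n)) (N : 'M[F]_(n, p)) :
  den env e1 M -> den env e2 N -> den env (EMul e1 e2) (M *m N).
Proof.
move=> d1 d2; apply: (wp2 (b := true) _ d1 d2) => //.
by split=> // [_|outs /computes_mul->//]; eexists; constructor.
Qed.

Lemma den_kron env e1 e2 m n p q (M : 'M[F]_(m, n)) (N : 'M[F]_(p, q)) :
  den env e1 M -> den env e2 N -> den env (EKron e1 e2) (tensmx M N).
Proof.
move=> d1 d2; apply: (wp2 (b := true) _ d1 d2) => //.
by split=> // [_|outs /computes_kron->//]; eexists; constructor.
Qed.

Lemma step_row b m n p (M : 'M[F]_(m, n)) (N : 'M[F]_(m, p)) P :
  P (mx (row_mx M N)) -> step b OpRowBlock 0 [:: mx M; mx N] P.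
Proof. by move=> PM; split=> // [_|outs /computes_row->//]; eexists; constructor. Qed.

Lemma den_compound env e k m n (M : 'M[F]_(m, n)) : (k <= minn m n)%N ->
  den env e M -> den env (ECompound k e) (compound k M).
Proof.
move=> kmn; apply: wp_mono => a ->.
by split=> // [_|outs /computes_compound->//]; eexists; constructor.
Qed.

Lemma den_reshape env e m n p q (M : 'M[F]_(m, n)) (X : 'M[F]_(p, q)) :
  (m * n = p * q)%N ->
  (forall (i : 'I_m) (j : 'I_n) (k : 'I_p) (l : 'I_q), (i * n + j = k * q + l)%N -> X k l = M i j) ->
  den env e M -> den env (EReshape p q e) X.
Proof.
move=> mn XP; apply: wp_mono => a ->; split=> // [_|outs /computes_reshape[_ [X' -> X'P]] /=].
  by eexists; apply: CReshape XP.
congr mx; apply/matrixP => k l.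
have kl : (k * q + l < m * n)%N.
  by rewrite mn; apply: leq_trans (_ : k * q + q <= _)%N; rewrite ?ltn_add2l // addnC -mulSn leq_mul2r ltn_ord orbT.
have [o oE] : exists o : 'I_(m * n), o = (k * q + l)%N :> nat by exists (Ordinal kl).
case: (mxtens_indexP o) oE => i j /= e_ij.
by rewrite (X'P i j) ?(XP i j).
Qed.

Lemma den_vecc env e m n (M : 'M[F]_(m, n)) N : N = (m * n)%N ->
  den env e M -> den env (EReshape N 1 e) (vecc M).
Proof.
move=> -> ; apply: den_reshape => [|i j k l e_]; first by rewrite muln1.
have -> : k = mxtens_index (i, j) by apply: val_inj => /=; move: e_; rewrite (ord1 l) muln1 addn0.
by rewrite mxE mxtens_indexK.
Qed.

Lemma den_unvecc env e m n (M : 'M[F]_(m, n)) :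
  den env e (vecc M) -> den env (EReshape m n e) M.
Proof.
apply: den_reshape => [|i j k l e_]; first by rewrite muln1.
have -> : i = mxtens_index (k, l) by apply: val_inj => /=; move: e_; rewrite (ord1 j) muln1 addn0.
by rewrite (ord1 j) mxE mxtens_indexK.
Qed.

Lemma wp_solve b env e1 e2 m n p (M : 'M[F]_(m, n)) (N : 'M[F]_(m, p)) :
  (b -> exists X, M *m X = N) -> den env e1 M -> den env e2 N ->
  wp b env (ESolve e1 e2) (fun a => exists2 X : 'M[F]_(n, p), a = mx X & M *m X = N).
Proof.
move=> ex d1 d2; apply: (wp2 (b := b) _ d1 d2) => //.
split=> // [/ex[X XP]|outs /computes_solve[X -> XP]]; last by exists X.
by eexists; constructor; exact: XP.
Qed.

Lemma factor_exists m n (M : 'M[F]_(m, n)) : exists outs, computes OpRankFactor [:: mx M] outs.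
Proof. by eexists; apply: (CRankFactor (X := col_base M) (Y := row_base M)); rewrite mulmx_base. Qed.

Lemma wp_factorL env e m n r (M : 'M[F]_(m, n)) : \rank M = r -> den env e M ->
  wp true env (EFactorL e) (fun a => exists2 X : 'M[F]_(m, r), a = mx X & exists Y, M = X *m Y).
Proof.
move=> rM; apply: wp_mono => a ->; split=> // [_|outs /(computes_rank_factor rM)[X [Y [-> h]]]].
  exact: factor_exists.
by exists X => //; exists Y.
Qed.

Lemma wp_factorR env e m n r (M : 'M[F]_(m, n)) : \rank M = r -> den env e M ->
  wp true env (EFactorR e) (fun a => exists2 Y : 'M[F]_(r, n), a = mx Y & exists X, M = X *m Y).
Proof.
move=> rM; apply: wp_mono => a ->; split=> // [_|outs /(computes_rank_factor rM)[X [Y [-> h]]]].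
  exact: factor_exists.
by exists Y => //; exists X.
Qed.

Lemma orth_exists m n (M : 'M[F]_(m, n)) : exists outs, computes OpOrthCompl [:: mx M] outs.
Proof.
eexists; apply: (COrthCompl (X := (row_base (kermx M^T^T))^T)).
- apply/trmx_inj; rewrite trmx_mul !trmxK trmx0; apply/sub_kermxP.
  by have := eq_row_base (kermx M); move/eqmxP/andP => [].
- by rewrite mxrank_tr eq_row_base.
- by rewrite trmxK mxrank_ker subnKC // rank_leq_row.
Qed.

(** The double orthogonal complement is the column space, by dimensions. *)
Lemma orth_orth m n d (M : 'M[F]_(m, n)) (X : 'M[F]_(m, d)) :
  M^T *m X = 0 -> \rank X = d -> (\rank M + d = m)%N ->
  forall z : 'cV_m, X^T *m z = 0 <-> exists w, z = M *m w.
Proof.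
move=> MX rX rM z.
have XM : X^T *m M = 0 by apply/trmx_inj; rewrite trmx_mul trmxK trmx0.
split=> [Xz|[w ->]]; last by rewrite mulmxA XM mul0mx.
have sub : (M^T <= kermx X)%MS by apply/sub_kermxP.
have /submxP[u uE] : (z^T <= M^T)%MS.
  apply: (@submx_trans _ _ _ _ _ _ (kermx X)).
    by apply/sub_kermxP/trmx_inj; rewrite trmx_mul trmxK trmx0.
  by rewrite -(mxrank_leqif_sup sub) mxrank_tr mxrank_ker rX; apply/eqP; lia.
by exists u^T; apply/trmx_inj; rewrite uE trmx_mul trmxK.
Qed.

Lemma wp_orth env e m (P : forall n, 'M[F]_(m, n) -> Prop) :
  wp true env e (fun a => exists n (M : 'M[F]_(m, n)), a = mx M /\ P n M) ->
  wp true env (EOrth e) (fun a => exists d (X : 'M[F]_(m, d)), a = mx X /\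
    exists n (M : 'M[F]_(m, n)), [/\ P n M, M^T *m X = 0, \rank X = d & (\rank M + d = m)%N]).
Proof.
apply: wp_mono => a [n [M [-> PM]]]; split=> // [_|outs /computes_orth[d [X [-> h1 h2 h3]]] /=].
  exact: orth_exists.
by exists d, X; split=> //; exists n, M.
Qed.

(** The expression [e0] stands for the matrix without columns, which fixes the number
of rows also when there is no block. *)
Fixpoint EBlocks (e0 : expr) s : ('I_s -> expr) -> expr :=
  if s is s'.+1 then fun es => ERow (es ord0) (@EBlocks e0 s' (fun j => es (lift ord0 j)))
  else fun=> e0.

Lemma wp_cols b env e0 m (M0 : 'M[F]_(m, 0)) s (es : 'I_s -> expr) (P : 'I_s -> 'cV[F]_m -> Prop) :
  den env e0 M0 ->
  (forall j, wp b env (es j) (fun a => exists2 c : 'cV[F]_m, a = mx c & P j c)) ->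
  wp b env (EBlocks e0 es) (fun a => exists2 M : 'M[F]_(m, s), a = mx M & forall j, P j (col j M)).
Proof.
move=> d0; elim: s es P => [|s IH] es P Pj.
  by apply: wp_any; apply: wp_mono d0 => a ->; exists M0 => // -[].
apply: wp_mono (Pj ord0) => a [c -> Pc].
apply: wp_mono (IH _ (fun j => P (lift ord0 j)) (fun j => Pj (lift ord0 j))) => a' [M -> PM].
apply: step_row; exists (row_mx c M : 'M_(m, s.+1)) => // j.
case: (unliftP ord0 j) => [j'|] ->.
  have -> : col (lift ord0 j') (row_mx c M : 'M_(m, s.+1)) = col j' M.
    by apply/colP => i; rewrite mxE row_mx_lift mxE.
  exact: PM.
have -> : col ord0 (row_mx c M : 'M_(m, s.+1)) = c.
  by apply/colP => i; rewrite mxE row_mx_ord0.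
exact: Pc.
Qed.

Lemma den_cols env e0 m (M0 : 'M[F]_(m, 0)) s (es : 'I_s -> expr) (M : 'M[F]_(m, s)) :
  den env e0 M0 -> (forall j, den env (es j) (col j M)) -> den env (EBlocks e0 es) M.
Proof.
move=> d0 dj; apply: wp_mono (wp_cols (P := fun j c => c = col j M) d0 _) => [a [N -> NP]|j].
  by congr mx; apply/matrixP => i j; have /colP/(_ i) := NP j; rewrite !mxE.
by apply: wp_mono (dj j) => a ->; exists (col j M).
Qed.

(** If each block spans the complement of a subspace, their concatenation spans that of
the intersection. *)
Lemma wp_orth_blocks env e0 m (M0 : 'M[F]_(m, 0)) s (es : 'I_s -> expr) (P : 'I_s -> 'cV[F]_m -> Prop) :
  den env e0 M0 ->
  (forall j, wp true env (es j) (fun a => exists d (X : 'M[F]_(m, d)), a = mx X /\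
     forall z, X^T *m z = 0 <-> P j z)) ->
  wp true env (EBlocks e0 es) (fun a => exists d (X : 'M[F]_(m, d)), a = mx X /\
     forall z, X^T *m z = 0 <-> forall j, P j z).
Proof.
move=> d0; elim: s es P => [|s IH] es P Pj.
  apply: wp_mono d0 => a ->; exists 0%N, M0; split=> // z; split=> [_ []//|_].
  by apply/matrixP => -[].
apply: wp_mono (Pj ord0) => a [d [X [-> XP]]].
apply: wp_mono (IH _ (fun j => P (lift ord0 j)) (fun j => Pj (lift ord0 j))) => a' [d' [X' [-> X'P]]].
apply: step_row; exists (d + d')%N, (row_mx X X'); split=> // z.
rewrite tr_row_mx mul_col_mx; split=> [/eqP|Pz].
  rewrite col_mx_eq0 => /andP[/eqP/XP P0 /eqP/X'P P1] j.
  by case: (unliftP ord0 j) => [j'|] ->.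
apply/eqP; rewrite col_mx_eq0; apply/andP; split; apply/eqP.
  by apply/XP.
by apply/X'P.
Qed.

End Logic.

(** * The procedure *)

(** Only [I], [J], [K] are known, so all numbers of terms [R] and all values [k] of
the k-rank of [C] are tried, by increasing [R]. Here [n] stands for [R - k + 1]. *)

Section Procedure.
Variables I J K : nat.

Definition eunfold : expr :=
  EBlocks (EConst (0 : 'M_(I * J, 0))) (fun k : 'I_K => EReshape (I * J) 1 (Var k)).

Fixpoint epower (t : nat) j : expr :=
  if j is j'.+1 then EMul (Var t) (epower t j') else EConst (1%:M : 'M_1).

Definition emoment m t : expr :=
  ETr (EBlocks (EConst (0 : 'M_(1, 0))) (fun j : 'I_m => epower t j)).

Definition emoments k ts : expr :=
  EBlocks (EConst (0 : 'M_(K, 0))) (fun j : 'I_k => emoment K (nth 0%N ts j)).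

Fixpoint draws m (ts : seq nat) (f : seq nat -> builder) : builder :=
  if m is m'.+1 then draw (fun t => draws m' (t :: ts) f) else f ts.

Section Attempt.
Variables (R k n : nat).
Notation L := (grid_size k n.+1).
Notation N := 'C(R, n).

Section Compressed.
Variable ts : seq nat.

Definition eslab (x : expr) : expr := EReshape I J (EMul (EMul eunfold (emoments k ts)) x).

Definition eminors m : expr :=
  EBlocks (EConst (0 : 'M_('C(I, m) * 'C(J, m), 0)))
    (fun l : 'I_L => EReshape ('C(I, m) * 'C(J, m)) 1
       (ECompound m (eslab (EConst (grid_int l))))).

(** A basis of the functions on the grid spanned by the products of [n] forms, which
are also spanned by the [n]-minors of the slabs. *)
Definition eproducts : expr := EFactorL (ETr (eminors n)).
(** The annihilator of the products of [n + 1] forms. *)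
Definition equotient : expr := EOrth (ETr (eminors n.+1)).

(** The matrix with columns [vecc (mul_form e_j)]: multiplying it by [l] and reshaping
gives [mul_form l] without any product of a scalar by a matrix. *)
Definition mul_forms_int : 'M[int]_(L * L, k) :=
  \matrix_(a, j) (((mxtens_unindex a).1 == (mxtens_unindex a).2)%:R * grid_int (mxtens_unindex a).1 j 0).

Definition emul_form (l : expr) : expr := EReshape L L (EMul (EConst mul_forms_int) l).

Section Pencils.
Variables iX iY : nat.

Definition epencil (l : expr) : expr := EMul (EMul (ETr (Var iY)) (emul_form l)) (Var iX).

Definition eeigen t u : expr :=
  EEigen (ESolve (epencil (emoment k t)) (epencil (emoment k u))) (EConst (1%:M : 'M_N)).

Variable iV : nat.

(** The [k] coordinate forms multiply an eigenvector by the coordinates of a star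
point, modulo the products of [n + 1] forms: side by side, the results make a rank-1
matrix with the star point as row factor. *)
Definition estar (i : 'I_N) : expr :=
  EFactorR (EBlocks (EMul (ETr (Var iY)) (EConst (0 : 'M_(L, 0))))
    (fun j : 'I_k => EMul (epencil (EConst (delta_mx j 0 : 'M_(k, 1)))) (EMul (Var iV) (EConst (delta_mx i 0 : 'M_(N, 1)))))).

Definition estar_slab i : expr := eslab (ETr (estar i)).

(** Orthogonal complements turn an intersection of column spaces into a
concatenation. *)
Definition emeet p (es : 'I_n -> expr) : expr :=
  EOrth (EBlocks (EConst (0 : 'M_(p, 0))) (fun s => EOrth (es s))).

(** The eigenvectors come in no particular order; [phi (r, s)] guesses the positions of
the [n] star points used for column [r]. *)
Variable phi : {ffun 'I_R * 'I_n -> 'I_N}.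

Definition eA : expr := EReshape I R (EBlocks (EConst (0 : 'M_(I, 0)))
  (fun r => emeet I (fun s => estar_slab (phi (r, s))))).

Definition eB : expr := EReshape J R (EBlocks (EConst (0 : 'M_(J, 0)))
  (fun r => emeet J (fun s => ETr (estar_slab (phi (r, s)))))).

End Pencils.
End Compressed.

Definition ekhatri_rao iA iB : expr :=
  EBlocks (EConst (0 : 'M_(I * J, 0))) (fun r : 'I_R =>
    EKron (EMul (Var iA) (EConst (delta_mx r 0 : 'M_(R, 1))))
          (EMul (Var iB) (EConst (delta_mx r 0 : 'M_(R, 1))))).

Definition eC iA iB : expr := ETr (ESolve (ekhatri_rao iA iB) eunfold).

(** Whatever the guess, a solution of the last linear system makes a decomposition, so
solvability is the test that the guess is right. *)
Definition finish (eA eB : expr) (q : builder) : builder :=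
  compile eA (fun iA => compile eB (fun iB => compile (eC iA iB) (fun iC _ => Return iA iB iC) q) q) q.

Definition attempt (q : builder) : builder :=
  draws k [::] (fun ts => compile (eproducts ts) (fun iX => compile (equotient ts) (fun iY =>
    draw (fun t => draw (fun u => compile (eeigen iX iY t u) (fun iV =>
      foldr (fun phi => finish (eA ts iX iY iV phi) (eB ts iX iY iV phi)) q
        (enum {ffun 'I_R * 'I_n -> 'I_N})) q))) q) q).

End Attempt.

Definition attempts R (q : builder) : builder :=
  foldr (fun k => attempt R k (R.+1 - k)) q (iota 0 K.+1).

Definition cpd_procedure : procedure :=
  foldr attempts (fun=> Fail) (iota 0 (I + K)) K.

End Procedure.

Section Semantics.
Context {F : realType} {I J K : nat}.
Variable T : tensor F I J K.
Notation anymx := (@anymx F).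

Definition returns_cpd (a b c : anymx) :=
  exists (R : nat) (A : 'M[F]_(I, R)) (B : 'M[F]_(J, R)) (C : 'M[F]_(K, R)),
    [/\ a = mx A, b = mx B, c = mx C & is_cpd T A B C].

Definition good env0 (q : builder) := forall env, ext env0 env ->
  guarantees (q (size env)) env returns_cpd.

Lemma good_ext env0 env1 q : ext env0 env1 -> good env0 q -> good env1 q.
Proof. by move=> ex H env ex'; apply: H; apply: ext_trans ex ex'. Qed.

Lemma foldr_good (X : eqType) env0 (st : X -> builder -> builder) s q :
  (forall y, y \in s -> forall q', good env0 q' -> good env0 (st y q')) ->
  good env0 q -> good env0 (foldr st q s).
Proof.
elim: s => [|x s IH] //= safe gq; apply: (safe x); first exact: mem_head.
by apply: IH gq => y ys; apply: safe; rewrite in_cons ys orbT.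
Qed.

(** It suffices that some candidate succeeds and that those tried before it do no
harm. *)
Lemma foldr_good_hit (X : eqType) env0 (st : X -> builder -> builder) s q x : x \in s ->
  (forall y, y \in s -> forall q', good env0 q' -> good env0 (st y q')) ->
  (forall q', good env0 (st x q')) -> good env0 (foldr st q s).
Proof.
elim: s => [|y s IH] //=; rewrite in_cons; case: eqVneq => [->|_] //= xs safe sure.
apply: (safe y); first exact: mem_head.
by apply: IH => // z zs; apply: safe; rewrite in_cons zs orbT.
Qed.

Definition unfold3 : 'M[F]_(I * J, K) :=
  \matrix_(a, k) T ((mxtens_unindex a).1, (mxtens_unindex a).2, k).

Lemma unfold3_mul x : unfold3 *m x = vecc (slab T x).
Proof. by apply/colP => a; rewrite !mxE; apply: eq_bigr => k _; rewrite mxE. Qed.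

Lemma den_unfold env : ext (slices T) env -> den env (eunfold I J K) unfold3.
Proof.
move=> ex; have sz : size (slices T) = K by rewrite size_map size_enum_ord.
apply: den_cols => [|k]; first exact: den_const.
have -> : col k unfold3 = vecc (\matrix_(i < I, j < J) T (i, j, k)).
  by apply/colP => a; rewrite !mxE.
apply: den_vecc => //; apply: den_var.
  by apply: leq_trans (ext_size ex); rewrite sz.
rewrite (get_ext ex) ?sz // /get (nth_map k) ?size_enum_ord //.
by rewrite nth_ord_enum.
Qed.

Lemma cpd_of_unfold R (A : 'M[F]_(I, R)) (B : 'M[F]_(J, R)) (X : 'M[F]_(R, K)) :
  khatri_rao A B *m X = unfold3 <-> T = cpd_tensor A B X^T.
Proof.
split=> [e|e].
  apply/ffunP => -[[i j] k]; rewrite cpd_tensorE.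
  have /matrixP/(_ (mxtens_index (i, j)) k) := e; rewrite [RHS]mxE mxtens_indexK /= => <-.
  by rewrite mxE; apply: eq_bigr => r _; rewrite khatri_raoE mxtens_indexK [X^T _ _]mxE.
apply/matrixP => a k; rewrite [RHS]mxE e cpd_tensorE mxE; apply: eq_bigr => r _.
by rewrite khatri_raoE [X^T _ _]mxE.
Qed.

Lemma den_khatri_rao env R iA iB (A : 'M[F]_(I, R)) (B : 'M[F]_(J, R)) :
  den env (Var iA) A -> den env (Var iB) B -> den env (ekhatri_rao I J R iA iB) (khatri_rao A B).
Proof.
move=> dA dB; apply: den_cols => [|r]; first exact: den_const.
have -> : col r (khatri_rao A B) =
    tensmx (A *m map_mx intr (delta_mx r 0 : 'M_(R, 1))) (B *m map_mx intr (delta_mx r 0 : 'M_(R, 1))).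
  by rewrite !map_delta_mx -!colE; apply/colP => a; rewrite mxE [LHS]mxE.
exact: (den_kron (den_mul dA (den_const _ _)) (den_mul dB (den_const _ _))).
Qed.

Lemma wp_eC (b : bool) env R iA iB (A : 'M[F]_(I, R)) (B : 'M[F]_(J, R)) :
  ext (slices T) env -> (b -> exists C, T = cpd_tensor A B C) ->
  den env (Var iA) A -> den env (Var iB) B ->
  wp b env (eC I J K R iA iB) (fun c => exists2 C : 'M[F]_(K, R), c = mx C & T = cpd_tensor A B C).
Proof.
move=> ex hb dA dB; apply: wp_mono (wp_tr (P := fun X => khatri_rao A B *m X = unfold3) _) => [c [C -> CP]|].
  by exists C => //; rewrite -[C]trmxK; apply/cpd_of_unfold.
apply: wp_solve; [|exact: den_khatri_rao|exact: den_unfold].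
by move=> /hb[C TC]; exists C^T; apply/cpd_of_unfold; rewrite trmxK.
Qed.

Lemma return_ok R (A : 'M[F]_(I, R)) (B : 'M[F]_(J, R)) (C : 'M[F]_(K, R)) env iA iB iC :
  (R <= tensor_rank T)%N -> get env iA = mx A -> get env iB = mx B -> get env iC = mx C ->
  T = cpd_tensor A B C -> returns_cpd (get env iA) (get env iB) (get env iC).
Proof. by move=> le_R -> -> -> TE; exists R, A, B, C; split=> //; apply: is_cpd_of_size. Qed.

Lemma compile_reshape p q e (f : nat -> builder) qq env :
  (forall i env' (M : 'M[F]_(p, q)), ext env env' -> den env' (Var i) M ->
     guarantees (f i (size env')) env' returns_cpd) ->
  good env qq -> guarantees (compile (EReshape p q e) f qq (size env)) env returns_cpd.
Proof.
move=> fP qP; rewrite /EReshape /=; apply: compile_total => // i env' ex.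
apply: (@apply_ok _ _ false (OpReshape p q) 0%N [:: i] f qq env' (fun a => exists M : 'M[F]_(p, q), a = mx M)).
- rewrite /=; case: (get env' i) => m n M; split=> // outs /computes_reshape[_ [X -> _]].
  by exists X.
- by move=> j env'' ex' hj [M eM]; apply: (fP j env'' M) => //; apply: ext_trans ex ex'.
- by move=> _; apply: qP.
Qed.

(** An attempt with at most [tensor_rank T] terms cannot return a wrong answer: a
solution of the last linear system is a decomposition, which is then minimal. *)
Lemma finish_safe R env0 ea eb qq : ext (slices T) env0 -> (R <= tensor_rank T)%N ->
  good env0 qq -> good env0 (finish I J K R (EReshape I R ea) (EReshape J R eb) qq).
Proof.
move=> ex0 le_R gq env ex; apply: compile_reshape; last exact: good_ext ex gq.
move=> iA env1 A ex1 dA; have ex01 := ext_trans ex ex1.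
apply: compile_reshape; last exact: good_ext ex01 gq.
move=> iB env2 B ex2 dB; have ex02 := ext_trans ex01 ex2.
have {}dA := den_ext ex2 dA.
apply: (compile_ok (b := false) (wp_eC (b := false) (ext_trans ex0 ex02) _ dA dB)) => //.
  move=> iC env3 ex3 _ [C eC_ TE] /=.
  have [_ eA_] := den_ext ex3 dA; have [_ eB_] := den_ext ex3 dB.
  exact: return_ok le_R eA_ eB_ eC_ TE.
by move=> _ env3 ex3; apply: gq; apply: ext_trans ex02 ex3.
Qed.

Lemma finish_sure R env0 ea eb qq (P : 'M[F]_(I, R) -> Prop) (Q : 'M[F]_(J, R) -> Prop) :
  ext (slices T) env0 -> (R <= tensor_rank T)%N ->
  wp true env0 ea (fun a => exists2 A : 'M[F]_(I, R), a = mx A & P A) ->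
  wp true env0 eb (fun a => exists2 B : 'M[F]_(J, R), a = mx B & Q B) ->
  (forall A B, P A -> Q B -> exists C, T = cpd_tensor A B C) ->
  good env0 (finish I J K R ea eb qq).
Proof.
move=> ex0 le_R wA wB PQ env ex; apply: (compile_ok (wp_ext ex wA)) => // iA env1 ex1 hA [A eA_ PA].
have ex01 := ext_trans ex ex1.
apply: (compile_ok (wp_ext ex01 wB)) => // iB env2 ex2 hB [B eB_ QB].
have ex02 := ext_trans ex01 ex2; have dA := den_ext ex2 (den_var hA eA_).
have dB := den_var hB eB_.
have exC := ext_trans ex0 ex02.
apply: (compile_ok (b := true) (wp_eC (b := true) exC (fun=> PQ _ _ PA QB) dA dB)) => //.
move=> iC env3 ex3 _ [C eC_ TE] /=.
have [_ eA3] := den_ext ex3 dA; have [_ eB3] := den_ext ex3 dB.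
exact: return_ok le_R eA3 eB3 eC_ TE.
Qed.

Definition holds_scalars env (ts : seq nat) (xs : seq F) := forall j, (j < size xs)%N ->
  den env (Var (nth 0%N ts j)) ((xs`_j)%:M : 'M_1).

Lemma draws_ok (Inv : seq F -> Prop) k m ts xs f env :
  (forall xs, Inv xs -> (size xs < k)%N -> exists bad : seq F, forall x, x \notin bad -> Inv (x :: xs)) ->
  Inv xs -> (size xs + m = k)%N -> holds_scalars env ts xs ->
  (forall ts' xs' env', ext env env' -> size xs' = k -> Inv xs' -> holds_scalars env' ts' xs' ->
     guarantees (f ts' (size env')) env' returns_cpd) ->
  guarantees (draws m ts f (size env)) env returns_cpd.
Proof.
move=> H; elim: m ts xs env => [|m IH] ts xs env Ixs sz hs fP.
  by apply: fP hs => //; [exact: ext_refl | rewrite -sz addn0].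
have [|bad badP] := H xs Ixs; first by lia.
apply: (draw_ok (k := fun t => draws m (t :: ts) f)); exists bad => x /badP Ix i env' ex hi ei.
apply: (IH _ (x :: xs)) => //; first by rewrite /= -sz addSnnS.
  by case=> [_|j hj]; [apply: den_var | apply: den_ext ex (hs j hj)].
by move=> ts' xs' env'' ex'; apply: fP; apply: ext_trans ex ex'.
Qed.

Lemma attempt_safe R k n env0 q : ext (slices T) env0 -> (R <= tensor_rank T)%N ->
  good env0 q -> good env0 (attempt I J K R k n q).
Proof.
move=> ex0 le_R gq env ex.
apply: (@draws_ok (fun=> True) k k [::] [::]) => //; first by move=> *; exists [::].
move=> ts _ env1 ex1 _ _ _; have ex01 := ext_trans ex ex1.
apply: compile_total => [iX env2 ex2|]; last exact: good_ext ex01 gq.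
have ex02 := ext_trans ex01 ex2.
apply: compile_total => [iY env3 ex3|]; last exact: good_ext ex02 gq.
have ex03 := ext_trans ex02 ex3.
apply: draw_ok; exists [::] => x _ t env4 ex4 _ _; have ex04 := ext_trans ex03 ex4.
apply: draw_ok; exists [::] => y _ u env5 ex5 _ _; have ex05 := ext_trans ex04 ex5.
apply: compile_total => [iV env6 ex6|]; last exact: good_ext ex05 gq.
have ex06 := ext_trans ex05 ex6.
apply: (@foldr_good _ env0) => // phi _ q' gq'.
exact: finish_safe.
Qed.

End Semantics.

(** * Correctness of the procedure *)

Section Values.
Context {F : realType}.
Notation anymx := (@anymx F).

Lemma den_moment env m t (x : F) : den env (Var t) (x%:M : 'M_1) -> den env (emoment m t) (moment m x).
Proof.
move=> dt; have -> : moment m x = (\row_j x ^+ j : 'rV_m)^T by apply/colP => j; rewrite !mxE.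
apply/den_tr/den_cols => [|j]; first exact: den_const.
have -> : col j (\row_j0 x ^+ j0 : 'rV_m) = (x ^+ j)%:M.
  by apply/matrixP => a b; rewrite !ord1 !mxE eqxx mulr1n.
elim: (nat_of_ord j) => [|j' IH].
  by apply: den_eq (den_const _ _) _; rewrite map_scalar_mx.
by apply: den_eq (den_mul dt IH) _; rewrite exprS scalar_mxM.
Qed.

Lemma den_moments env K k ts (xs : seq F) : size xs = k -> holds_scalars env ts xs ->
  den env (emoments K k ts) (moments K k xs).
Proof.
move=> sz hs; apply: den_cols => [|j]; first exact: den_const.
have -> : col j (moments K k xs) = moment K xs`_j by apply/colP => a; rewrite !mxE.
by apply/den_moment/hs; rewrite sz.
Qed.

Lemma mul_forms_intE k n (l : 'cV[F]_k) :
  map_mx intr (mul_forms_int k n) *m l = vecc (mul_form n l).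
Proof.
apply/colP => a; rewrite [RHS]mxE [mul_form n l _ _]mxE [X in _ = X *+ _]mxE [X in _ = X *+ _]mxE.
rewrite mxE -mulr_natl mulr_sumr; apply: eq_bigr => j _.
rewrite !mxE; set p := mxtens_unindex a.
by case: (p.1 == p.2); rewrite /= ?mul1r ?mul0r // mulrC.
Qed.

Lemma den_mul_form env k n e (l : 'cV[F]_k) : den env e l -> den env (emul_form k n e) (mul_form n l).
Proof.
move=> de; apply: den_unvecc; rewrite -mul_forms_intE.
by apply: den_mul => //; apply: den_const.
Qed.

Lemma den_pencil env R k n d iX iY e (l : 'cV[F]_k) (X : 'M[F]_(grid_size k n.+1, 'C(R, n)))
    (Y : 'M[F]_(grid_size k n.+1, d)) :
  den env (Var iX) X -> den env (Var iY) Y -> den env e l ->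
  den env (epencil k n iX iY e) (Y^T *m mul_form n l *m X).
Proof. by move=> dX dY dl; do !apply: den_mul => //; [apply: den_tr | apply: den_mul_form]. Qed.

(** A basis of a line consists of a single non-zero vector; in particular the number of
columns of the orthogonal complement is known. *)
Lemma orth_line I w d (O : 'M[F]_(I, w)) (X : 'M[F]_(I, d)) (v : 'cV[F]_I) : v != 0 ->
  (forall z : 'cV_I, O^T *m z = 0 <-> exists a, z = a *: v) ->
  O^T *m X = 0 -> \rank X = d -> (\rank O + d = I)%N ->
  exists2 a, a != 0 & mx X = mx (a *: v).
Proof.
move=> v0 OP OX rX rO.
have /choice[a aP] : forall j, exists a, col j X = a *: v.
  by move=> j; apply/OP; rewrite colE mulmxA OX mul0mx.
have XE : X = v *m \row_j a j.
  apply/matrixP => i j; have /colP/(_ i) := aP j; rewrite !mxE big_ord1 !mxE => ->.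
  by rewrite mulrC.
have d1 : d = 1%N.
  apply/eqP; rewrite eqn_leq -{1}rX XE (leq_trans (mxrankM_maxl _ _)) ?rank_leq_col //=.
  have : (v^T <= kermx O)%MS.
    apply/sub_kermxP/trmx_inj; rewrite trmx_mul trmxK trmx0; apply/OP.
    by exists 1; rewrite scale1r.
  move/mxrankS; rewrite mxrank_ker mxrank_tr.
  by have : (0 < \rank v)%N by [rewrite lt0n mxrank_eq0]; lia.
subst d; have Xa : X = a 0 *: v by rewrite -aP col_id.
exists (a 0); last by rewrite Xa.
by apply/eqP => a0; move: rX; rewrite Xa a0 scale0r mxrank0.
Qed.

Lemma emeet_ok env p n (es : 'I_n -> expr) (P : 'I_n -> 'cV[F]_p -> Prop) (v : 'cV[F]_p) :
  v != 0 ->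
  (forall s, wp true env (es s) (fun a => exists m (E : 'M[F]_(p, m)), a = mx E /\
     forall z, (exists w, z = E *m w) <-> P s z)) ->
  (forall z, (forall s, P s z) <-> exists a, z = a *: v) ->
  wp true env (emeet p es) (fun a => exists2 c : 'cV[F]_p, a = mx c & exists2 al, al != 0 & c = al *: v).
Proof.
move=> v0 esP Pv.
apply: wp_mono (wp_orth (P := fun m (O : 'M[F]_(p, m)) => forall z : 'cV_p, O^T *m z = 0 <-> exists a, z = a *: v) _).
  move=> a [d [X [-> [m [O [OP OX rX rO]]]]]].
  by have [al al0 ->] := orth_line v0 OP OX rX rO; exists (al *: v) => //; exists al.
apply: wp_mono (wp_orth_blocks (M0 := 0) (P := P) _ _) => [a [d [X [-> XP]]]||s].
- by exists d, X; split=> // z; rewrite XP.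
- by apply: den_eq (den_const _ _) _; rewrite map_mx0.
- apply: wp_mono (wp_orth (P := fun m (E : 'M[F]_(p, m)) => forall z, (exists w, z = E *m w) <-> P s z) (esP s)).
  move=> a [d [X [-> [m [E [EP h1 h2 h3]]]]]]; exists d, X; split=> // z.
  by rewrite -EP; apply: orth_orth.
Qed.

End Values.

Section Run.
Context {F : realType} {I J K R n k : nat}.
Notation anymx := (@anymx F).
Context (A : 'M[F]_(I, R)) (B : 'M[F]_(J, R)) (C : 'M[F]_(K, R)).
Let T := cpd_tensor A B C.
Hypotheses (Rnk : R.+1 = (n + k)%N) (nIJ : (n < minn I J)%N) (n0 : (0 < n)%N) (nR : (n < R)%N).
Hypothesis (H : minors_indep n.+1 A B).
Context (scal : seq F) (ts : seq nat).
Hypothesis size_scal : size scal = k.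
Let D := C^T *m moments K k scal.
Hypothesis kD : kfree k D.
Context (env0 : seq anymx).
Hypotheses (ex0 : ext (slices T) env0) (hs : holds_scalars env0 ts scal).

Let kA : kfree n.+1 A^T := minors_indep_kfree nR H.
Let kB : kfree n.+1 B^T := minors_indep_kfree nR (minors_indep_sym H).

Lemma den_slab env x (X : 'cV[F]_k) : ext env0 env -> den env x X ->
  den env (eslab I J K k ts x) (diag_prod A B (D *m X)^T).
Proof.
move=> ex dx; apply: den_unvecc.
have -> : vecc (diag_prod A B (D *m X)^T) = unfold3 T *m moments K k scal *m X.
  by rewrite -mulmxA unfold3_mul slab_cpd mulmxA.
apply: den_mul => //; apply: den_mul; first exact/den_unfold/(ext_trans ex0 ex).
by apply: den_moments => // j hj; apply: den_ext ex (hs hj).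
Qed.

Lemma wp_slab env e (Q : 'cV[F]_k -> Prop) : ext env0 env ->
  wp true env e (fun a => exists2 X : 'cV[F]_k, a = mx X & Q X) ->
  wp true env (eslab I J K k ts e) (fun a => exists2 E : 'M[F]_(I, J), a = mx E &
    exists2 X, Q X & E = diag_prod A B (D *m X)^T).
Proof.
move=> ex we; have dM : den env (EMul (eunfold I J K) (emoments K k ts)) (unfold3 T *m moments K k scal).
  apply: den_mul; first exact/den_unfold/(ext_trans ex0 ex).
  by apply: den_moments => // j hj; apply: den_ext ex (hs hj).
apply: wp_mono dM => a ->; apply: wp_mono we => a' [X -> QX].
split=> // [_|outs /computes_mul->]; first by eexists; constructor.
have -> : unfold3 T *m moments K k scal *m X = vecc (diag_prod A B (D *m X)^T).
  by rewrite -mulmxA unfold3_mul slab_cpd mulmxA.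
have [_] := den_unvecc (den_var (env := [:: mx (vecc (diag_prod A B (D *m X)^T))]) (i := 0) isT erefl).
by apply: step_mono => // c ->; exists (diag_prod A B (D *m X)^T) => //; exists X.
Qed.

Lemma den_minors env m : ext env0 env -> (m <= minn I J)%N ->
  den env (eminors I J K k n ts m)
    (khatri_rao (compound m A) (compound m B) *m (form_values n D m)^T).
Proof.
move=> ex mIJ; apply: den_cols => [|l]; first exact: den_const.
have -> : col l (khatri_rao (compound m A) (compound m B) *m (form_values n D m)^T) =
   vecc (compound m (diag_prod A B (D *m grid l)^T)).
  by rewrite vecc_compound colE -mulmxA -colE; congr (_ *m _); apply/colP => i; rewrite !mxE.
apply: den_vecc => //; apply: den_compound => //; apply: den_slab => //.
exact: den_const.
Qed.

Lemma khatri_rao_right_inv m : minors_indep m A B ->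
  exists V, (khatri_rao (compound m A) (compound m B))^T *m V = 1%:M.
Proof.
move/full_rank_minors_indep => fr.
have : row_free (khatri_rao (compound m A) (compound m B))^T.
  by rewrite /row_free mxrank_tr.
by case/row_freeP => V VP; exists V.
Qed.

Context (x : 'I_'C(R, n) -> 'cV[F]_k).
Hypothesis xP : forall q, supp (D *m x q)^T = subset_at q.

(** The Khatri-Rao products of compound matrices have full column rank for [n] as well
as for [n + 1], so that the minors span the same functions as the products. *)
Lemma wp_products env : ext env0 env ->
  wp true env (eproducts I J K k n ts) (fun a =>
    exists2 X : 'M[F]_(grid_size k n.+1, 'C(R, n)), a = mx X &
    exists2 P, P \in unitmx & form_values n D n = X *m P).
Proof.
move=> ex; have iF := form_values_indep xP.
have H' := minors_indep_pred nR H.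
have [V VP] := khatri_rao_right_inv H'.
have rF : \rank (form_values n D n) = 'C(R, n) by apply/eqP/full_column_rankP.
have dM := den_tr (den_minors ex (ltnW nIJ)).
have rM : \rank (khatri_rao (compound n A) (compound n B) *m (form_values n D n)^T)^T = 'C(R, n).
  rewrite mxrank_tr -mxrank_tr trmx_mul trmxK mxrankMfree //.
  by apply/row_freeP; exists V.
apply: wp_mono (wp_factorL rM dM) => a [X -> [Y XY]].
exists X => //; exists (Y *m V).
  rewrite -row_full_unit /row_full; apply/full_column_rankP => w w0.
  apply: iF; have -> : form_values n D n = X *m (Y *m V).
    by rewrite mulmxA -XY trmx_mul trmxK -mulmxA VP mulmx1.
  by rewrite -mulmxA w0 mulmx0.
by rewrite mulmxA -XY trmx_mul trmxK -mulmxA VP mulmx1.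
Qed.

Lemma wp_quotient env : ext env0 env ->
  wp true env (equotient I J K k n ts) (fun a =>
    exists d (Y : 'M[F]_(grid_size k n.+1, d)), a = mx Y /\
    forall v : 'cV_(grid_size k n.+1), Y^T *m v = 0 <-> exists w, v = form_values n D n.+1 *m w).
Proof.
move=> ex; have [V VP] := khatri_rao_right_inv H.
have dM := den_tr (den_minors ex nIJ).
pose M := (khatri_rao (compound n.+1 A) (compound n.+1 B) *m (form_values n D n.+1)^T)^T.
apply: wp_mono (wp_orth (P := fun m (M : 'M[F]_(_, m)) => forall z : 'cV_(grid_size k n.+1),
    (exists w, z = M *m w) <-> exists w, z = form_values n D n.+1 *m w) _).
  move=> a [d [Y [-> [m [M' [MP h1 h2 h3]]]]]]; exists d, Y; split=> // v.
  by rewrite -MP; apply: orth_orth.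
apply: wp_mono dM => a ->; eexists _, M; split=> // z.
split=> -[w ->]; first by exists ((khatri_rao (compound n.+1 A) (compound n.+1 B))^T *m w);
  rewrite /M trmx_mul trmxK mulmxA.
by exists (V *m w); rewrite /M trmx_mul trmxK -mulmxA (mulmxA _ V) VP mul1mx.
Qed.

Section Eigenvectors.
Context (d : nat) (X : 'M[F]_(grid_size k n.+1, 'C(R, n))) (Y : 'M[F]_(grid_size k n.+1, d)).
Context (P : 'M[F]_'C(R, n)).
Hypotheses (uP : P \in unitmx) (XP : form_values n D n = X *m P).
Hypothesis YP : forall v : 'cV_(grid_size k n.+1),
  Y^T *m v = 0 <-> exists w, v = form_values n D n.+1 *m w.
Context (iX iY : nat) (env1 : seq anymx).
Hypotheses (ex1 : ext env0 env1) (dX : den env1 (Var iX) X) (dY : den env1 (Var iY) Y).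

Let U := pencil_left D n0 x Y.

Lemma pencilP l : Y^T *m mul_form n l *m X *m P = U *m diag_mx (\row_q (l^T *m x q) 0 0).
Proof. by rewrite -mulmxA -XP; apply: pencil_diag. Qed.

Definition eigen_spec (V : 'M[F]_'C(R, n)) :=
  exists (ka : 'S_'C(R, n)) (z : 'I_'C(R, n) -> F), forall i, z i != 0 /\ col i V = z i *: col (ka i) P.

Lemma wp_eigen env t u (a b : F) : ext env1 env ->
  den env (Var t) (a%:M : 'M_1) -> den env (Var u) (b%:M : 'M_1) ->
  (forall q, ((moment k a)^T *m x q) 0 0 != 0) ->
  injective (fun q => ((moment k b)^T *m x q) 0 0 / ((moment k a)^T *m x q) 0 0) ->
  wp true env (eeigen R k n iX iY t u)
    (fun v => exists2 V : 'M[F]_'C(R, n), v = mx V & eigen_spec V).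
Proof.
move=> ex da db a0 ba.
have dXe := den_ext ex dX; have dYe := den_ext ex dY.
have iU : indep_cols U by apply: pencil_left_indep.
have a0' q : (\row_q (((moment k a)^T *m x q) 0 0)) 0 q != 0 by rewrite mxE.
have W_iff := pencil_solve uP iU a0' (pencilP (moment k a)) (pencilP (moment k b)).
set e := \row_i _ in W_iff.
have eE q : e 0 q = ((moment k b)^T *m x q) 0 0 / ((moment k a)^T *m x q) 0 0.
  by rewrite [LHS]mxE [X in X / _]mxE [X in _ / X]mxE.
have ei : injective (fun q => e 0 q) by move=> q q'; rewrite !eE => /ba.
have wW : wp true env (ESolve (epencil k n iX iY (emoment k t)) (epencil k n iX iY (emoment k u)))
    (fun v => exists2 W : 'M[F]_'C(R, n), v = mx W & W *m P = P *m diag_mx e).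
  apply: wp_mono (wp_solve (M := Y^T *m mul_form n (moment k a) *m X)
      (N := Y^T *m mul_form n (moment k b) *m X) _ _ _) => [v [W -> /W_iff WP]|_||].
  - by exists W.
  - by exists (P *m diag_mx e *m invmx P); apply/W_iff; rewrite mulmxKV.
  - by apply: den_pencil => //; apply: den_moment.
  - by apply: den_pencil => //; apply: den_moment.
apply: wp_mono wW => _ [W -> WP].
apply: (wp_mono _ (den_const env (1%:M : 'M_('C(R, n))))) => v ->; rewrite map_mx1; split=> // [_|outs].
  eexists; apply: (CGEVD (V := P) (al := e) (be := const_mx 1)) => //.
    by move=> i; rewrite [X in _ || (X != _)]mxE oner_eq0 orbT.
  by rewrite diag_const_mx mulmx1 mul1mx.
case/computes_gevd => V [al [be [-> uV ab eV]]] /=; exists V => //.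
exact: eigenvectors_of_diag uP WP ei uV ab eV.
Qed.

Context (V : 'M[F]_'C(R, n)) (ka : 'S_'C(R, n)) (z : 'I_'C(R, n) -> F).
Hypothesis VP : forall i, z i != 0 /\ col i V = z i *: col (ka i) P.
Context (iV : nat) (env2 : seq anymx).
Hypotheses (ex2 : ext env1 env2) (dV : den env2 (Var iV) V).

Lemma star_neq0 q : x q != 0.
Proof. by apply: contraTneq (form_in_neq0 n0 xP q) => ->; rewrite mulmx0 eqxx. Qed.

Lemma wp_star i :
  wp true env2 (estar k iX iY iV i) (fun a => exists2 y : 'rV[F]_k, a = mx y &
    exists2 al, al != 0 & y = al *: (x (ka i))^T).
Proof.
have dXe := den_ext ex2 dX; have dYe := den_ext ex2 dY.
have [z0 Vi] := VP i; pose u := z i *: col (ka i) U.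
have iU : indep_cols U by apply: pencil_left_indep.
have u0 : u != 0.
  rewrite scaler_eq0 (negPf z0) /= colE; apply/eqP => /iU/colP/(_ (ka i)).
  by rewrite !mxE !eqxx => /eqP; rewrite oner_eq0.
have dM : den env2 (EBlocks (EMul (ETr (Var iY)) (EConst (0 : 'M_(grid_size k n.+1, 0))))
    (fun j : 'I_k => EMul (epencil k n iX iY (EConst (delta_mx j 0 : 'M_(k, 1))))
       (EMul (Var iV) (EConst (delta_mx i 0 : 'M_('C(R, n), 1)))))) (u *m (x (ka i))^T).
  apply: den_cols => [|j].
    exact: (den_mul (den_tr dYe) (den_const _ _)).
  have -> : col j (u *m (x (ka i))^T) =
     Y^T *m mul_form n (map_mx intr (delta_mx j 0 : 'M[int]_(k, 1))) *m X *m
     (V *m map_mx intr (delta_mx i 0 : 'M[int]_('C(R, n), 1))).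
    rewrite !map_delta_mx -(colE i V) Vi -scalemxAr [col (ka i) P]colE (mulmxA _ P) pencilP -mulmxA.
    have -> : diag_mx (\row_q ((delta_mx j 0 : 'cV_k)^T *m x q) 0 0) *m delta_mx (ka i) 0 =
        (x (ka i)) j 0 *: delta_mx (ka i) 0 :> 'cV_'C(R, n).
      apply/colP => q; rewrite mul_diag_mx !mxE eqxx andbT.
      case: eqVneq => [->|]; rewrite ?mulr0 // !mulr1.
      rewrite (bigD1 j) //= !mxE !eqxx mul1r big1 ?addr0 // => m mj.
      by rewrite !mxE (negPf mj) mul0r.
    rewrite -scalemxAr -colE; apply/colP => a; rewrite /u !mxE big_ord1 !mxE; ring.
  apply: den_mul; first by apply: den_pencil => //; apply: den_const.
  by apply: den_mul => //; apply: den_const.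
have r1 := rank_outer u0 (star_neq0 (ka i)).
apply: wp_mono (wp_factorR r1 dM) => a [y -> [X' eX']].
by exists y => //; apply: rank1_factor u0 (star_neq0 _) eX'.
Qed.

Lemma diag_prod_range I' J' (A' : 'M[F]_(I', R)) (B' : 'M[F]_(J', R)) (y : 'rV[F]_R) (q : 'I_'C(R, n)) :
  kfree n.+1 B'^T -> supp y = subset_at q -> forall v : 'cV_I',
  (exists w, v = diag_prod A' B' y *m w) <-> (v^T <= rows_in (subset_at q) A'^T)%MS.
Proof.
move=> kB' yq v; have sp := diag_prod_span A' (y := y) kB'.
rewrite yq card_subset_at in sp; rewrite -(sp (leqnSn n)).
split=> [[w ->]|/submxP[w wE]]; first by rewrite trmx_mul submxMl.
by exists w^T; apply/trmx_inj; rewrite wE [RHS]trmx_mul trmxK.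
Qed.

Lemma wp_star_slab i :
  wp true env2 (estar_slab I J K k ts iX iY iV i) (fun a =>
    exists2 E : 'M[F]_(I, J), a = mx E & exists2 y, supp y = subset_at (ka i) & E = diag_prod A B y).
Proof.
have ex02 := ext_trans ex1 ex2.
have wE : wp true env2 (ETr (estar k iX iY iV i)) (fun a => exists2 X' : 'cV[F]_k, a = mx X' &
    exists2 al, al != 0 & X' = al *: x (ka i)).
  apply: wp_mono (wp_tr (wp_star i)) => a [M -> [al al0 e]]; exists M => //; exists al => //.
  by apply/trmx_inj; rewrite e linearZ.
apply: wp_mono (wp_slab ex02 wE) => a [E -> [X' [al al0 ->] EX]]; exists E => //.
exists (D *m (al *: x (ka i)))^T => //; rewrite -(xP (ka i)); apply/setP => r.
by rewrite !inE -scalemxAr linearZ /= mxE mulf_eq0 negb_or al0.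
Qed.

Lemma meet_spans p (A' : 'M[F]_(p, R)) (es : 'I_n -> expr)
    (i : 'I_n -> 'I_'C(R, n)) (M : {set 'I_R}) r (e : 'I_n -> 'I_R) :
  kfree n.+1 A'^T ->
  (forall s, wp true env2 (es s) (fun a => exists m (E : 'M[F]_(p, m)), a = mx E /\
     forall v : 'cV_p, (exists w, v = E *m w) <-> (v^T <= rows_in (subset_at (i s)) A'^T)%MS)) ->
  r \in M -> #|M| = n.+1 -> (forall s, subset_at (i s) = M :\ e s) ->
  (forall s, e s != r) -> (forall t, t \in M -> t != r -> exists s, e s = t) ->
  wp true env2 (emeet p es) (fun a => exists2 c : 'cV[F]_p, a = mx c &
    exists2 al, al != 0 & c = al *: col r A').
Proof.
move=> kA' esP rM cM iM er eM.
apply: (emeet_ok (P := fun s v => (v^T <= rows_in (subset_at (i s)) A'^T)%MS)) => //.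
  have := kA' set0 r; rewrite in_set0 cards0 => /(_ isT isT); apply: contraNneq => e0.
  by rewrite -tr_col e0 trmx0 sub0mx.
move=> v; split=> [vs|[a ->] s].
  have [|||t tM tr|a aE] := @span_inter F R p n.+1 A'^T M r v^T kA'; rewrite ?cM //.
    by have [s <-] := eM t tM tr; rewrite -iM.
  by exists a; apply/trmx_inj; rewrite aE [RHS]linearZ /= tr_col.
rewrite linearZ /= tr_col scalemx_sub // row_sub_rows_in // iM !inE rM andbT.
by rewrite eq_sym.
Qed.

(** The right guess: column [r] is obtained from the [n]-sets that omit one element
other than [r] of a fixed [(n + 1)]-set through [r]. *)
Lemma exists_table : exists (phi : {ffun 'I_R * 'I_n -> 'I_'C(R, n)})
    (M : 'I_R -> {set 'I_R}) (e : 'I_R -> 'I_n -> 'I_R),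
  forall r, [/\ r \in M r, #|M r| = n.+1, forall s, subset_at (ka (phi (r, s))) = M r :\ e r s,
    forall s, e r s != r & forall t, t \in M r -> t != r -> exists s, e r s = t].
Proof.
have /choice[M MP] : forall r : 'I_R, exists M : {set 'I_R}, r \in M /\ #|M| = n.+1.
  move=> r; have [|M rM cM] := @superset_of_card R [set r] n.+1; first by rewrite cards1.
  by exists M; rewrite -sub1set.
pose e r (s : 'I_n) := nth r (enum (M r :\ r)) s.
have sz r : size (enum (M r :\ r)) = n.
  by have [rM cM] := MP r; rewrite -cardE; have := cardsD1 r (M r); rewrite rM cM => -[].
have eP r s : e r s \in M r :\ r by rewrite -mem_enum mem_nth // sz.
have /choice[ph phP] : forall p : 'I_R * 'I_n, exists i, subset_at (ka i) = M p.1 :\ e p.1 p.2.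
  case=> r s /=; have [rM cM] := MP r; have := eP r s; rewrite !inE => /andP[_ eM].
  have [|q qE] := @subset_at_surj R n (M r :\ e r s).
    by have := cardsD1 (e r s) (M r); rewrite eM cM => -[].
  by exists (ka^-1 q)%g; rewrite permKV.
exists [ffun p => ph p], M, e => r; have [rM cM] := MP r; split=> // [s|s|t tM tr].
- by rewrite ffunE phP.
- by have := eP r s; rewrite !inE => /andP[].
- have tE : t \in enum (M r :\ r) by rewrite mem_enum !inE tr.
  have lt_i : (index t (enum (M r :\ r)) < n)%N by rewrite -[X in (_ < X)%N](sz r) index_mem.
  by exists (Ordinal lt_i); rewrite /e nth_index.
Qed.

Definition scaled p (M M' : 'M[F]_(p, R)) := exists2 al : 'I_R -> F,
  forall r, al r != 0 & forall r, col r M' = al r *: col r M.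

Lemma scaled_factors A' B' : scaled A A' -> scaled B B' -> exists C', T = cpd_tensor A' B' C'.
Proof.
move=> [al al0 aE] [be be0 bE]; exists (\matrix_(j, r) ((al r)^-1 * (be r)^-1 * C j r)).
apply/ffunP => -[[i j] l]; rewrite !cpd_tensorE; apply: eq_bigr => r _.
have -> : A' i r = al r * A i r by have /colP/(_ i) := aE r; rewrite !mxE.
have -> : B' j r = be r * B j r by have /colP/(_ j) := bE r; rewrite !mxE.
rewrite mxE; have := al0 r; have := be0 r => b0 a0; by field; rewrite a0 b0.
Qed.

Lemma wp_scaled p (M : 'M[F]_(p, R)) (es : 'I_R -> expr) :
  (forall r, wp true env2 (es r) (fun a => exists2 c : 'cV[F]_p, a = mx c &
    exists2 al, al != 0 & c = al *: col r M)) ->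
  wp true env2 (EReshape p R (EBlocks (EConst (0 : 'M_(p, 0))) es))
    (fun a => exists2 M' : 'M[F]_(p, R), a = mx M' & scaled M M').
Proof.
move=> esP; have w := wp_cols (den_const env2 (0 : 'M_(p, 0))) esP.
apply: wp_mono w => a [M' -> M'P].
have sM' : scaled M M'.
  have /choice[al alP] : forall r, exists al, al != 0 /\ col r M' = al *: col r M.
    by move=> r; have [al] := M'P r; exists al.
  by exists al => r; have [] := alP r.
have [_] : den [:: mx M'] (EReshape p R (Var 0)) M'.
  apply: den_reshape (den_var (env := [:: mx M']) (i := 0) isT erefl) => // i j l m e.
  have := congr1 (divn^~ R) e; have := congr1 (modn^~ R) e.
  have R0 : (0 < R)%N by apply: leq_ltn_trans (ltn_ord j).
  rewrite /= !modnMDl !modn_small // !divnMDl // !divn_small // !addn0.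
  by move=> /val_inj-> /val_inj->.
by apply: step_mono => // c ->; exists M'.
Qed.

Lemma finish_good : (R <= tensor_rank T)%N -> exists phi : {ffun 'I_R * 'I_n -> 'I_'C(R, n)},
  forall qq, good T env2 (finish I J K R (eA I J K k ts iX iY iV phi) (eB I J K k ts iX iY iV phi) qq).
Proof.
move=> le_R; have [phi [M [e phiP]]] := exists_table; exists phi => qq.
have ex02 := ext_trans ex0 (ext_trans ex1 ex2).
apply: (@finish_sure F I J K T R env2 _ _ qq (scaled A) (scaled B)) => //; last exact: scaled_factors.
- apply: wp_scaled => r; have [rM cM pM er eM] := phiP r.
  apply: (meet_spans (i := fun s => ka (phi (r, s))) kA _ rM cM pM er eM) => s.
  apply: wp_mono (wp_star_slab (phi (r, s))) => a [E -> [y yq ->]].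
  by exists J, (diag_prod A B y); split=> //; apply: diag_prod_range.
- apply: wp_scaled => r; have [rM cM pM er eM] := phiP r.
  apply: (meet_spans (i := fun s => ka (phi (r, s))) kB _ rM cM pM er eM) => s.
  have w : wp true env2 (estar_slab I J K k ts iX iY iV (phi (r, s))) (fun a =>
      exists2 E : 'M[F]_(I, J), a = mx E & exists2 y, supp y = subset_at (ka (phi (r, s))) & E^T = diag_prod B A y).
    apply: wp_mono (wp_star_slab (phi (r, s))) => a [E -> [y yq EE]].
    by exists E => //; exists y; rewrite // EE tr_diag_prod.
  apply: wp_mono (wp_tr w) => a [E -> [y yq]]; rewrite trmxK => ->.
  by exists I, (diag_prod B A y); split=> //; apply: diag_prod_range.
Qed.

End Eigenvectors.

(** Star points are pairwise not proportional: some form vanishes at only one of the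
two. *)
Lemma star_separated (l : 'cV[F]_k) : (forall q, (l^T *m x q) 0 0 != 0) -> forall q q', q != q' ->
  (l^T *m x q') 0 0 *: x q - (l^T *m x q) 0 0 *: x q' != 0.
Proof.
move=> l0 q q' qq'; have /subsetPn[r rq rq'] : ~~ (subset_at q \subset subset_at q').
  apply: contra qq' => sub; apply/eqP/subset_at_inj/eqP.
  by rewrite eqEcard sub !card_subset_at leqnn.
apply/eqP => /(congr1 (mulmx D))/colP/(_ r); rewrite mulmx0 mulmxBr -!scalemxAr.
rewrite [LHS]mxE [X in X + _]mxE [X in _ + X]mxE [X in _ - X]mxE [RHS]mxE.
move: rq rq'; rewrite -!xP !inE [(D *m x q)^T _ _]mxE [(D *m x q')^T _ _]mxE negbK => d0 /eqP ->.
rewrite mulr0 subr0 => /eqP; rewrite mulf_eq0 (negPf d0) orbF => /eqP h.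
by move: (l0 q'); rewrite h eqxx.
Qed.

End Run.

Section AttemptSure.
Context {F : realType} {I J K R : nat}.
Context (A : 'M[F]_(I, R)) (B : 'M[F]_(J, R)) (C : 'M[F]_(K, R)).
Let T := cpd_tensor A B C.

Lemma attempt_sure n k q : R.+1 = (n + k)%N -> (n < minn I J)%N -> (0 < n < R)%N ->
  minors_indep n.+1 A B -> kfree k C^T -> (R <= tensor_rank T)%N ->
  good T (slices T) (attempt I J K R k n q).
Proof.
move=> Rnk nIJ /andP[n0 nR] H kC le_R env ex.
apply: (@draws_ok _ _ _ _ T (compresses C^T k) k k [::] [::]) => //.
- by move=> xs Cxs sxs; apply: compresses_cons.
- exact: compresses_nil.
move=> ts xs env0 ex0 sxs Cxs hs; have exs0 := ext_trans ex ex0.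
have kD : kfree k (C^T *m moments K k xs) by apply: compresses_kfree => //; lia.
have /choice[x xP] : forall p : 'I_'C(R, n), exists v : 'cV[F]_k,
    supp (C^T *m moments K k xs *m v)^T = subset_at p.
  by move=> p; apply: (exists_supp kD); rewrite card_subset_at; lia.
apply: (compile_ok (wp_products nIJ nR H sxs exs0 hs xP (ext_refl _))) => //.
move=> iX env1 ex1 hX [X eX [P uP XP]].
apply: (compile_ok (wp_quotient nIJ H sxs exs0 hs ex1)) => //.
move=> iY env2 ex2 hY [d [Y [eY YP]]]; have ex02 := ext_trans ex1 ex2.
have dX := den_ext ex2 (den_var hX eX); have dY := den_var hY eY.
have [bad badP] := generic_form (star_neq0 n0 xP).
apply: draw_ok; exists bad => a /badP a0 t env3 ex3 ht et.
have [bad' bad'P] := generic_ratio (star_separated xP a0) a0.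
apply: draw_ok; exists bad' => b /bad'P ba u env4 ex4 hu eu.
have ex24 := ext_trans ex3 ex4.
apply: (compile_ok (wp_eigen Rnk n0 kD xP uP XP YP dX dY ex24 (den_ext ex4 (den_var ht et)) (den_var hu eu) a0 ba)) => //.
move=> iV env5 ex5 hV [V eV [ka [z VP]]]; have ex25 := ext_trans ex24 ex5.
have [phi phiP] := finish_good Rnk n0 nR H sxs kD exs0 hs xP XP YP ex02 dX dY VP ex25 (den_var hV eV) le_R.
have exs5 := ext_trans exs0 (ext_trans ex02 ex25).
have in_enum : phi \in enum {ffun 'I_R * 'I_n -> 'I_'C(R, n)} by rewrite mem_enum.
apply: (@foldr_good_hit F I J K T _ env5 _ _ q phi in_enum _ _ env5 (ext_refl env5)) => //.
by move=> psi _ q' gq'; apply: finish_safe.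
Qed.

End AttemptSure.

(** The attempts with fewer terms than the rank are harmless, and among those with the
right number of terms one succeeds. *)
Lemma cpd_procedure_ok (F : realType) I J K R (A : 'M[F]_(I, R)) (B : 'M[F]_(J, R)) (C : 'M[F]_(K, R)) :
  compound_condition A B C -> finds_cpd (cpd_procedure I J K) (cpd_tensor A B C).
Proof.
move=> cond; have rk := condition_rank cond; set T := cpd_tensor A B C in rk *.
have [n [k [Rnk kK [nIJ nR] H kC]]] := condition_facts cond.
suff G : good T (slices T) (foldr (attempts I J K) (fun=> Fail) (iota 0 (I + K))).
  by have := G _ (ext_refl _); rewrite size_map size_enum_ord.
have hit q : good T (slices T) (attempts I J K R q).
  have in_iota : k \in iota 0 K.+1 by rewrite mem_iota.
  apply: (@foldr_good_hit F I J K T _ _ _ _ q k in_iota) => [y _ q' gq'|q'].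
  - by apply: attempt_safe gq' => //; [apply: ext_refl | rewrite rk].
  - have -> : (R.+1 - k = n)%N by lia.
    by apply: attempt_sure; rewrite ?rk.
have RIK : (R < I + K)%N by lia.
have -> : iota 0 (I + K) = iota 0 R ++ R :: iota R.+1 (I + K - R.+1).
  have -> : (I + K = R + (I + K - R.+1).+1)%N by lia.
  by rewrite iotaD /= add0n; congr (_ ++ _ :: iota _ _); lia.
rewrite foldr_cat; apply: foldr_good; last exact: hit.
move=> R' R'R q gq; rewrite mem_iota add0n /= in R'R.
apply: foldr_good gq => y _ q' gq'.
by apply: attempt_safe gq' => //; [apply: ext_refl | rewrite rk ltnW].
Qed.

Theorem theorem1p7 (F : realType) (I J K : nat) :
  (forall (R : nat) (A : 'M[F]_(I, R)) (B : 'M[F]_(J, R)) (C : 'M[F]_(K, R)),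
     compound_condition A B C ->
     tensor_rank (cpd_tensor A B C) = R /\ cpd_unique (cpd_tensor A B C)) /\
  (exists p : procedure,
     forall (R : nat) (A : 'M[F]_(I, R)) (B : 'M[F]_(J, R)) (C : 'M[F]_(K, R)),
     compound_condition A B C -> finds_cpd p (cpd_tensor A B C)).
Proof.
split=> [R A B C cond|]; first by split; [apply: condition_rank | apply: condition_unique].
by exists (cpd_procedure I J K) => R A B C; apply: cpd_procedure_ok.
Qed.
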